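(* Given a dynamic path network with $n$ vertices and general edge capacities, and an integer $k\ge1$, an optimal $k$-sink can be found in $O(n\log^3 n)$ time.
   Context: A dynamic path network $P$ consists of vertices $v_1,\dots,v_n$ arranged from left to right on a path; vertex $v_i$ has an integral weight $w_i>0$, and each edge $e_i=(v_i,v_{i+1})$ has a non-negative length $l_i$ and a capacity $c_i>0$; $\tau>0$ is the transit time per unit distance. $d(a,b)$ is the (prorated) distance between points $a,b$ of $P$; $c(a,b)$ is the minimum capacity of the edges between $a$ and $b$ (with $c(a,a)=+\infty$); $P[a,b]$ is the subpath from $a$ to $b$, $V[a,b]$ its vertex set; $W[v_i,v_j]=\sum_{l=i}^j w_l$. For a subpath $P[v_i,v_j]$ and sink $s\in P[v_i,v_j]$, the evacuation time is $\Theta(s,[v_i,v_j])=\max\{\max_{v_h\in V[v_i,s]}(d(v_h,s)\tau+W[v_i,v_h]/c(v_h,s)),\ \max_{v_h\in V[s,v_j]}(d(s,v_h)\tau+W[v_h,v_j]/c(s,v_h))\}$. The $k$-sink problem: choose $m\le k$, indices $0=j_0<j_1<\dots<j_m=n$ and sinks $s_q\in P[v_{j_{q-1}+1},v_{j_q}]$ minimizing $\max_q\Theta(s_q,[v_{j_{q-1}+1},v_{j_q}])$; an optimal $k$-sink is a choice attaining the minimum. *)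

(* Defs.v *)
From HB Require Import structures.
From mathcomp Require Import all_boot all_order all_algebra.
From mathcomp Require Import all_classical all_reals all_analysis.

Set Implicit Arguments.
Unset Strict Implicit.
Unset Printing Implicit Defensive.

Import Order.TTheory GRing.Theory Num.Theory.
Import numFieldNormedType.Exports.

Local Open Scope ring_scope.

(** * Dynamic path networks and the k-sink problem

    Vertices are numbered from 0: they are v_0, ..., v_(n-1), and edge e_i joins
    v_i to v_(i+1), for i < n-1. *)

Record path_network (R : realType) (n : nat) := PathNetwork {
  weight : n.-tuple nat;
  edge_length : n.-1.-tuple R;
  edge_capacity : n.-1.-tuple R;
  transit_time : R;
  weight_gt0 : all (fun w => 0 < w)%N weight;
  edge_length_ge0 : all (fun l => 0 <= l) edge_length;
  edge_capacity_gt0 : all (fun c => 0 < c) edge_capacity;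
  transit_time_gt0 : 0 < transit_time }.

(** A point of the path is a pair (i, x): v_i is the last vertex at or before
    it, and x is its distance from v_i.  Thus (i, 0) is the vertex v_i, and
    (i, x) with 0 < x < l_i is an interior point of e_i.  An edge of length 0 has
    no interior point, but its two end vertices remain distinct points. *)
Definition point (R : realType) : Type := (nat * R)%type.

Definition vertex (R : realType) (i : nat) : point R := (i, 0).

(** Index of the first vertex at or after a point. *)
Definition next_vertex (R : realType) (s : point R) : nat :=
  (s.1 + (s.2 != 0)%R)%N.

Section Network.
Variables (R : realType) (n : nat) (P : path_network R n).

Definition in_subpath (i j : nat) (s : point R) : bool :=
  (i <= s.1)%N && (next_vertex s <= j)%N &&
  ((s.2 == 0) || (0 < s.2 < nth 0 (edge_length P) s.1)).

Definition position (s : point R) : R :=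
  \sum_(0 <= h < s.1) nth 0 (edge_length P) h + s.2.

Definition dist (a b : point R) : R := `|position b - position a|.

(** Minimum capacity of the edges met strictly between [a] and [b], where [a] is
    at or to the left of [b]. *)
Definition capacity (a b : point R) : \bar R :=
  (if a == b then +oo
   else \big[mine/+oo]_(a.1 <= h < next_vertex b)
          (nth 0%R (edge_capacity P) h)%:E)%E.

Definition total_weight (i j : nat) : nat :=
  (\sum_(i <= l < j.+1) nth 0 (weight P) l)%N.

(** Evacuation time to [s] of the subpath from v_i to v_j (both included), for
    [s] in it.  When [s] is a vertex, it belongs to both vertex sets and
    contributes 0 to each maximum, as the inverse of [+oo] is 0. *)
Definition evacuation_time (s : point R) (i j : nat) : \bar R :=
  maxe
    (\big[maxe/-oo]_(i <= h < s.1.+1)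
       ((dist (vertex R h) s * transit_time P)%:E +
        (total_weight i h)%:R%:E / capacity (vertex R h) s))%E
    (\big[maxe/-oo]_(next_vertex s <= h < j.+1)
       ((dist s (vertex R h) * transit_time P)%:E +
        (total_weight h j)%:R%:E / capacity s (vertex R h)))%E.

End Network.

(** The q-th subpath (q < parts) goes from v_(cut q) to v_(cut (q+1) - 1) and is
    served by [sink q]; only [cut 0, ..., cut parts] and
    [sink 0, ..., sink (parts-1)] are meaningful. *)
Record solution (R : realType) := Solution {
  parts : nat;
  cut : nat -> nat;
  sink : nat -> point R }.

Section Sinks.
Variables (R : realType) (n : nat) (P : path_network R n) (k : nat).

Definition feasible (S : solution R) : Prop :=
  [/\ (parts S <= k)%N, cut S 0 = 0%N, cut S (parts S) = n,
      forall q, (q < parts S)%N -> (cut S q < cut S q.+1)%N &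
      forall q, (q < parts S)%N ->
        in_subpath P (cut S q) (cut S q.+1).-1 (sink S q)].

Definition objective (S : solution R) : \bar R :=
  (\big[maxe/-oo]_(0 <= q < parts S)
     evacuation_time P (sink S q) (cut S q) (cut S q.+1).-1)%E.

Definition optimal_k_sink (S : solution R) : Prop :=
  feasible S /\
  forall S' : solution R, feasible S' -> (objective S <= objective S')%E.

End Sinks.

(** * A unit-cost real RAM

    A program is a fixed finite text of a while language.  Its memory consists of
    integer cells and real cells, both addressed by an array name, which is a
    constant of the program text, and a computed index; a scalar variable is a
    cell at a constant index.  Index arithmetic is addition, truncated
    subtraction and halving; real cells support the four field operations and
    comparison.  There is no operation from reals to integers other than
    branching on a comparison, and the only literals are natural numbers. *)

Inductive iexpr : Type :=
| ILit of nat
| IGet of nat & iexpr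
| IAdd of iexpr & iexpr
| ISub of iexpr & iexpr
| IHalf of iexpr.

Inductive rexpr : Type :=
| ROfI of iexpr
| RGet of nat & iexpr
| RAdd of rexpr & rexpr
| RSub of rexpr & rexpr
| RMul of rexpr & rexpr
| RDiv of rexpr & rexpr.

Inductive bexpr : Type :=
| BILe of iexpr & iexpr
| BRLe of rexpr & rexpr
| BNot of bexpr
| BAnd of bexpr & bexpr.

Inductive cmd : Type :=
| Skip
| ISet of nat & iexpr & iexpr
| RSet of nat & iexpr & rexpr
| Seq of cmd & cmd
| If of bexpr & cmd & cmd
| While of bexpr & cmd.

(** The cost of evaluating an expression is its number of operations,
    literals and memory accesses. *)
Fixpoint icost (e : iexpr) : nat :=
  match e with
  | ILit _ => 1
  | IGet _ e1 | IHalf e1 => (icost e1).+1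
  | IAdd e1 e2 | ISub e1 e2 => (icost e1 + icost e2).+1
  end.

Fixpoint rcost (e : rexpr) : nat :=
  match e with
  | ROfI e1 | RGet _ e1 => (icost e1).+1
  | RAdd e1 e2 | RSub e1 e2 | RMul e1 e2 | RDiv e1 e2 =>
      (rcost e1 + rcost e2).+1
  end.

Fixpoint bcost (b : bexpr) : nat :=
  match b with
  | BILe e1 e2 => (icost e1 + icost e2).+1
  | BRLe e1 e2 => (rcost e1 + rcost e2).+1
  | BNot b1 => (bcost b1).+1
  | BAnd b1 b2 => (bcost b1 + bcost b2).+1
  end.

Record memory (R : realType) := Memory {
  imem : nat -> nat -> nat;
  rmem : nat -> nat -> R }.

Definition update (A : Type) (f : nat -> nat -> A) (a i : nat) (x : A) :
    nat -> nat -> A :=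
  fun b j => if (b == a) && (j == i) then x else f b j.

Section Semantics.
Variable R : realType.
Implicit Type m : memory R.

Fixpoint ieval m (e : iexpr) : nat :=
  match e with
  | ILit c => c
  | IGet a e1 => imem m a (ieval m e1)
  | IAdd e1 e2 => (ieval m e1 + ieval m e2)%N
  | ISub e1 e2 => (ieval m e1 - ieval m e2)%N
  | IHalf e1 => (ieval m e1)./2
  end.

Fixpoint reval m (e : rexpr) : R :=
  match e with
  | ROfI e1 => (ieval m e1)%:R
  | RGet a e1 => rmem m a (ieval m e1)
  | RAdd e1 e2 => reval m e1 + reval m e2
  | RSub e1 e2 => reval m e1 - reval m e2
  | RMul e1 e2 => reval m e1 * reval m e2
  | RDiv e1 e2 => reval m e1 / reval m e2
  end.

Fixpoint beval m (b : bexpr) : bool :=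
  match b with
  | BILe e1 e2 => (ieval m e1 <= ieval m e2)%N
  | BRLe e1 e2 => reval m e1 <= reval m e2
  | BNot b1 => ~~ beval m b1
  | BAnd b1 b2 => beval m b1 && beval m b2
  end.

(** [exec c m t m']: started in memory [m], program [c] halts after exactly [t]
    unit-cost steps with memory [m']. *)
Inductive exec : cmd -> memory R -> nat -> memory R -> Prop :=
| exec_skip m : exec Skip m 1 m
| exec_iset m a e1 e2 :
    exec (ISet a e1 e2) m (icost e1 + icost e2).+1
      (Memory (update (imem m) a (ieval m e1) (ieval m e2)) (rmem m))
| exec_rset m a e1 e2 :
    exec (RSet a e1 e2) m (icost e1 + rcost e2).+1
      (Memory (imem m) (update (rmem m) a (ieval m e1) (reval m e2)))
| exec_seq c1 c2 m t1 m1 t2 m2 :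
    exec c1 m t1 m1 -> exec c2 m1 t2 m2 ->
    exec (Seq c1 c2) m (t1 + t2) m2
| exec_if b c1 c2 m t m' :
    exec (if beval m b then c1 else c2) m t m' ->
    exec (If b c1 c2) m (bcost b + t).+1 m'
| exec_while_false b c m :
    ~~ beval m b -> exec (While b c) m (bcost b).+1 m
| exec_while_true b c m t1 m1 t2 m2 :
    beval m b -> exec c m t1 m1 -> exec (While b c) m1 t2 m2 ->
    exec (While b c) m ((bcost b).+1 + t1 + t2) m2.

End Semantics.

(** Input: integer array 0 is (n, k); real arrays 0, 1, 2, 3 are the weights, the
    lengths, the capacities and the transit time; every other cell is 0. *)
Definition input (R : realType) (n : nat) (P : path_network R n) (k : nat) :
    memory R :=
  Memory
    (fun a i => if a is 0 then nth 0%N [:: n; k] i else 0%N)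
    (fun a i =>
       match a with
       | 0 => (nth 0%N (weight P) i)%:R
       | 1 => nth 0 (edge_length P) i
       | 2 => nth 0 (edge_capacity P) i
       | 3 => nth 0 [:: transit_time P] i
       | _ => 0
       end).

(** Output: cell 0 of integer array 1 is the number of parts, integer array 2 is
    the list of cuts, and the q-th sink is given by the q-th cells of integer
    array 3 (its base vertex) and of real array 4 (its distance from it). *)
Definition output (R : realType) (m : memory R) : solution R :=
  Solution (imem m 1 0) (imem m 2) (fun q => (imem m 3 q, rmem m 4 q)).

(* Main.v *)
(** The path is followed by its mirror image, so that one data structure answers
    evacuation costs on both sides of a sink.  It is a segment tree whose nodes
    store just enough (the largest inverse capacity, the crossing of the two
    upper envelopes below, and a threshold telling which half holds the worst
    pair) to find the left cost L(i, s) of v_i, ..., v_s at v_s in O(log^2 n)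
    steps; it is built bottom up by searching the part already built.

    A cost t is feasible iff greedily taking the longest subpaths of cost at most
    t, from left to right, leaves at most k of them; this takes O(n log^2 n)
    steps.  The greedy choice at v_i depends on t only through comparisons with
    the entries of two matrices with nondecreasing rows: first L(i, s), which
    gives the base vertex s of the sink, then the least cost of v_i, ..., v_j
    with a sink just after v_s.  In each matrix one repeatedly tests the weighted
    median of the middle entries of the undecided rows, which discards a quarter
    of the candidates, so that O(log n) tests leave no entry strictly between
    an infeasible cost and a feasible one.  The latter is then optimal, because
    the greedy choices are constant in between. *)
Require Import Defs.
From mathcomp Require Import all_boot all_order all_algebra.
From mathcomp Require Import all_classical all_reals all_analysis.
From mathcomp Require Import zify ring lra.
Import Order.TTheory GRing.Theory Num.Theory.
Import numFieldNormedType.Exports.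
Local Open Scope classical_set_scope.
Local Open Scope ring_scope.

Set Implicit Arguments.
Unset Strict Implicit.
Unset Printing Implicit Defensive.

(** * Programs with a bound on their running time *)

(** With general capacities the bottleneck between a vertex and the sink depends on both ends, so no
    prefix quantity yields the cost. Since dividing by a minimum is maximizing quotients, each edge
    on the way can be charged separately: costs become maxima over pairs of a vertex and a later
    edge, and such maxima split over tree blocks.

    The machine cannot round reals, so the optimum has to be hit exactly, among finitely many
    values. A sink inside an edge gives candidates indexed by three vertices: the start i, the base
    s and the end j. The greedy choice always takes the farthest base, and this base is settled for
    every i once no left cost lies strictly between the two bounds. Hence the order of the two
    searches: the first fixes s in each row, and the second is left with a matrix in i and j.

    Sizes are rounded up to N = 2^l with 2n <= N < 4n, so that the doubled path fits, and times are
    stated with l + 1, which is positive whatever l is. *)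

Notation "c1 ';;' c2" := (Seq c1 c2) (at level 90, right associativity).

Fixpoint iwrites (c : cmd) : seq nat :=
  match c with
  | ISet a _ _ => [:: a]
  | Seq c1 c2 | If _ c1 c2 => iwrites c1 ++ iwrites c2
  | While _ c1 => iwrites c1
  | _ => [::]
  end.

Fixpoint rwrites (c : cmd) : seq nat :=
  match c with
  | RSet a _ _ => [:: a]
  | Seq c1 c2 | If _ c1 c2 => rwrites c1 ++ rwrites c2
  | While _ c1 => rwrites c1
  | _ => [::]
  end.

Fixpoint straight (c : cmd) : bool :=
  match c with
  | Seq c1 c2 | If _ c1 c2 => straight c1 && straight c2
  | While _ _ => false
  | _ => true
  end.

(** Adding up both branches of a conditional avoids maxima at the price of a constant factor. The
    value at a loop is a dummy: uses are restricted to [straight] programs. *)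
Fixpoint scost (c : cmd) : nat :=
  match c with
  | Skip => 1
  | ISet _ e1 e2 => (icost e1 + icost e2).+1
  | RSet _ e1 e2 => (icost e1 + rcost e2).+1
  | Seq c1 c2 => scost c1 + scost c2
  | If b c1 c2 => (bcost b + (scost c1 + scost c2)).+1
  | While _ _ => 0
  end.

Section Runs.
Variable R : realType.
Implicit Types (m : memory R) (c : cmd) (Q : memory R -> Prop).

(** Arrays are tracked by name only, which makes the preservation of a cell by a concrete program a
    boolean test settled by computation. *)
Definition frame c m m' : Prop :=
  (forall a i, a \notin iwrites c -> imem m' a i = imem m a i) /\
  (forall a i, a \notin rwrites c -> rmem m' a i = rmem m a i).

Definition runs c m (T : nat) Q : Prop :=
  exists t m', [/\ exec c m t m', (t <= T)%N & Q m'].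

Fixpoint sem c m : memory R :=
  match c with
  | ISet a e1 e2 => Memory (update (imem m) a (ieval m e1) (ieval m e2)) (rmem m)
  | RSet a e1 e2 => Memory (imem m) (update (rmem m) a (ieval m e1) (reval m e2))
  | Seq c1 c2 => sem c2 (sem c1 m)
  | If b c1 c2 => if beval m b then sem c1 m else sem c2 m
  | _ => m
  end.

Lemma frame_refl c m : frame c m m.
Proof. by []. Qed.

Lemma frame_trans c m1 m2 m3 : frame c m1 m2 -> frame c m2 m3 -> frame c m1 m3.
Proof.
by move=> [i1 r1] [i2 r2]; split=> a i H; [rewrite i2 ?i1|rewrite r2 ?r1].
Qed.

Lemma frame_weaken c c' m m' : {subset iwrites c <= iwrites c'} ->
  {subset rwrites c <= rwrites c'} -> frame c m m' -> frame c' m m'.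
Proof.
move=> ic rc [fi fr]; split=> a i Ha; [apply: fi|apply: fr].
  by apply: contra Ha => /ic.
by apply: contra Ha => /rc.
Qed.

Lemma exec_frame c m t m' : exec c m t m' -> frame c m m'.
Proof.
elim=> {c m t m'} //=.
- move=> m a e1 e2; split=> b i //=.
  by rewrite inE /update => /negbTE ->.
- move=> m a e1 e2; split=> b i //=.
  by rewrite inE /update => /negbTE ->.
- move=> c1 c2 m t1 m1 t2 m2 _ [i1 r1] _ [i2 r2].
  by split=> a i /=; rewrite mem_cat negb_or => /andP[H1 H2]; rewrite ?i2 ?r2 ?i1 ?r1.
- move=> b c1 c2 m t m' _ [i1 r1].
  by split=> a i /=; rewrite mem_cat negb_or => /andP[H1 H2];
    [rewrite i1|rewrite r1] => //; case: ifP.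
- by move=> b c m t1 m1 t2 m2 _ _ [i1 r1] _ [i2 r2]; split=> a i H /=;
    rewrite ?i2 ?r2 ?i1 ?r1.
Qed.

Lemma runs_le c m T T' Q : (T <= T')%N -> runs c m T Q -> runs c m T' Q.
Proof.
by move=> TT' [t [m' [e le q]]]; exists t, m'; split=> //; apply: leq_trans TT'.
Qed.

Lemma runs_post c m T Q Q' : (forall m', frame c m m' -> Q m' -> Q' m') ->
  runs c m T Q -> runs c m T Q'.
Proof.
move=> QQ' [t [m' [e le q]]]; exists t, m'; split=> //.
exact: QQ' (exec_frame e) q.
Qed.

Lemma runs_seq c1 c2 m T1 T2 Q1 Q :
  runs c1 m T1 Q1 ->
  (forall m1, frame c1 m m1 -> Q1 m1 -> runs c2 m1 T2 Q) ->
  runs (c1 ;; c2) m (T1 + T2) Q.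
Proof.
move=> [t1 [m1 [e1 le1 q1]]] /(_ m1 (exec_frame e1) q1) [t2 [m2 [e2 le2 q2]]].
by exists (t1 + t2)%N, m2; split=> //; [apply: exec_seq e2|apply: leq_add].
Qed.

Lemma straight_exec c m : straight c ->
  exists2 t, exec c m t (sem c m) & (t <= scost c)%N.
Proof.
elim: c m => [|a e1 e2|a e1 e2|c1 IH1 c2 IH2|b c1 IH1 c2 IH2|] m //=.
- by exists 1%N => //; constructor.
- by move=> _; eexists; [constructor|].
- by move=> _; eexists; [constructor|].
- move=> /andP[/(IH1 m)[t1 e1 l1] /(IH2 (sem c1 m))[t2 e2 l2]].
  by exists (t1 + t2)%N; [apply: exec_seq e2|apply: leq_add].
- move=> /andP[/(IH1 m)[t1 e1 l1] /(IH2 m)[t2 e2 l2]].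
  exists (bcost b + (if beval m b then t1 else t2)).+1.
    by constructor; case: ifP.
  by rewrite ltnS leq_add2l; case: ifP => _; lia.
Qed.

Lemma runs_straight c m Q : straight c -> Q (sem c m) -> runs c m (scost c) Q.
Proof. by move=> /(straight_exec m)[t e le] q; exists t, (sem c m). Qed.

Lemma runs_straight_seq c1 c2 m T Q : straight c1 ->
  (forall m1, frame c1 m m1 -> m1 = sem c1 m -> runs c2 m1 T Q) ->
  runs (c1 ;; c2) m (scost c1 + T) Q.
Proof.
by move=> s; apply: (runs_seq (Q1 := fun m1 => m1 = sem c1 m)); apply: runs_straight.
Qed.

Lemma runs_if b c1 c2 m T1 T2 Q :
  (beval m b -> runs c1 m T1 Q) -> (~~ beval m b -> runs c2 m T2 Q) ->
  runs (If b c1 c2) m (bcost b + T1 + T2).+1 Q.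
Proof.
move=> r1 r2; case bm: (beval m b) r1 r2.
  move=> /(_ isT) [t [m' [e le q]]] _; exists (bcost b + t).+1, m'.
  by split=> //; [constructor; rewrite bm|lia].
move=> _ /(_ isT) [t [m' [e le q]]]; exists (bcost b + t).+1, m'.
by split=> //; [constructor; rewrite bm|lia].
Qed.

(** An iteration may be long if it lowers the potential accordingly. This amortizes the greedy test,
    where an iteration costs in proportion to the length of the subpath it takes. *)
Lemma runs_while_potential b c m0 K (I : nat -> memory R -> Prop) v0 :
  (forall v m, frame c m0 m -> I v m -> beval m b ->
     exists2 d, (0 < d <= v)%N & runs c m (K * d) (I (v - d)%N)) ->
  I v0 m0 ->
  runs (While b c) m0 ((K + (bcost b).+1) * v0 + (bcost b).+1)
    (fun m => (exists v, I v m) /\ ~~ beval m b).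
Proof.
move=> step I0.
suff: forall v m, frame c m0 m -> I v m ->
    runs (While b c) m ((K + (bcost b).+1) * v + (bcost b).+1)
      (fun m => (exists v, I v m) /\ ~~ beval m b).
  by apply=> //; apply: frame_refl.
elim/ltn_ind=> v IH m fr Iv.
case bm: (beval m b); last first.
  exists (bcost b).+1, m; split; [by constructor; rewrite bm|lia|].
  by split; [exists v|rewrite bm].
have [d /andP[d0 dv] [t [m' [e le Im']]]] := step v m fr Iv bm.
have [||t2 [m2 [e2 le2 [I2 nb2]]]] := IH (v - d)%N _ m' _ Im'; first lia.
  exact: frame_trans fr (exec_frame e).
exists ((bcost b).+1 + t + t2)%N, m2; split=> //.
  exact: exec_while_true e e2.
move: le2; rewrite mulnBr; nia.
Qed.

Lemma runs_while b c m0 K (I : nat -> memory R -> Prop) v0 :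
  (forall v m, frame c m0 m -> I v m -> beval m b ->
     runs c m K (fun m' => exists2 v', (v' < v)%N & I v' m')) ->
  I v0 m0 ->
  runs (While b c) m0 ((K + (bcost b).+1) * v0 + (bcost b).+1)
    (fun m => (exists v, I v m) /\ ~~ beval m b).
Proof.
move=> step I0.
(* Weakening [I] to [J] lets an iteration that lowers the measure by more than one be charged for
   exactly one. *)
pose J v m := exists2 v', (v' <= v)%N & I v' m.
have J0 : J v0 m0 by exists v0.
have := runs_while_potential (b := b) (c := c) (K := K) (I := J) (v0 := v0) (m0 := m0).
case=> //.
  move=> v m fr [v' le Iv'] bm.
  have [t [m' [e let_ [v'' lt Iv'']]]] := step v' m fr Iv' bm.
  exists 1%N; first lia.
  exists t, m'; split=> //; first by rewrite muln1.
  by exists v'' => //; lia.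
move=> t [m' [e le [[v [v' _ Iv]] nb]]].
by exists t, m'; split=> //; split=> //; exists v'.
Qed.

End Runs.

(** * Envelopes *)

Lemma bigmax_natP d (T : orderType d) (F : nat -> T) x0 a b t :
  (\big[Order.max/x0]_(a <= h < b) F h <= t)%O <->
  ((x0 <= t)%O /\ forall h, (a <= h)%N -> (h < b)%N -> (F h <= t)%O).
Proof.
split=> [H|[H0 H]].
  split=> [|h ah hb]; apply: le_trans H; first exact: bigmax_ge_id.
  by apply: le_bigmax_seq; rewrite // mem_index_iota ah.
rewrite big_seq; apply: bigmax_le => // h.
by rewrite mem_index_iota => /andP[]; apply: H.
Qed.

Section Envelopes.
Variables (R : realType) (S E r : nat -> R).
Hypothesis S_lt : forall h, S h < S h.+1.
Hypothesis E_le : forall h, E h <= E h.+1.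
Hypothesis r_ge0 : forall h, 0 <= r h.

(* [S] stands for the prefix sums of the weights, [E] for those of the transit
   times and [r] for the inverse capacities.  Vertex h waiting at edge g costs
   [E s + pairv i h g] at the sink s; maximizing over all pairs h <= g < s brings
   in the minimum capacity between h and s without computing it.  For a fixed
   bound [z] on [r g], the best h is read off an upper envelope of lines. *)
Definition line h z := S h.+1 * z - E h.

Definition pairv i h g := (S h.+1 - S i) * r g - E h.

Fixpoint env p a z :=
  if p is p'.+1 then Num.max (env p' a z) (env p' (a + 2 ^ p')%N z)
  else line a z.

Fixpoint rho p a :=
  if p is p'.+1 then Num.max (rho p' a) (rho p' (a + 2 ^ p')%N) else r a.

(* Pairs with h in the left half of a block of size 2^(p+1) and g in the right
   half: the best g is the one of largest [r], whatever i is. *)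
Definition cross p a i :=
  env p a (rho p (a + 2 ^ p)%N) - S i * rho p (a + 2 ^ p)%N.

Fixpoint pairs p a i :=
  if p is p'.+1 then
    Num.max (pairs p' a i) (Num.max (cross p' a i) (pairs p' (a + 2 ^ p')%N i))
  else pairv i a a.

Lemma S_homo i j : (i <= j)%N -> S i <= S j.
Proof. by apply: (homo_leq (fun x => lexx x) (@le_trans _ _)) => h; apply: ltW. Qed.

Lemma S_homo_lt i j : (i < j)%N -> S i < S j.
Proof. by move=> ij; apply: lt_le_trans (S_lt i) (S_homo ij). Qed.

Lemma E_homo i j : (i <= j)%N -> E i <= E j.
Proof. by apply: (homo_leq (fun x => lexx x) (@le_trans _ _)). Qed.

Lemma env_ge p a z h : (a <= h < a + 2 ^ p)%N -> line h z <= env p a z.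
Proof.
elim: p a => [|p IH] a /= H.
  by have -> : h = a by move: H; rewrite expn0; lia.
rewrite le_max; case: (ltnP h (a + 2 ^ p)) => H'.
  by rewrite IH //; lia.
by rewrite orbC IH //; move: H; rewrite expnS; lia.
Qed.

Lemma env_ex p a z : exists2 h, (a <= h < a + 2 ^ p)%N & env p a z = line h z.
Proof.
elim: p a => [|p IH] a /=; first by exists a; rewrite // expn0; lia.
case: (leP (env p a z)) => _.
  by have [h H ->] := IH (a + 2 ^ p)%N; exists h => //; rewrite expnS; lia.
by have [h H ->] := IH a; exists h => //; rewrite expnS; lia.
Qed.

Lemma rho_ge p a h : (a <= h < a + 2 ^ p)%N -> r h <= rho p a.
Proof.
elim: p a => [|p IH] a /= H.
  by have -> : h = a by move: H; rewrite expn0; lia.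
rewrite le_max; case: (ltnP h (a + 2 ^ p)) => H'.
  by rewrite IH //; lia.
by rewrite orbC IH //; move: H; rewrite expnS; lia.
Qed.

Lemma rho_ex p a : exists2 h, (a <= h < a + 2 ^ p)%N & rho p a = r h.
Proof.
elim: p a => [|p IH] a /=; first by exists a; rewrite // expn0; lia.
case: (leP (rho p a)) => _.
  by have [h H ->] := IH (a + 2 ^ p)%N; exists h => //; rewrite expnS; lia.
by have [h H ->] := IH a; exists h => //; rewrite expnS; lia.
Qed.

Lemma rho_ge0 p a : 0 <= rho p a.
Proof. by have [h _ ->] := rho_ex p a. Qed.

Lemma pairv_le i h g z : (i <= h)%N -> r g <= z -> pairv i h g <= line h z - S i * z.
Proof.
move=> ih gz; rewrite /pairv /line.
have := @S_homo i h.+1 (leqW ih); nra.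
Qed.

Lemma pairs_ge p a i h g : (i <= a)%N -> (a <= h)%N -> (h <= g)%N ->
  (g < a + 2 ^ p)%N -> pairv i h g <= pairs p a i.
Proof.
elim: p a => [|p IH] a /= ia ah hg gb.
  have [-> ->] // : h = a /\ g = a by move: gb; rewrite expn0; lia.
rewrite !le_max; case: (ltnP g (a + 2 ^ p)) => H1.
  by rewrite IH.
case: (ltnP h (a + 2 ^ p)) => H2; last first.
  by rewrite (IH (a + 2 ^ p)%N) ?orbT //; move: gb; rewrite ?expnS; lia.
(* Here h is in the left half and g in the right one. The weight S h.+1 - S i is nonnegative, so
   replacing [r g] by the largest value on the right can only increase the cost. *)
apply/orP; right; apply/orP; left; rewrite /cross.
apply: le_trans (pairv_le (z := rho p (a + 2 ^ p)%N) _ _) _; first by lia.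
  by apply: rho_ge; move: gb; rewrite expnS; lia.
by rewrite lerD2r env_ge //; lia.
Qed.

Lemma pairs_ex p a i : exists h g,
  [/\ (a <= h)%N, (h <= g)%N, (g < a + 2 ^ p)%N & pairs p a i = pairv i h g].
Proof.
elim: p a => [|p IH] a /=; first by exists a, a; split=> //; rewrite expn0; lia.
have [h1 [g1 [H1 H2 H3 e1]]] := IH a.
have [h2 [g2 [H4 H5 H6 e2]]] := IH (a + 2 ^ p)%N.
have [g3 H7 e3] := rho_ex p (a + 2 ^ p)%N.
have [h3 H8 e4] := env_ex p a (rho p (a + 2 ^ p)%N).
rewrite expnS; case: (leP (pairs p a i)) => _; last first.
  by exists h1, g1; split=> //; lia.
case: (leP (cross p a i)) => _; first by exists h2, g2; split=> //; lia.
exists h3, g3; split; [lia|lia|lia|].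
by rewrite /cross e4 e3 /line /pairv; ring.
Qed.

(* Lines of later vertices are steeper, so the envelopes of the two halves of a
   block cross once. *)
Definition crossing p a z0 := forall z,
  (z <= z0 -> env p (a + 2 ^ p)%N z <= env p a z) /\
  (z0 <= z -> env p a z <= env p (a + 2 ^ p)%N z).

Lemma crossing_eq p a z0 : crossing p a z0 -> env p a z0 = env p (a + 2 ^ p)%N z0.
Proof. by move=> /(_ z0)[/(_ (lexx _)) H1 /(_ (lexx _)) H2]; apply/le_anti/andP. Qed.

Lemma line_cross h k z0 z : (h < k)%N -> line h z0 = line k z0 ->
  (z <= z0 -> line k z <= line h z) /\ (z0 <= z -> line h z <= line k z).
Proof.
move=> hk; rewrite /line => e0; have ? := @S_homo_lt h.+1 k.+1 hk.
by split=> H; nra.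
Qed.

Definition meet h k := (E k - E h) / (S k.+1 - S h.+1).

Lemma meetP h k : (h < k)%N -> line h (meet h k) = line k (meet h k).
Proof.
move=> hk; rewrite /line /meet; have ? := @S_homo_lt h.+1 k.+1 hk.
field; lra.
Qed.

(** The threshold is a minimax: the minimum over right lines of the maximum over left lines of the
    abscissa where they meet. Below it each right line is dominated by some left line; above it the
    minimizing right line dominates all left lines. *)
Lemma crossing_ex p a : exists z0, crossing p a z0.
Proof.
have p0 : (0 < 2 ^ p)%N by rewrite expn_gt0.
pose X (h k : 'I_(2 ^ p)) := meet (a + h) (a + 2 ^ p + k).
have ltX (h k : 'I_(2 ^ p)) : (a + h < a + 2 ^ p + k)%N by have := ltn_ord h; lia.
pose i0 := Ordinal p0.
pose H k := [arg max_(h > i0) X h k]%O.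
pose k0 := [arg min_(k < i0) X (H k) k]%O.
have maxH k h : X h k <= X (H k) k.
  by rewrite /H; case: arg_maxP => //= j _; apply.
have mink k : X (H k0) k0 <= X (H k) k.
  by rewrite /k0; case: arg_minP => //= j _; apply.
exists (X (H k0) k0) => z; split=> Hz.
- have [h hb ->] := env_ex p (a + 2 ^ p) z.
  have hb' : (h - (a + 2 ^ p) < 2 ^ p)%N by lia.
  pose k := Ordinal hb'.
  have -> : h = (a + 2 ^ p + k)%N by rewrite /=; lia.
  apply: le_trans (env_ge (h := (a + H k)%N) _ _); last by have := ltn_ord (H k); lia.
  have [L1 _] := line_cross z (ltX (H k) k) (meetP (ltX (H k) k)).
  apply: L1; exact: le_trans Hz (mink k).
- have [h hb ->] := env_ex p a z.
  have hb' : (h - a < 2 ^ p)%N by lia.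
  pose h' := Ordinal hb'.
  have -> : h = (a + h')%N by rewrite /=; lia.
  apply: le_trans (env_ge (h := (a + 2 ^ p + k0)%N) _ _); last by have := ltn_ord k0; lia.
  have [_ L1] := line_cross z (ltX h' k0) (meetP (ltX h' k0)).
  apply: L1; exact: le_trans (maxH _ _) Hz.
Qed.

(** This is how the construction obtains [z0]: one division, once the lines on both envelopes at
    [z0] have been identified. *)
Lemma crossing_meet p a z0 h k : crossing p a z0 -> (h < k)%N ->
  env p a z0 = line h z0 -> env p (a + 2 ^ p)%N z0 = line k z0 ->
  meet h k = z0.
Proof.
move=> c0 hk e1 e2; have := crossing_eq c0; rewrite e1 e2 /line /meet => e.
have ? := @S_homo_lt h.+1 k.+1 hk.
have -> : E k - E h = (S k.+1 - S h.+1) * z0 by lra.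
by field; lra.
Qed.

(* Antitone in i, hence stored at a tree node as a threshold on i. *)
Definition left_wins p a i :=
  Num.max (cross p a i) (pairs p (a + 2 ^ p)%N i) <= pairs p a i.

(** If the left half wins, its best pair (h, g) beats the crossing pair at h, so r g >= z, the
    largest inverse capacity on the right. Starting earlier adds a weight d, which raises that pair
    by d r g, but the crossing and the right pairs by at most d z. *)
Lemma left_wins_down p a i i' : (i' <= i)%N -> (i <= a)%N ->
  left_wins p a i -> left_wins p a i'.
Proof.
move=> i'i ia; rewrite /left_wins !ge_max => /andP[c1 c2].
set b := (a + 2 ^ p)%N in c1 c2 *.
have [h [g [H1 H2 H3 e]]] := pairs_ex p a i.
set z := rho p b in c1 *.
have zr : z <= r g.
  have le1 : line h z - S i * z <= pairv i h g.
    by rewrite -e; apply: le_trans c1; rewrite /cross lerD2r env_ge //; lia.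
  have := @S_homo_lt i h.+1 ltac:(lia); move: le1; rewrite /line /pairv; nra.
have Sii' := S_homo i'i.
have low : pairs p a i + (S i - S i') * r g <= pairs p a i'.
  apply: le_trans (pairs_ge (h := h) (g := g) _ _ _ _) => //; last by lia.
  by rewrite e /pairv; lra.
have z0 : 0 <= z by apply: rho_ge0.
apply/andP; split; apply: le_trans low.
  move: c1; rewrite /cross -/b -/z; nra.
have [h' [g' [H1' H2' H3' ->]]] := pairs_ex p b i'.
have rz : r g' <= z by apply: rho_ge; lia.
have := pairs_ge (p := p) (a := b) (i := i) (h := h') (g := g') ltac:(lia) H1' H2' H3'.
rewrite /pairv; nra.
Qed.

Definition lcost i s :=
  \big[Num.max/0]_(i <= h < s) \big[Num.max/0]_(h <= g < s) (E s + pairv i h g).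

Lemma lcost_leP i s t : lcost i s <= t <->
  (0 <= t /\ forall h g, (i <= h)%N -> (h <= g)%N -> (g < s)%N -> E s + pairv i h g <= t).
Proof.
rewrite /lcost bigmax_natP; split=> -[t0 H]; split=> // h.
  move=> g ih hg gs; have /bigmax_natP[_] := H h ih ltac:(lia); exact.
by move=> ih hs; apply/bigmax_natP; split=> // g hg gs; apply: H.
Qed.

Lemma lcost_ge0 i s : 0 <= lcost i s.
Proof. by have /lcost_leP[] := lexx (lcost i s). Qed.

Lemma lcost_ge i s h g : (i <= h)%N -> (h <= g)%N -> (g < s)%N ->
  E s + pairv i h g <= lcost i s.
Proof. by move: h g; have /lcost_leP[] := lexx (lcost i s). Qed.

Lemma lcost_nil i s : (s <= i)%N -> lcost i s = 0.
Proof. by move=> si; rewrite /lcost big_geq. Qed.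

(** Each old pair is delayed by the transit time of the new edge; the floor 0 of [lcost i s] is
    taken care of by the new pair (s, s). *)
Lemma lcost_step i s : (i < s.+1)%N -> lcost i s + (E s.+1 - E s) <= lcost i s.+1.
Proof.
move=> is1; rewrite -lerBrDr; apply/lcost_leP; split.
  have := @lcost_ge i s.+1 s s ltac:(lia) ltac:(lia) ltac:(lia).
  have := @S_homo i s.+1 ltac:(lia); have := r_ge0 s; rewrite /pairv; nra.
move=> h g H1 H2 H3.
have := @lcost_ge i s.+1 h g H1 H2 ltac:(lia); lra.
Qed.

Lemma lcost_homo i s s' : (s <= s')%N -> lcost i s <= lcost i s'.
Proof.
apply: (homo_leq (fun x => lexx x) (@le_trans _ _)) => {s'}s.
case: (ltnP i s.+1) => H; last by rewrite lcost_nil ?lcost_ge0 //; lia.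
have := lcost_step H; have := E_le s; lra.
Qed.

Lemma lcost_anti i i' s : (i <= i')%N -> lcost i' s <= lcost i s.
Proof.
move=> ii; apply/lcost_leP; split; first exact: lcost_ge0.
move=> h g H1 H2 H3; apply: le_trans (lcost_ge (h := h) (g := g) _ _ _) => //; last by lia.
by rewrite lerD2l /pairv; have := S_homo ii; have := r_ge0 g; nra.
Qed.

End Envelopes.

(** * The segment tree *)

Infix "⊞" := IAdd (at level 50, left associativity).
Infix "⊟" := ISub (at level 50, left associativity).
Infix "⊕" := RAdd (at level 50, left associativity).
Infix "⊖" := RSub (at level 50, left associativity).
Infix "⊗" := RMul (at level 40, left associativity).
Infix "⊘" := RDiv (at level 40, left associativity).
Notation iv a := (IGet a (ILit 0)).
Notation rv a := (RGet a (ILit 0)).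
Notation iset a e := (ISet a (ILit 0) e).
Notation rset a e := (RSet a (ILit 0) e).
Notation ilt e1 e2 := (BILe (e1 ⊞ ILit 1) e2).

(** Integer arrays 0 to 3 and real arrays 0 to 4 hold the input and the output. Each scalar has an
    array of its own, so that frames tell scalars apart. *)
Notation i_N := 4%N.
Notation i_theta := 5%N.
Notation i_x := 6%N.
Notation i_y := 7%N.
Notation i_p := 8%N.
Notation i_qi := 9%N.
Notation i_qs := 10%N.
Notation i_w := 11%N.
Notation i_s := 12%N.
Notation i_q := 13%N.
Notation i_node := 14%N.
Notation i_lo := 15%N.
Notation i_hi := 16%N.
Notation i_mid := 17%N.
Notation i_u := 18%N.

Notation r_tau := 3%N.
Notation r_S := 5%N.
Notation r_E := 6%N.
Notation r_rho := 7%N.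
Notation r_thr := 8%N.
Notation r_K := 9%N.
Notation r_z := 10%N.
Notation r_ev := 11%N.
Notation r_acc := 12%N.
Notation r_Z := 14%N.
Notation r_qr := 15%N.
Notation r_tmp := 16%N.

Definition rmax a e : cmd := If (BRLe (rv a) e) (rset a e) Skip.

Definition env_descent : cmd :=
  While (ilt (iv i_x) (iv i_N))
    (If (BRLe (rv r_z) (RGet r_thr (iv i_x)))
       (iset i_x (iv i_x ⊞ iv i_x))
       (iset i_x (iv i_x ⊞ iv i_x ⊞ ILit 1))) ;;
  rset r_ev (RGet r_S (iv i_x ⊟ iv i_N ⊞ ILit 1) ⊗ rv r_z
             ⊖ RGet r_E (iv i_x ⊟ iv i_N)).

Definition pairs_descent : cmd :=
  While (ilt (iv i_y) (iv i_N))
    (If (ilt (iv i_p) (IGet i_theta (iv i_y)))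
       (iset i_y (iv i_y ⊞ iv i_y))
       (rmax r_acc (RGet r_K (iv i_y) ⊖
          RGet r_S (iv i_p) ⊗ RGet r_rho (iv i_y ⊞ iv i_y ⊞ ILit 1)) ;;
        iset i_y (iv i_y ⊞ iv i_y ⊞ ILit 1))) ;;
  rmax r_acc ((RGet r_S (iv i_y ⊟ iv i_N ⊞ ILit 1) ⊖ RGet r_S (iv i_p))
                ⊗ RGet r_rho (iv i_y)
              ⊖ RGet r_E (iv i_y ⊟ iv i_N)).

(** * Time bounds of the form constant times size *)

Ltac arith := first [lia | nia | split; lia].

Lemma costC a X : (0 < X)%N -> (a <= a * X)%N.
Proof. by move=> X0; rewrite leq_pmulr. Qed.

Lemma costS a : (a <= a * 1)%N.
Proof. by rewrite muln1. Qed.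

Lemma costD a b A B X : (a <= A * X -> b <= B * X -> a + b <= (A + B) * X)%N.
Proof. by rewrite mulnDl; apply: leq_add. Qed.

Lemma costM a b A X Y Z :
  (a <= A * X -> b <= Y -> X * Y <= Z -> a * b <= A * Z)%N.
Proof.
move=> aX bY XY; apply: leq_trans (leq_mul aX bY) _.
by rewrite -mulnA leq_mul2l XY orbT.
Qed.

Lemma costMM a b A B X Y Z :
  (a <= A * X -> b <= B * Y -> X * Y <= Z -> a * b <= (A * B) * Z)%N.
Proof.
move=> aX bY XY; apply: leq_trans (leq_mul aX bY) _.
by rewrite mulnACA leq_mul2l XY orbT.
Qed.

Lemma costN a A X : (0 < X -> a <= A * X -> a.+1 <= A.+1 * X)%N.
Proof. by move=> X0 aX; rewrite mulSn; lia. Qed.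

(** The constant is an existential variable when this runs, and recursion on the shape of the cost
    instantiates it. It is chosen before the network is introduced, hence uniform; products that
    come from loops are left to [costM] and its variants. *)
Ltac cost := lazymatch goal with
  | |- is_true (leq (addn _ _) _) => apply: costD; cost
  | |- is_true (leq (S _) _) => apply: costN; [by []|cost]
  | |- is_true (leq (muln _ _) _) => first [exact: leqnn | idtac]
  | |- _ => apply: costC; by []
  end.

Definition admissible (R : realType) (S E r : nat -> R) : Prop :=
  [/\ forall h, S h < S h.+1, forall h, E h <= E h.+1 & forall h, 0 <= r h].

Section Tree.
Variables (R : realType) (S E r : nat -> R).
Hypothesis S_lt : forall h, S h < S h.+1.
Hypothesis E_le : forall h, E h <= E h.+1.
Hypothesis r_ge0 : forall h, 0 <= r h.
Variables (n k l : nat) (tau : R).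
Notation N := (2 ^ l)%N.
Implicit Type m : memory R.

Record loaded m : Prop := Loaded {
  loaded_n : imem m 0 0 = n;
  loaded_k : imem m 0 1 = k;
  loaded_N : imem m i_N 0 = N;
  loaded_tau : rmem m r_tau 0 = tau;
  loaded_S : forall h, (h <= N)%N -> rmem m r_S h = S h;
  loaded_E : forall h, (h <= N)%N -> rmem m r_E h = E h;
  loaded_r : forall h, (h < N)%N -> rmem m r_rho (N + h) = r h }.

(* Heap order: the node x with x 2^(p+1) = N + a has the block
   [a, a + 2^(p+1)), its children 2x and 2x+1 have the two halves of it, and the
   leaves are the cells N + h. *)
Record node_ok m p a x : Prop := NodeOk {
  node_rho : rmem m r_rho x = rho r p.+1 a;
  node_thr : crossing S E p a (rmem m r_thr x);
  node_K : rmem m r_K x = env S E p a (rho r p (a + 2 ^ p)%N);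
  node_theta : forall i, (i <= a)%N ->
    (i < imem m i_theta x)%N = left_wins S E r p a i }.

(** Indices decrease towards the root, so [x0] is the frontier of the bottom-up construction: the
    finished tree has x0 = 1, and a descent only meets indices at least as large as its start. *)
Definition tree_ok x0 m := forall p a x, (x0 <= x)%N ->
  (x * 2 ^ p.+1 = N + a)%N -> (a + 2 ^ p.+1 <= N)%N -> node_ok m p a x.

Lemma loaded_frame c m m' : frame c m m' ->
  all (fun a => a \notin iwrites c) [:: 0; i_N]%N ->
  all (fun a => a \notin rwrites c) [:: r_tau; r_S; r_E; r_rho]%N ->
  loaded m -> loaded m'.
Proof.
move=> [fi fr] /and3P[i0 iN _] /and5P[r1 r2 r3 r4 _] [].
move=> *; split; rewrite ?fi ?fr // => h Hh; rewrite fr //; auto.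
Qed.

Lemma tree_frame x0 c m m' : frame c m m' ->
  i_theta \notin iwrites c ->
  all (fun a => a \notin rwrites c) [:: r_rho; r_thr; r_K]%N ->
  tree_ok x0 m -> tree_ok x0 m'.
Proof.
move=> [fi fr] i0 /and4P[r1 r2 r3 _] H p a x H1 H2 H3.
have [] := H p a x H1 H2 H3.
by move=> *; split; rewrite ?fr // => i Hi; rewrite fi //; auto.
Qed.

(** Justifies the loop test of the descents, which recognize a leaf by its index alone. *)
Lemma node_lt p a x : (x * 2 ^ p = N + a)%N -> (a + 2 ^ p <= N)%N ->
  (x < N)%N = (0 < p)%N.
Proof.
case: p => [|p]; first by rewrite expn0; lia.
rewrite expnS => e1 e2; have ? : (0 < 2 ^ p)%N by rewrite expn_gt0.
have := leq_pmulr x (n := 2 ^ p)%N ltac:(done).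
rewrite ltn0Sn; move: (N) e1 e2 => M e1 e2 e3.
by suff -> : (x < M)%N by []; nia.
Qed.

End Tree.

Section TreeCost.
Variable R : realType.
Implicit Type m : memory R.

Lemma env_descent_ok : exists C, forall (S E r : nat -> R) (n k l : nat) (tau : R),
  admissible S E r -> forall m p a x x0,
  loaded S E r n k l tau m -> tree_ok S E r l x0 m -> (x0 <= x)%N ->
  (x * 2 ^ p = 2 ^ l + a)%N -> (a + 2 ^ p <= 2 ^ l)%N -> imem m i_x 0 = x -> (p <= l)%N ->
  runs env_descent m (C * l.+1)
    (fun m' => rmem m' r_ev 0 = env S E p a (rmem m r_z 0)).
Proof.
eexists=> S E r n k l tau [S_lt E_le r_ge0] m p a x x0 ld tr x0x xN aN mx pl.
apply: runs_le; last first.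
  apply: runs_seq.
    apply: (runs_while (v0 := p) (I := fun p' m' => exists a' x',
      [/\ (x0 <= x')%N, (x' * 2 ^ p' = 2 ^ l + a')%N, (a' + 2 ^ p' <= 2 ^ l)%N, (p' <= p)%N &
       imem m' i_x 0 = x' /\ env S E p a (rmem m r_z 0) = env S E p' a' (rmem m r_z 0)])).
      move=> v m1 fr [a' [x' [H1 H2 H3 H4 [H5 H6]]]] bm.
      have ld1 := loaded_frame fr isT isT ld.
      have tr1 := tree_frame fr isT isT tr.
      apply: runs_straight => //.
      move: bm; rewrite /= H5 (loaded_N ld1) addn1 (node_lt H2 H3) => v0.
      case: v v0 H2 H3 H4 H6 => // v _ H2 H3 H4 H6; exists v => //.
      have nd := tr1 _ _ _ H1 H2 H3.
      have [c1 c2] := node_thr nd (rmem m r_z 0).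
      rewrite H6 /= (fr.2 r_z) //; move: H2 H3; rewrite expnS => H2 H3.
      case: leP => cz.
        exists a', (x' + x')%N; rewrite /update /= ?H5; split=> //; try arith.
        by split=> //; apply/max_idPl; apply: c1.
      exists (a' + 2 ^ v)%N, (x' + x' + 1)%N; rewrite /update /= ?H5.
      split=> //; try arith.
      by split=> //; apply/max_idPr; apply: c2; apply: ltW.
    by exists a, x; split.
  move=> m1 fr [[v [a' [x' [H1 H2 H3 H4 [H5 H6]]]]] bm].
  have ld1 := loaded_frame fr isT isT ld.
  apply: runs_straight => //.
  move: bm; rewrite /= H5 (loaded_N ld1) addn1 (node_lt H2 H3) -eqn0Ngt => /eqP v0.
  subst v; rewrite /update /= ?H6 ?H5 /line.
  move: H2 H3; rewrite expn0 muln1 => H2 H3.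
  rewrite (fr.2 r_z) // addn1 (loaded_S ld1) ?(loaded_E ld1); [|lia|lia].
  by have -> : (x' - 2 ^ l = a')%N by lia.
cost; apply: costM; [exact: costS|exact: pl|lia].
Qed.

(* The crossing line is only compared when the descent goes right: on the left
   branch it is dominated, by the choice of theta. *)
Lemma pairs_descent_ok : exists C, forall (S E r : nat -> R) (n k l : nat) (tau : R),
  admissible S E r -> forall m p a x x0 i,
  loaded S E r n k l tau m -> tree_ok S E r l x0 m -> (x0 <= x)%N ->
  (x * 2 ^ p = 2 ^ l + a)%N -> (a + 2 ^ p <= 2 ^ l)%N -> imem m i_y 0 = x -> (p <= l)%N ->
  imem m i_p 0 = i -> (i <= a)%N ->
  runs pairs_descent m (C * l.+1)
    (fun m' => rmem m' r_acc 0 = Num.max (rmem m r_acc 0) (pairs S E r p a i)).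
Proof.
eexists=> S E r n k l tau [S_lt E_le r_ge0] m p a x x0 i ld tr x0x xN aN mx pl mi ia.
apply: runs_le; last first.
  apply: runs_seq.
    apply: (runs_while (v0 := p) (I := fun p' m' => exists a' x',
      [/\ (x0 <= x')%N, (x' * 2 ^ p' = 2 ^ l + a')%N, (a' + 2 ^ p' <= 2 ^ l)%N,
       (p' <= p)%N /\ (i <= a')%N &
       imem m' i_y 0 = x' /\ Num.max (rmem m r_acc 0) (pairs S E r p a i) =
         Num.max (rmem m' r_acc 0) (pairs S E r p' a' i)])).
      move=> v m1 fr [a' [x' [H1 H2 H3 [H4 ia'] [H5 H6]]]] bm.
      have ld1 := loaded_frame fr isT isT ld.
      have tr1 := tree_frame fr isT isT tr.
      apply: runs_straight => //.
      move: bm; rewrite /= H5 (loaded_N ld1) addn1 (node_lt H2 H3) => v0.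
      case: v v0 H2 H3 H4 H6 => // v _ H2 H3 H4 H6; exists v => //.
      have nd := tr1 _ _ _ H1 H2 H3.
      have H2' : ((x' + x' + 1) * 2 ^ v = 2 ^ l + (a' + 2 ^ v))%N.
        by move: H2; rewrite expnS; nia.
      have K1 := node_K nd; have th1 := node_theta nd ia'.
      have rho1 : rmem m1 r_rho (x' + x' + 1) = rho r v (a' + 2 ^ v).
        case: v {H6 K1 th1} H2 H3 H4 H2' nd => [|v] H2 H3 H4 H2' nd.
          move: H2' H3; rewrite !expn0 muln1 => -> H3 /=.
          by rewrite (loaded_r ld1) //; lia.
        have := tr1 _ _ _ _ H2' _ => /(_ ltac:(lia) ltac:(move: H3; rewrite !expnS; lia)).
        by case.
      rewrite H6 /= (fr.1 i_p) // mi addn1 th1.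
      move: H2 H3; rewrite expnS => H2 H3.
      rewrite /left_wins; case: leP => cz.
        exists a', (x' + x')%N; rewrite /update /= ?H5; clear H2'.
        by split=> //; arith.
      exists (a' + 2 ^ v)%N, (x' + x' + 1)%N.
      have Si : rmem m1 r_S i = S i by rewrite (loaded_S ld1) //; lia.
      have eqc : rmem m1 r_K x' - S i * rmem m1 r_rho (x' + x' + 1) = cross S E r v a' i.
        by rewrite K1 rho1.
      rewrite maxA Si eqc.
      case: (lerP (rmem m1 r_acc 0) _) => c3; rewrite /update /= ?H5.
        by split=> //; arith.
      by split=> //; arith.
    by exists a, x; split.
  move=> m1 fr [[v [a' [x' [H1 H2 H3 [H4 ia'] [H5 H6]]]]] bm].
  have ld1 := loaded_frame fr isT isT ld.
  apply: runs_straight => //.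
  move: bm; rewrite /= H5 (loaded_N ld1) addn1 (node_lt H2 H3) -eqn0Ngt => /eqP v0.
  subst v; rewrite H6 /= /pairv.
  move: H2 H3; rewrite expn0 muln1 => H2 H3.
  rewrite (fr.1 i_p) // mi addn1 !(loaded_S ld1) ?(loaded_E ld1); [|lia|lia|lia].
  have -> : (x' - 2 ^ l = a')%N by lia.
  rewrite H2 (loaded_r ld1); last lia.
  by case: lerP => c3; rewrite /update //=.
cost; apply: costM; [exact: costS|exact: pl|lia].
Qed.

End TreeCost.

(** * Left costs in O(log^2 n) steps *)

(** For h in the new block and g to the right of it, only the largest inverse capacity met so far
    matters, so one envelope evaluation at [r_Z] covers these pairs. Hence [r_Z] is raised last. *)
Definition absorb : cmd :=
  (iset i_x (iv i_w) ;; rset r_z (rv r_Z)) ;;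
  env_descent ;;
  (rmax r_acc (rv r_ev ⊖ RGet r_S (iv i_qi) ⊗ rv r_Z) ;;
   iset i_y (iv i_w) ;; iset i_p (iv i_qi)) ;;
  pairs_descent ;;
  rmax r_Z (RGet r_rho (iv i_w)).

Definition take_block : cmd :=
  iset i_w (iv i_w ⊟ ILit 1) ;; absorb ;; iset i_s (iv i_s ⊟ iv i_q).

(** Blocks of [i, s) are taken from right to left, first of growing sizes until one no longer fits,
    then of shrinking sizes. The cell [i_w] is kept at the index of the block that would start at s,
    so the block ending at s is its predecessor. The initial -E(s) in [r_acc] stands for the cost
    0. *)
Definition query : cmd :=
  (rset r_acc (ROfI (ILit 0) ⊖ RGet r_E (iv i_qs)) ;;
   rset r_Z (ROfI (ILit 0)) ;;
   iset i_w (iv i_N ⊞ iv i_qs) ;; iset i_s (iv i_qs) ;; iset i_q (ILit 1)) ;;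
  While (BILe (iv i_qi ⊞ iv i_q) (iv i_s))
    (If (BNot (BILe (iv i_w) (IHalf (iv i_w) ⊞ IHalf (iv i_w)))) take_block Skip ;;
     iset i_w (IHalf (iv i_w)) ;; iset i_q (iv i_q ⊞ iv i_q)) ;;
  While (BILe (ILit 2) (iv i_q))
    ((iset i_q (IHalf (iv i_q)) ;; iset i_w (iv i_w ⊞ iv i_w)) ;;
     If (BILe (iv i_qi ⊞ iv i_q) (iv i_s)) take_block Skip) ;;
  rset r_qr (rv r_acc ⊕ RGet r_E (iv i_qs)).

Lemma sem_seq (R : realType) c1 c2 (m : memory R) :
  sem (c1 ;; c2) m = sem c2 (sem c1 m).
Proof. by []. Qed.

Lemma sem_rmax (R : realType) a e (m : memory R) :
  sem (rmax a e) m =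
  Memory (imem m) (update (rmem m) a 0 (Num.max (rmem m a 0) (reval m e))).
Proof.
rewrite /=; case: lerP => // _; case: m => im rm /=; congr Memory.
apply/funext => b; apply/funext => j; rewrite /update.
by case: eqP => // ->; case: eqP => // ->.
Qed.

Section Query.
Variables (R : realType) (S E r : nat -> R).
Hypothesis S_lt : forall h, S h < S h.+1.
Hypothesis E_le : forall h, E h <= E h.+1.
Hypothesis r_ge0 : forall h, 0 <= r h.
Variables (n k l : nat) (tau : R).
Notation N := (2 ^ l)%N.
Implicit Type m : memory R.

Lemma rho_ok x0 m p a x : loaded S E r n k l tau m -> tree_ok S E r l x0 m -> (x0 <= x)%N ->
  (x * 2 ^ p = N + a)%N -> (a + 2 ^ p <= N)%N -> rmem m r_rho x = rho r p a.
Proof.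
move=> ld tr x0x; case: p => [|p] H2 H3; last by have [] := tr _ _ _ x0x H2 H3.
move: H2 H3; rewrite expn0 muln1 => -> H3 /=.
by rewrite (loaded_r ld) //; lia.
Qed.

(* The blocks of [s, s0) have been absorbed: [acc] bounds their pairs and [Z] is
   their largest inverse capacity; [acc] never exceeds the value sought. *)
Record covered i s0 s acc Z : Prop := Covered {
  covered_ge : forall h g, (s <= h)%N -> (h <= g)%N -> (g < s0)%N ->
    pairv S E r i h g <= acc;
  covered_le : acc <= lcost S E r i s0 - E s0;
  covered_E : - E s0 <= acc;
  covered_Z : forall g, (s <= g)%N -> (g < s0)%N -> r g <= Z;
  covered_Z_ex : Z = 0 \/ exists g, [/\ (s <= g)%N, (g < s0)%N & Z = r g] }.

Lemma covered_step p i s0 a acc Z : (i <= a)%N -> (a + 2 ^ p <= s0)%N ->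
  covered i s0 (a + 2 ^ p)%N acc Z ->
  covered i s0 a
    (Num.max (Num.max acc (env S E p a Z - S i * Z)) (pairs S E r p a i))
    (Num.max Z (rho r p a)).
Proof.
move=> ia as0 [c1 c2 c3 c4 c5]; split.
- move=> h g ah hg gs; rewrite !le_max.
  case: (ltnP g (a + 2 ^ p)) => H1; first by rewrite pairs_ge ?orbT.
  case: (ltnP h (a + 2 ^ p)) => H2; last by rewrite c1.
  suff -> : pairv S E r i h g <= env S E p a Z - S i * Z by rewrite orbT.
  have le1 : line S E h Z <= env S E p a Z by apply: env_ge; lia.
  have := @pairv_le _ S E r S_lt i h g Z ltac:(lia) (c4 _ H1 gs); lra.
- rewrite !ge_max c2 /=; apply/andP; split.
    have [h Hh ->] := env_ex S E p a Z.
    (* For Z = 0 the line of h has value -E h, which does not exceed the pair (h, h). *)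
    case: c5 => [->|[g [H1 H2 ->]]].
      have := @lcost_ge _ S E r i s0 h h ltac:(lia) ltac:(lia) ltac:(lia).
      have := S_homo S_lt (i := i) (j := h.+1) ltac:(lia); have := r_ge0 h.
      by rewrite /pairv /line; nra.
    have := @lcost_ge _ S E r i s0 h g ltac:(lia) ltac:(lia) ltac:(lia).
    by rewrite /pairv /line; nra.
  have [h [g [H1 H2 H3 ->]]] := pairs_ex S E r p a i.
  have := @lcost_ge _ S E r i s0 h g ltac:(lia) ltac:(lia) ltac:(lia).
  by rewrite /pairv; lra.
- by rewrite !le_max c3.
- move=> g ag gs; rewrite le_max; case: (ltnP g (a + 2 ^ p)) => H1.
    by rewrite rho_ge ?orbT //; lia.
  by rewrite c4.
- case: lerP => _.
    by right; have [g Hg ->] := rho_ex r p a; exists g; split=> //; lia.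
  case: c5 => [->|[g [H1 H2 ->]]]; first by left.
  by right; exists g; split=> //; lia.
Qed.

Lemma covered_end i s0 s acc Z : covered i s0 s acc Z -> (s <= i)%N ->
  acc + E s0 = lcost S E r i s0.
Proof.
move=> [c1 c2 c3 _ _] si; apply/le_anti/andP; split; first lra.
apply/lcost_leP; split; first lra.
move=> h g H1 H2 H3; have := c1 h g ltac:(lia) H2 H3; lra.
Qed.

(** Halving is the only division on indices, so parity is tested by halving and doubling. *)
Lemma odd_testE w : ~~ (w <= w./2 + w./2)%N = odd w.
Proof. by have := odd_double_half w; case: odd; lia. Qed.

End Query.

Section QueryCost.
Variable R : realType.
Implicit Type m : memory R.

Lemma take_block_ok : exists C, forall (S E r : nat -> R) (n k l : nat) (tau : R),
  admissible S E r -> forall m p i s s0,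
  loaded S E r n k l tau m -> tree_ok S E r l 1 m -> (imem m i_w 0 * 2 ^ p = 2 ^ l + s)%N -> (s <= 2 ^ l)%N ->
  (s <= s0)%N ->
  imem m i_q 0 = (2 ^ p)%N -> imem m i_s 0 = s -> imem m i_qi 0 = i ->
  (i + 2 ^ p <= s)%N -> covered S E r i s0 s (rmem m r_acc 0) (rmem m r_Z 0) ->
  runs take_block m (C * l.+1)
    (fun m' => [/\ imem m' i_w 0 = (imem m i_w 0).-1, imem m' i_s 0 = (s - 2 ^ p)%N &
       covered S E r i s0 (s - 2 ^ p)%N (rmem m' r_acc 0) (rmem m' r_Z 0)]).
Proof.
have [C1 env_ok_] := @env_descent_ok R.
have [C2 pairs_ok_] := @pairs_descent_ok R.
eexists=> S E r n k l tau [S_lt E_le r_ge0] m p i s s0 ld tr wp sN ss0 mq ms mqi is_ cov.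
have env_ok := env_ok_ S E r n k l tau (And3 S_lt E_le r_ge0).
have pairs_ok := pairs_ok_ S E r n k l tau (And3 S_lt E_le r_ge0).
have p0 : (0 < 2 ^ p)%N by rewrite expn_gt0.
have pl : (p <= l)%N by rewrite -(leq_exp2l (m := 2)) //; lia.
have w1 : (((imem m i_w 0).-1) * 2 ^ p = 2 ^ l + (s - 2 ^ p))%N.
  by rewrite -subn1 mulnBl wp; lia.
have w0 : (1 <= (imem m i_w 0).-1)%N.
  by move: w1; case: ((imem m i_w 0).-1)%N => //; lia.
have aN : (s - 2 ^ p + 2 ^ p <= 2 ^ l)%N by lia.
apply: runs_le; last first.
  apply: runs_straight_seq => // m1 fr1 e1.
  have ld1 := loaded_frame fr1 isT isT ld.
  have tr1 := tree_frame fr1 isT isT tr.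
  apply: (runs_seq (Q1 := fun m' => imem m' i_w 0 = (imem m i_w 0).-1 /\
    covered S E r i s0 (s - 2 ^ p)%N (rmem m' r_acc 0) (rmem m' r_Z 0))); last first.
    move=> m2 fr [H1 H4]; apply: runs_straight => //.
    rewrite /= /update /= H1 (fr.1 i_s) // (fr.1 i_q) // e1 /= /update /= ms mq.
    by split.
  apply: runs_straight_seq => // m2 fr2 e2.
  have ld2 := loaded_frame fr2 isT isT ld1.
  have tr2 := tree_frame fr2 isT isT tr1.
  apply: runs_seq.
    apply: (env_ok _ p (s - 2 ^ p)%N (imem m i_w 0).-1 1%N) => //.
    by rewrite e2 e1 /= /update /= subn1.
  move=> m3 fr3 ev3.
  have ld3 := loaded_frame fr3 isT isT ld2.
  have tr3 := tree_frame fr3 isT isT tr2.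
  apply: runs_straight_seq => // m4 fr4 e4.
  have ld4 := loaded_frame fr4 isT isT ld3.
  have tr4 := tree_frame fr4 isT isT tr3.
  have mw3 : imem m3 i_w 0 = (imem m i_w 0).-1.
    by rewrite (fr3.1 i_w) // e2 e1 /= /update /= subn1.
  have mi3 : imem m3 i_qi 0 = i.
    by rewrite (fr3.1 i_qi) // e2 e1 /= /update.
  apply: runs_seq.
    apply: (pairs_ok _ p (s - 2 ^ p)%N (imem m i_w 0).-1 1%N i) => //; last lia.
      by rewrite e4 [sem]lock /= -lock; rewrite /= ?mw3; case: ifP.
    by rewrite e4 /=; case: ifP.
  move=> m5 fr5 acc5.
  have ld5 := loaded_frame fr5 isT isT ld4.
  have tr5 := tree_frame fr5 isT isT tr4.
  apply: runs_straight => //.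
  rewrite sem_rmax /= /update /= acc5.
  have mw5 : imem m5 i_w 0 = (imem m i_w 0).-1.
    by rewrite (fr5.1 i_w) // (fr4.1 i_w).
  split; first exact: mw5.
  rewrite mw5 (rho_ok ld5 tr5 w0 w1 aN).
  have Z3 : rmem m3 r_Z 0 = rmem m r_Z 0.
    by rewrite (fr3.2 r_Z) // (fr2.2 r_Z) // (fr1.2 r_Z).
  have -> : rmem m5 r_Z 0 = rmem m r_Z 0.
    by rewrite (fr5.2 r_Z) // (fr4.2 r_Z).
  have -> : rmem m4 r_acc 0 = Num.max (rmem m r_acc 0)
      (env S E p (s - 2 ^ p) (rmem m r_Z 0) - S i * rmem m r_Z 0).
    rewrite e4 sem_seq sem_rmax /= /update /= ev3 mi3 Z3 (loaded_S ld3); last lia.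
    rewrite (fr3.2 r_acc) // (fr2.2 r_acc) // (fr1.2 r_acc) //.
    by rewrite e2 e1 /= /update.
  by apply: covered_step; rewrite ?subnK //; lia.
cost.
Qed.

Lemma query_ok : exists C, forall (S E r : nat -> R) (n k l : nat) (tau : R),
  admissible S E r -> forall m i s,
  loaded S E r n k l tau m -> tree_ok S E r l 1 m -> imem m i_qi 0 = i -> imem m i_qs 0 = s -> (s <= 2 ^ l)%N ->
  runs query m (C * l.+1 ^ 2) (fun m' => rmem m' r_qr 0 = lcost S E r i s).
Proof.
have [C tb_] := take_block_ok.
eexists=> S E r n k l tau [S_lt E_le r_ge0] m i s0 ld tr mi ms sN.
have tb := tb_ S E r n k l tau (And3 S_lt E_le r_ge0).
pose inv s m' := [/\ (imem m' i_s 0 = s)%N, (s <= s0)%N &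
   covered S E r i s0 s (rmem m' r_acc 0) (rmem m' r_Z 0)].
apply: runs_le; last first.
  apply: runs_straight_seq => // m1 fr1 e1.
  have ld1 := loaded_frame fr1 isT isT ld.
  have tr1 := tree_frame fr1 isT isT tr.
  apply: runs_seq.
    apply: (runs_while (v0 := l.+1) (I := fun v m' => exists p s,
      [/\ inv s m', (imem m' i_w 0 * 2 ^ p = 2 ^ l + s)%N,
        imem m' i_q 0 = (2 ^ p)%N, (v + p = l.+1)%N & True])).
      move=> v m2 fr2 [p [s [[s2 ss0 cov] w2 q2 vp _]]] bm.
      have ld2 := loaded_frame fr2 isT isT ld1.
      have tr2 := tree_frame fr2 isT isT tr1.
      have mi2 : imem m2 i_qi 0 = i by rewrite (fr2.1 i_qi) // (fr1.1 i_qi).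
      move: bm; rewrite /= mi2 q2 s2 => ips.
      have p0 : (0 < 2 ^ p)%N by rewrite expn_gt0.
      have pl : (p <= l)%N by rewrite -(leq_exp2l (m := 2)) //; lia.
      apply: (runs_seq (Q1 := fun m' => exists s, [/\ inv s m',
         (imem m' i_w 0 * 2 ^ p = 2 ^ l + s)%N & ~~ odd (imem m' i_w 0)])).
        apply: runs_if; rewrite /= odd_testE => ow; last first.
          by apply: runs_straight => //=; exists s.
        apply: runs_post (tb m2 p i s s0 ld2 tr2 w2 _ ss0 q2 s2 mi2 ips cov); last lia.
        move=> m3 fr3 [w3 s3 cov3]; exists (s - 2 ^ p)%N; split.
        - by split=> //; lia.
        - by rewrite w3 -subn1 mulnBl w2; lia.
        - by rewrite w3; move: ow; case: (imem m2 i_w 0).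
      move=> m3 fr3 [s' [[s3 ss0' cov3] w3 ow]].
      apply: runs_straight => //; exists v.-1; first lia.
      exists p.+1, s'; rewrite /inv /= /update /= (fr3.1 i_q) // q2.
      split=> //; [|by rewrite expnS; lia|lia].
      have := odd_double_half (imem m3 i_w 0); rewrite (negbTE ow) add0n => e.
      by rewrite expnS mulnA muln2 e.
    exists 0%N, s0; rewrite /inv e1 /= /update /= expn0 muln1 ld.(loaded_N) ms.
    split=> //; last lia.
    split=> //; rewrite (loaded_E ld) // sub0r.
    split=> //; [lia| |lia|by left].
    by have := lcost_ge0 S E r i s0; lra.
  move=> m2 fr2 [[v [p [s [[s2 ss0 cov] w2 q2 vp _]]]] bm].
  have ld2 := loaded_frame fr2 isT isT ld1.
  have tr2 := tree_frame fr2 isT isT tr1.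
  have mi2 : imem m2 i_qi 0 = i by rewrite (fr2.1 i_qi) // (fr1.1 i_qi).
  move: bm; rewrite /= mi2 q2 s2 -ltnNge => ips.
  apply: runs_seq.
    apply: (runs_while (v0 := l.+1) (I := fun v m' => exists p s,
      [/\ (p <= v)%N /\ inv s m', (imem m' i_w 0 * 2 ^ p = 2 ^ l + s)%N,
        imem m' i_q 0 = (2 ^ p)%N & (s < i + 2 ^ p)%N])).
      move=> v' m3 fr3 [{p s s2 ss0 cov w2 q2 vp ips}p [s [[pv [s2 ss0 cov]] w2 q2 ips]]] bm.
      have ld3 := loaded_frame fr3 isT isT ld2.
      have tr3 := tree_frame fr3 isT isT tr2.
      have mi3 : imem m3 i_qi 0 = i by rewrite (fr3.1 i_qi).
      case: p pv w2 q2 ips => [|p] pv w2 q2 ips; first by move: bm; rewrite /= q2.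
      have e2p : (2 ^ p.+1 = 2 ^ p + 2 ^ p)%N by rewrite expnS; lia.
      apply: runs_straight_seq => // m4 fr4 e4.
      have ld4 := loaded_frame fr4 isT isT ld3.
      have tr4 := tree_frame fr4 isT isT tr3.
      have q4 : imem m4 i_q 0 = (2 ^ p)%N.
        by rewrite e4 /= /update /= q2 e2p addnn doubleK.
      have w4 : (imem m4 i_w 0 * 2 ^ p = 2 ^ l + s)%N.
        by rewrite e4 /= /update /= -w2 e2p; lia.
      have mi4 : imem m4 i_qi 0 = i by rewrite (fr4.1 i_qi).
      have s4 : imem m4 i_s 0 = s by rewrite (fr4.1 i_s).
      have cov4 : covered S E r i s0 s (rmem m4 r_acc 0) (rmem m4 r_Z 0).
        by rewrite (fr4.2 r_acc) // (fr4.2 r_Z).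
      apply: runs_if; rewrite /= mi4 q4 s4 => c4; last first.
        apply: runs_straight => //=; exists v'.-1; first lia; exists p, s; do !split=> //; lia.
      apply: runs_post (tb m4 p i s s0 ld4 tr4 w4 _ ss0 q4 s4 mi4 c4 cov4); last lia.
      move=> m5 fr5 [w5 s5 cov5]; exists v'.-1; first lia.
      exists p, (s - 2 ^ p)%N; split.
      - by do !split=> //; lia.
      - by rewrite w5 -subn1 mulnBl w4; have : (0 < 2 ^ p)%N; [rewrite expn_gt0|lia].
      - by rewrite (fr5.1 i_q).
      - by lia.
    by exists p, s; do !split=> //; lia.
  move=> m3 fr3 [[v' [p' [s' [[_ [s3 ss0' cov3]] w3 q3 ips3]]]] bm].
  apply: runs_straight => //.
  have ld3 := loaded_frame fr3 isT isT ld2.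
  rewrite /= /update /= (fr3.1 i_qs) // (fr2.1 i_qs) // (fr1.1 i_qs) // ms.
  rewrite (loaded_E ld3) //; apply: (covered_end cov3).
  (* On exit the block size is 1, so s < i + 1 and no pair is left out. *)
  move: bm; rewrite /= q3 -ltnNge => bm.
  by move: ips3; case: (2 ^ p')%N bm => [|[|]] //; lia.
have X1 : (0 < l.+1 ^ 2)%N by rewrite expn_gt0.
have X2 : (l.+1 <= l.+1 ^ 2)%N by rewrite -mulnn; lia.
have lX a : (a * l.+1 <= a * l.+1 ^ 2)%N by rewrite leq_mul2l X2 orbT.
have one : (1 <= l.+1)%N by [].
by cost; apply: (costM (X := l.+1) (Y := l.+1)); rewrite ?mulnn //; cost.
Qed.

End QueryCost.

(** * Construction of the segment tree *)

(** Parametric search: the crossing z0 of the two children of [i_node] is unknown, but it can be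
    compared with the threshold t of any node below, by evaluating both children's envelopes at t.
    The outcome tells which way the line attained at z0 lies; each level costs two descents. *)
Definition find_leaf : cmd :=
  While (ilt (iv i_u) (iv i_N))
    ((rset r_z (RGet r_thr (iv i_u)) ;; iset i_x (iv i_node ⊞ iv i_node)) ;;
     env_descent ;;
     (rset r_tmp (rv r_ev) ;; iset i_x (iv i_node ⊞ iv i_node ⊞ ILit 1)) ;;
     env_descent ;;
     If (BRLe (rv r_tmp) (rv r_ev))
       (iset i_u (iv i_u ⊞ iv i_u))
       (iset i_u (iv i_u ⊞ iv i_u ⊞ ILit 1))).

(** Binary search on the monotone predicate [left_wins]. Going left down to a leaf recovers the
    start a of the block. The left descent starts from -E(N), a lower bound of all pairs
    ([pairs_lb]) that acts as minus infinity; the right one starts from the crossing value and so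
    returns the maximum of the two rivals. *)
Definition find_theta : cmd :=
  iset i_u (iv i_node) ;;
  While (ilt (iv i_u) (iv i_N)) (iset i_u (iv i_u ⊞ iv i_u)) ;;
  (iset i_lo (ILit 0) ;; iset i_hi (iv i_u ⊟ iv i_N ⊞ ILit 1)) ;;
  While (ilt (iv i_lo) (iv i_hi))
    ((iset i_mid (IHalf (iv i_lo ⊞ iv i_hi)) ;; iset i_p (iv i_mid) ;;
      rset r_acc (ROfI (ILit 0) ⊖ RGet r_E (iv i_N)) ;;
      iset i_y (iv i_node ⊞ iv i_node)) ;;
     pairs_descent ;;
     (rset r_tmp (rv r_acc) ;;
      rset r_acc (RGet r_K (iv i_node) ⊖
        RGet r_S (iv i_mid) ⊗ RGet r_rho (iv i_node ⊞ iv i_node ⊞ ILit 1)) ;;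
      iset i_y (iv i_node ⊞ iv i_node ⊞ ILit 1)) ;;
     pairs_descent ;;
     If (BRLe (rv r_acc) (rv r_tmp))
       (iset i_lo (iv i_mid ⊞ ILit 1)) (iset i_hi (iv i_mid))).

Definition build_node : cmd :=
  (If (BRLe (RGet r_rho (iv i_node ⊞ iv i_node))
            (RGet r_rho (iv i_node ⊞ iv i_node ⊞ ILit 1)))
     (RSet r_rho (iv i_node) (RGet r_rho (iv i_node ⊞ iv i_node ⊞ ILit 1)))
     (RSet r_rho (iv i_node) (RGet r_rho (iv i_node ⊞ iv i_node))) ;;
   iset i_x (iv i_node ⊞ iv i_node) ;;
   rset r_z (RGet r_rho (iv i_node ⊞ iv i_node ⊞ ILit 1))) ;;
  env_descent ;;
  (RSet r_K (iv i_node) (rv r_ev) ;; iset i_u (iv i_node ⊞ iv i_node)) ;;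
  find_leaf ;;
  (iset i_lo (iv i_u) ;; iset i_u (iv i_node ⊞ iv i_node ⊞ ILit 1)) ;;
  find_leaf ;;
  RSet r_thr (iv i_node)
    ((RGet r_E (iv i_u ⊟ iv i_N) ⊖ RGet r_E (iv i_lo ⊟ iv i_N)) ⊘
     (RGet r_S (iv i_u ⊟ iv i_N ⊞ ILit 1) ⊖
      RGet r_S (iv i_lo ⊟ iv i_N ⊞ ILit 1))) ;;
  find_theta ;;
  ISet i_theta (iv i_node) (iv i_lo).

Definition build_tree : cmd :=
  iset i_node (iv i_N) ;;
  While (BILe (ILit 2) (iv i_node))
    (iset i_node (iv i_node ⊟ ILit 1) ;; build_node).

Section Build.
Variables (R : realType) (S E r : nat -> R).
Hypothesis S_lt : forall h, S h < S h.+1.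
Hypothesis E_le : forall h, E h <= E h.+1.
Hypothesis r_ge0 : forall h, 0 <= r h.
Variables (n k l : nat) (tau : R).
Notation N := (2 ^ l)%N.
Implicit Type m : memory R.

Lemma node_uniq p p' a a' x :
  (x * 2 ^ p = N + a)%N -> (a + 2 ^ p <= N)%N ->
  (x * 2 ^ p' = N + a')%N -> (a' + 2 ^ p' <= N)%N -> p = p' /\ a = a'.
Proof.
wlog: p p' a a' / (p <= p')%N => [W|].
  case: (leqP p p') => [|/ltnW] pp H1 H2 H3 H4; first exact: W.
  by have [] := W p' p a' a pp H3 H4 H1 H2.
rewrite leq_eqVlt => /orP[/eqP <- H1 _ H2 _|pp H1 H2 H3 H4]; first by split=> //; lia.
exfalso; move: H3 H4; rewrite -(subnKC pp) expnD expnS.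
have : (0 < 2 ^ (p' - p.+1))%N by rewrite expn_gt0.
have : (0 < 2 ^ p)%N by rewrite expn_gt0.
have : (0 < N)%N by rewrite expn_gt0.
set A := (2 ^ (p' - p.+1))%N; move: (2 ^ p)%N (N) H1 H2 => P M H1 H2 M0 P0 A0.
have -> : (x * (2 * P * A) = 2 * (x * P) * A)%N by lia.
rewrite H1 => H3 H4; have : (2 * (M + a) <= 2 * (M + a) * A)%N by rewrite leq_pmulr.
by have : (0 < 2 * P * A)%N; [rewrite !muln_gt0 P0 A0|lia].
Qed.

Lemma node_ex x : (0 < x)%N -> (x < N)%N -> exists p a,
  (x * 2 ^ p.+1 = N + a)%N /\ (a + 2 ^ p.+1 <= N)%N.
Proof.
move=> x0 xN; have := trunc_log_bounds (p := 2) isT x0.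
set d := trunc_log 2 x => /andP[d1 d2].
have dl : (d < l)%N by rewrite -(ltn_exp2l (m := 2)) //; lia.
have e : (2 ^ d * 2 ^ (l - d.+1).+1 = N)%N by rewrite -expnD; congr (2 ^ _)%N; lia.
exists (l - d.+1)%N, (x * 2 ^ (l - d.+1).+1 - N)%N.
move: d2 (leq_mul d1 (leqnn (2 ^ (l - d.+1).+1))); rewrite e expnS => d2 le1.
have := leq_mul d2 (leqnn (2 ^ (l - d.+1).+1)); rewrite -mulnA e mulSn; lia.
Qed.

Lemma tree_agree x0 m m' :
  (forall y, (x0 <= y)%N -> [/\ rmem m' r_rho y = rmem m r_rho y,
     rmem m' r_thr y = rmem m r_thr y, rmem m' r_K y = rmem m r_K y &
     imem m' i_theta y = imem m i_theta y]) ->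
  tree_ok S E r l x0 m -> tree_ok S E r l x0 m'.
Proof.
move=> H tr p a x x0x H1 H2; have [e1 e2 e3 e4] := H x x0x.
by have [] := tr p a x x0x H1 H2; split; rewrite ?e1 ?e2 ?e3 ?e4.
Qed.

(** Going left from z0, every right line is steeper and drops faster than the left line attained at
    z0. The strict inequality makes the comparison at t decide on which side z0 is. *)
Lemma crossing_lt p a z0 t : crossing S E p a z0 -> t < z0 ->
  env S E p (a + 2 ^ p) t < env S E p a t.
Proof.
move=> cr tz; have ez := crossing_eq cr.
have [k0 Hk ek] := env_ex S E p (a + 2 ^ p) t.
have [h Hh eh] := env_ex S E p a z0.
have le1 : line S E h t <= env S E p a t by apply: env_ge; lia.
have le2 : line S E k0 z0 <= env S E p (a + 2 ^ p) z0 by apply: env_ge; lia.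
have := S_homo_lt S_lt (i := h.+1) (j := k0.+1) ltac:(lia).
move: le1 le2; rewrite ek -ez eh /line; nra.
Qed.

Lemma pairs_lb p a i : (i <= a)%N -> (a + 2 ^ p <= N)%N -> - E N <= pairs S E r p a i.
Proof.
move=> ia aN; have p0 : (0 < 2 ^ p)%N by rewrite expn_gt0.
have := @pairs_ge _ S E r S_lt p a i a a ia (leqnn _) (leqnn _) ltac:(lia).
have := S_homo S_lt (i := i) (j := a.+1) ltac:(lia).
have := E_homo E_le (i := a) (j := N) ltac:(lia).
by have := r_ge0 a; rewrite /pairv; nra.
Qed.

End Build.

Section BuildCost.
Variable R : realType.
Implicit Type m : memory R.

Lemma find_leaf_ok : exists C, forall (S E r : nat -> R) (n k l : nat) (tau : R),
  admissible S E r -> forall m p a x b z0,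
  loaded S E r n k l tau m -> tree_ok S E r l x.+1 m -> imem m i_node 0 = x ->
  (0 < x)%N -> (x * 2 ^ p.+1 = 2 ^ l + a)%N -> (a + 2 ^ p.+1 <= 2 ^ l)%N ->
  crossing S E p a z0 -> (x < imem m i_u 0)%N ->
  (imem m i_u 0 * 2 ^ p = 2 ^ l + b)%N -> (b + 2 ^ p <= 2 ^ l)%N ->
  runs find_leaf m (C * l.+1 ^ 2)
    (fun m' => exists h, [/\ imem m' i_u 0 = (2 ^ l + h)%N, (b <= h < b + 2 ^ p)%N &
       env S E p b z0 = line S E h z0]).
Proof.
have [C1 env_ok_] := @env_descent_ok R.
eexists=> S E r n k l tau [S_lt E_le r_ge0] m p a x b z0 ld tr mx x0 xa aN cr xu ub bN.
have env_ok := env_ok_ S E r n k l tau (And3 S_lt E_le r_ge0).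
have pl : (p <= l)%N.
  by rewrite -(leq_exp2l (m := 2)) //; move: aN; rewrite expnS; lia.
apply: runs_le; last first.
  apply: (runs_post (Q := fun m' => (exists v : nat, exists b' u,
       [/\ imem m' i_u 0 = u, (x < u)%N, (u * 2 ^ v = 2 ^ l + b')%N,
          (b' + 2 ^ v <= 2 ^ l)%N & [/\ (b <= b')%N, (b' + 2 ^ v <= b + 2 ^ p)%N &
          env S E p b z0 = env S E v b' z0]]) /\ ~~ beval m' (ilt (iv i_u) (iv i_N)))).
    move=> m' fr [[v [b' [u [mu xu' ub' bN' [b1 b2 e]]]]]].
    have ld' := loaded_frame fr isT isT ld.
    rewrite /= mu (loaded_N ld') addn1 (node_lt ub' bN') -eqn0Ngt => /eqP v0; subst v.
    move: ub' bN' b2; rewrite expn0 muln1 => ub' bN' b2.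
    by exists b'; split=> //; lia.
  apply: (runs_while (v0 := p)); last first.
    by exists b, (imem m i_u 0); do !split=> //.
  move=> v m1 fr1 [b' [u [mu xu' ub' bN' [b1 b2 e]]]] bm.
  have ld1 := loaded_frame fr1 isT isT ld.
  have tr1 := tree_frame fr1 isT isT tr.
  move: bm; rewrite /= mu (loaded_N ld1) addn1 (node_lt ub' bN') => v0.
  case: v v0 ub' bN' b2 e => // v _ ub' bN' b2 e.
  have nd := tr1 v b' u xu' ub' bN'.
  apply: runs_straight_seq => // m2 fr2 e2.
  have ld2 := loaded_frame fr2 isT isT ld1.
  have tr2 := tree_frame fr2 isT isT tr1.
  have mx1 : imem m1 i_node 0 = x by rewrite (fr1.1 i_node).
  have mx2 : imem m2 i_node 0 = x by rewrite (fr2.1 i_node).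
  have p2 : (0 < 2 ^ p)%N by rewrite expn_gt0.
  have p2' : (0 < 2 ^ v)%N by rewrite expn_gt0.
  have [xA xB] : ((x + x) * 2 ^ p = 2 ^ l + a /\ (x + x + 1) * 2 ^ p = 2 ^ l + (a + 2 ^ p))%N.
    by move: xa; rewrite expnS; lia.
  have [aA aB] : (a + 2 ^ p <= 2 ^ l /\ a + 2 ^ p + 2 ^ p <= 2 ^ l)%N.
    by move: aN; rewrite expnS; lia.
  apply: runs_seq.
    apply: (env_ok m2 p a (x + x)%N x.+1) => //; first lia.
    by rewrite e2 /= /update /= mx1.
  move=> m3 fr3 ev3.
  have ld3 := loaded_frame fr3 isT isT ld2.
  have tr3 := tree_frame fr3 isT isT tr2.
  have mx3 : imem m3 i_node 0 = x by rewrite (fr3.1 i_node).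
  apply: runs_straight_seq => // m4 fr4 e4.
  have ld4 := loaded_frame fr4 isT isT ld3.
  have tr4 := tree_frame fr4 isT isT tr3.
  apply: runs_seq.
    apply: (env_ok m4 p (a + 2 ^ p)%N (x + x + 1)%N x.+1) => //; first lia.
    by rewrite e4 /= /update /= mx3.
  move=> m5 fr5 ev5.
  apply: runs_straight => //.
  have thr2 : rmem m2 r_z 0 = rmem m1 r_thr u by rewrite e2 /= /update /= mu.
  have thr4 : rmem m4 r_z 0 = rmem m1 r_thr u by rewrite (fr4.2 r_z) // (fr3.2 r_z).
  have tmp5 : rmem m5 r_tmp 0 = env S E p a (rmem m1 r_thr u).
    by rewrite (fr5.2 r_tmp) // e4 /= /update /= ev3 thr2.
  have mu5 : imem m5 i_u 0 = u.
    by rewrite (fr5.1 i_u) // (fr4.1 i_u) // (fr3.1 i_u) // (fr2.1 i_u).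
  exists v => //; rewrite /= tmp5 ev5 thr4 mu5.
  have [c1 c2] := node_thr nd z0; have [d1 d2] := cr (rmem m1 r_thr u).
  move: ub' bN' b2; rewrite !expnS => ub' bN' b2.
  rewrite e; case: ifP => cz.
    have zt : z0 <= rmem m1 r_thr u.
      by case: leP => // /(crossing_lt S_lt cr); rewrite ltNge cz.
    exists b', (u + u)%N; rewrite /= /update /=.
    have -> : Num.max (env S E v b' z0) (env S E v (b' + 2 ^ v) z0) = env S E v b' z0.
      by apply/max_idPl/c1.
    by clear - xu' ub' bN' b1 b2 p2'; split=> //; [lia|lia|lia|split=> //; lia].
  have zt : rmem m1 r_thr u <= z0.
    by rewrite ltW // ltNge; apply/negP => /d2; rewrite cz.
  exists (b' + 2 ^ v)%N, (u + u + 1)%N; rewrite /= /update /=.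
  have -> : Num.max (env S E v b' z0) (env S E v (b' + 2 ^ v) z0) =
    env S E v (b' + 2 ^ v) z0 by apply/max_idPr/c2.
  by clear - xu' ub' bN' b1 b2 p2'; split=> //; [lia|lia|lia|split=> //; lia].
have X1 : (0 < l.+1 ^ 2)%N by rewrite expn_gt0.
have X2 : (l.+1 <= l.+1 ^ 2)%N by rewrite -mulnn; lia.
by cost; apply: (costM (X := l.+1) (Y := l.+1)); rewrite ?mulnn //; [cost|lia].
Qed.

Lemma find_theta_ok : exists C, forall (S E r : nat -> R) (n k l : nat) (tau : R),
  admissible S E r -> forall m p a x,
  loaded S E r n k l tau m -> tree_ok S E r l x.+1 m -> imem m i_node 0 = x ->
  (0 < x)%N -> (x * 2 ^ p.+1 = 2 ^ l + a)%N -> (a + 2 ^ p.+1 <= 2 ^ l)%N ->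
  rmem m r_K x = env S E p a (rho r p (a + 2 ^ p)%N) ->
  runs find_theta m (C * l.+1 ^ 2)
    (fun m' => forall i, (i <= a)%N ->
       (i < imem m' i_lo 0)%N = left_wins S E r p a i).
Proof.
have [C2 pairs_ok_] := @pairs_descent_ok R.
eexists=> S E r n k l tau [S_lt E_le r_ge0] m p a x ld tr mx x0 xa aN Kx.
have pairs_ok := pairs_ok_ S E r n k l tau (And3 S_lt E_le r_ge0).
have pl : (p.+1 <= l)%N by rewrite -(leq_exp2l (m := 2)) //; lia.
apply: runs_le; last first.
  apply: runs_straight_seq => // m1 fr1 e1.
  have ld1 := loaded_frame fr1 isT isT ld.
  have tr1 := tree_frame fr1 isT isT tr.
  apply: (runs_seq (Q1 := fun m' => imem m' i_u 0 = (2 ^ l + a)%N)).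
    apply: (runs_post (Q := fun m' => (exists v : nat, exists w u,
      [/\ imem m' i_u 0 = u, (w <= v)%N, (u * 2 ^ w = 2 ^ l + a)%N & (a + 2 ^ w <= 2 ^ l)%N]) /\ ~~ beval m' (ilt (iv i_u) (iv i_N)))).
      move=> m' fr [[v [w [u [mu _ H1 H2]]]]].
      have ld' := loaded_frame fr isT isT ld1.
      rewrite /= mu (loaded_N ld') addn1 (node_lt H1 H2) -eqn0Ngt => /eqP w0; subst w.
      by move: H1; rewrite muln1.
    apply: (runs_while (v0 := l)) => [v m' fr [w [u [mu wv H1 H2]]]|].
      have ld' := loaded_frame fr isT isT ld1.
      rewrite /= mu (loaded_N ld') addn1 (node_lt H1 H2) => w0.
      case: w w0 wv H1 H2 => // w _ wv; rewrite expnS => H1 H2.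
      apply: runs_straight => //; exists v.-1; first lia.
      exists w, (u + u)%N; rewrite /= /update /= mu.
      by split=> //; lia.
    by exists p.+1, x; split=> //; rewrite e1 /= /update /= mx.
  move=> m2 fr2 mu2.
  have ld2 := loaded_frame fr2 isT isT ld1.
  have tr2 := tree_frame fr2 isT isT tr1.
  apply: runs_straight_seq => // m3 fr3 e3.
  have ld3 := loaded_frame fr3 isT isT ld2.
  have tr3 := tree_frame fr3 isT isT tr2.
  have mx3 : imem m3 i_node 0 = x.
    by rewrite (fr3.1 i_node) // (fr2.1 i_node) // (fr1.1 i_node).
  have Kx3 : rmem m3 r_K x = env S E p a (rho r p (a + 2 ^ p)).
    by rewrite (fr3.2 r_K) // (fr2.2 r_K) // (fr1.2 r_K).
  apply: (runs_post (Q := fun m' => (exists v : nat, exists lo hi,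
    [/\ imem m' i_lo 0 = lo, imem m' i_hi 0 = hi, (lo <= hi)%N, (hi - lo < 2 ^ v)%N &
     [/\ (hi <= a.+1)%N, forall i, (i < lo)%N -> left_wins S E r p a i &
      forall i, (hi <= i)%N -> (i <= a)%N -> ~~ left_wins S E r p a i]]) /\
     ~~ beval m' (ilt (iv i_lo) (iv i_hi)))).
    move=> m' fr [[v [lo [hi [mlo mhi lohi _ [ha Hlo Hhi]]]]]].
    rewrite /= mlo mhi addn1 -leqNgt => hilo i ia; case: ltnP => [/Hlo -> //|ilo].
    by apply/esym/negbTE/Hhi => //; lia.
  (* The interval has length a + 1 < 2^(l+1) at first and is halved by each test. *)
  apply: (runs_while (v0 := l.+1)); last first.
    exists 0%N, a.+1; rewrite e3 /= /update /= mu2 (loaded_N ld2).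
    split=> //; [lia|by rewrite subn0 expnS; lia|].
    by split=> // i; lia.
  move=> v m4 fr4 [lo [hi [mlo mhi lohi hv [ha Hlo Hhi]]]] bm.
  have ld4 := loaded_frame fr4 isT isT ld3.
  have tr4 := tree_frame fr4 isT isT tr3.
  have mx4 : imem m4 i_node 0 = x by rewrite (fr4.1 i_node).
  move: bm; rewrite /= mlo mhi addn1 => lthi.
  set mid := (lo + hi)./2.
  have mid1 : (lo <= mid < hi)%N.
    by rewrite /mid; have := odd_double_half (lo + hi); case: odd; lia.
  have mid2 : (hi - mid - 1 < 2 ^ v.-1 /\ mid - lo < 2 ^ v.-1)%N.
    case: v hv => [|v]; rewrite ?expnS /= => hv; first by lia.
    by rewrite /mid; have := odd_double_half (lo + hi); case: odd; lia.
  have v0 : (v.-1 < v)%N by case: v hv {mid2} => // hv; move: hv; rewrite expn0; lia.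
  apply: runs_straight_seq => // m5 fr5 e5.
  have ld5 := loaded_frame fr5 isT isT ld4.
  have tr5 := tree_frame fr5 isT isT tr4.
  have mx5 : imem m5 i_node 0 = x by rewrite (fr5.1 i_node).
  have mid5 : imem m5 i_mid 0 = mid by rewrite e5 /= /update /= mlo mhi.
  have lo5 : imem m5 i_lo 0 = lo by rewrite (fr5.1 i_lo).
  have hi5 : imem m5 i_hi 0 = hi by rewrite (fr5.1 i_hi).
  have p2 : (0 < 2 ^ p)%N by rewrite expn_gt0.
  have [xA xB] : ((x + x) * 2 ^ p = 2 ^ l + a /\ (x + x + 1) * 2 ^ p = 2 ^ l + (a + 2 ^ p))%N.
    by move: xa; rewrite expnS; lia.
  have [aA aB] : (a + 2 ^ p <= 2 ^ l /\ a + 2 ^ p + 2 ^ p <= 2 ^ l)%N.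
    by move: aN; rewrite expnS; lia.
  have mida : (mid <= a)%N by lia.
  apply: runs_seq.
    apply: (pairs_ok m5 p a (x + x)%N x.+1 mid) => //; [lia| |lia|].
      by rewrite e5 /= /update /= mx4.
    by rewrite e5 /= /update /= mlo mhi.
  move=> m6 fr6 acc6.
  have ld6 := loaded_frame fr6 isT isT ld5.
  have tr6 := tree_frame fr6 isT isT tr5.
  have mx6 : imem m6 i_node 0 = x by rewrite (fr6.1 i_node).
  have mid6 : imem m6 i_mid 0 = mid by rewrite (fr6.1 i_mid).
  have Kx6 : rmem m6 r_K x = env S E p a (rho r p (a + 2 ^ p)).
    by rewrite (fr6.2 r_K) // (fr5.2 r_K) // (fr4.2 r_K).
  have aL : rmem m6 r_acc 0 = pairs S E r p a mid.
    rewrite acc6 e5 /= /update /= (loaded_N ld4) (loaded_E ld4) // sub0r.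
    by apply/max_idPr/pairs_lb.
  have rB : rmem m6 r_rho (x + x + 1) = rho r p (a + 2 ^ p).
    by apply: (rho_ok ld6 tr6 _ xB aB); lia.
  apply: runs_straight_seq => // m7 fr7 e7.
  have ld7 := loaded_frame fr7 isT isT ld6.
  have tr7 := tree_frame fr7 isT isT tr6.
  apply: runs_seq.
    apply: (pairs_ok m7 p (a + 2 ^ p)%N (x + x + 1)%N x.+1 mid) => //; [lia| |lia| |lia].
      by rewrite e7 /= /update /= mx6.
    by rewrite (fr7.1 i_p) // (fr6.1 i_p) // e5 /= /update /= mlo mhi.
  move=> m8 fr8 acc8.
  have c7 : rmem m7 r_acc 0 = cross S E r p a mid.
    by rewrite e7 /= /update /= mx6 mid6 Kx6 rB (loaded_S ld6) //; lia.
  have t8 : rmem m8 r_tmp 0 = pairs S E r p a mid.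
    by rewrite (fr8.2 r_tmp) // e7 /= /update /= aL.
  have mid8 : imem m8 i_mid 0 = mid by rewrite (fr8.1 i_mid) // (fr7.1 i_mid).
  have lo8 : imem m8 i_lo 0 = lo by rewrite (fr8.1 i_lo) // (fr7.1 i_lo) // (fr6.1 i_lo).
  have hi8 : imem m8 i_hi 0 = hi by rewrite (fr8.1 i_hi) // (fr7.1 i_hi) // (fr6.1 i_hi).
  apply: runs_straight => //; exists v.-1 => //.
  rewrite /= acc8 c7 t8 mid8 -/(left_wins S E r p a mid).
  case: ifP => lw.
    exists mid.+1, hi; rewrite /= /update /= hi8 addn1.
    split=> //; [lia|by rewrite subnS -subn1; case: mid2|split=> //].
    by move=> i im; apply: left_wins_down lw => //; lia.
  exists lo, mid; rewrite /= /update /= lo8.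
  split=> //; [lia|by case: mid2|split=> //; first lia].
  move=> i mi ia; apply/negP => lwi; move: lw.
  by rewrite (left_wins_down S_lt r_ge0 mi ia lwi).
have X1 : (0 < l.+1 ^ 2)%N by rewrite expn_gt0.
have X2 : (l.+1 <= l.+1 ^ 2)%N by rewrite -mulnn; lia.
cost; apply: (costM (X := l.+1) (Y := l.+1)); rewrite ?mulnn //; try lia; cost.
Qed.

Lemma build_node_ok : exists C, forall (S E r : nat -> R) (n k l : nat) (tau : R),
  admissible S E r -> forall m p a x,
  loaded S E r n k l tau m -> tree_ok S E r l x.+1 m -> imem m i_node 0 = x ->
  (0 < x)%N -> (x * 2 ^ p.+1 = 2 ^ l + a)%N -> (a + 2 ^ p.+1 <= 2 ^ l)%N ->
  runs build_node m (C * l.+1 ^ 2) (fun m' => loaded S E r n k l tau m' /\ tree_ok S E r l x m').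
Proof.
have [C1 env_ok_] := @env_descent_ok R.
have [C2 leaf_ok_] := find_leaf_ok.
have [C3 theta_ok_] := find_theta_ok.
eexists=> S E r n k l tau [S_lt E_le r_ge0] m p a x ld tr mx x0 xa aN.
have env_ok := env_ok_ S E r n k l tau (And3 S_lt E_le r_ge0).
have leaf_ok := leaf_ok_ S E r n k l tau (And3 S_lt E_le r_ge0).
have theta_ok := theta_ok_ S E r n k l tau (And3 S_lt E_le r_ge0).
have pl : (p.+1 <= l)%N by rewrite -(leq_exp2l (m := 2)) //; lia.
have p2 : (0 < 2 ^ p)%N by rewrite expn_gt0.
have [xA xB] : ((x + x) * 2 ^ p = 2 ^ l + a /\ (x + x + 1) * 2 ^ p = 2 ^ l + (a + 2 ^ p))%N.
  by move: xa; rewrite expnS; lia.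
have [aA aB] : (a + 2 ^ p <= 2 ^ l /\ a + 2 ^ p + 2 ^ p <= 2 ^ l)%N.
  by move: aN; rewrite expnS; lia.
have xN : (x < 2 ^ l)%N by rewrite (node_lt xa aN).
(* Writes at the new node x touch neither the leaves, at N and beyond, nor the nodes already built,
   whose indices exceed x. *)
have xh h : (2 ^ l + h == x)%N = false by apply/negbTE; rewrite neq_ltn; lia.
have xy y : (x < y)%N -> (y == x) = false by move=> ?; apply/negbTE; rewrite neq_ltn; lia.
have [z0 cr] := crossing_ex E S_lt p a.
apply: runs_le; last first.
  apply: runs_straight_seq => // m1 fr1 e1.
  have rho1 : rmem m1 r_rho = update (rmem m) r_rho x (rho r p.+1 a) r_rho.
    rewrite e1 /= mx (rho_ok ld tr _ xA aA) ?(rho_ok ld tr _ xB aB); [|lia|lia].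
    by case: lerP => _.
  have ld1 : loaded S E r n k l tau m1.
    case: ld => *; split; rewrite ?(fr1.1 0%N) ?(fr1.1 i_N) ?(fr1.2 r_tau) // => h Hh.
    - by rewrite (fr1.2 r_S) //; auto.
    - by rewrite (fr1.2 r_E) //; auto.
    - by rewrite rho1 /update /= xh; auto.
  have tr1 : tree_ok S E r l x.+1 m1.
    apply: tree_agree tr => y xy'; rewrite (fr1.1 i_theta) // (fr1.2 r_thr) // (fr1.2 r_K) //.
    by rewrite rho1 /update /= xy.
  have mx1 : imem m1 i_node 0 = x by rewrite (fr1.1 i_node).
  have z1 : rmem m1 r_z 0 = rho r p (a + 2 ^ p).
    rewrite -(rho_ok ld1 tr1 _ xB aB); last lia.
    by rewrite e1 /=; case: ifP => _ /=; rewrite /update /= mx // !xy //; lia.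
  apply: runs_seq.
    apply: (env_ok m1 p a (x + x)%N x.+1) => //; [lia| |lia].
    by rewrite e1 /=; case: ifP => _ /=; rewrite /update /= mx.
  move=> m2 fr2 ev2.
  have ld2 := loaded_frame fr2 isT isT ld1.
  have tr2 := tree_frame fr2 isT isT tr1.
  have mx2 : imem m2 i_node 0 = x by rewrite (fr2.1 i_node).
  apply: runs_straight_seq => // m3 fr3 e3.
  have ld3 := loaded_frame fr3 isT isT ld2.
  have K3 : rmem m3 r_K = update (rmem m2) r_K x (env S E p a (rho r p (a + 2 ^ p))) r_K.
    by rewrite e3 /= mx2 ev2 z1.
  have tr3 : tree_ok S E r l x.+1 m3.
    apply: tree_agree tr2 => y xy'; rewrite (fr3.1 i_theta) // (fr3.2 r_rho) // (fr3.2 r_thr) //.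
    by rewrite K3 /update /= xy.
  have mx3 : imem m3 i_node 0 = x by rewrite (fr3.1 i_node).
  have u3 : imem m3 i_u 0 = (x + x)%N by rewrite e3 /= /update /= mx2.
  apply: runs_seq.
    by apply: (leaf_ok m3 p a x a z0) => //; rewrite u3 //; lia.
  move=> m4 fr4 [h [u4 Hh eh]].
  have ld4 := loaded_frame fr4 isT isT ld3.
  have tr4 := tree_frame fr4 isT isT tr3.
  have mx4 : imem m4 i_node 0 = x by rewrite (fr4.1 i_node).
  apply: runs_straight_seq => // m5 fr5 e5.
  have ld5 := loaded_frame fr5 isT isT ld4.
  have tr5 := tree_frame fr5 isT isT tr4.
  have mx5 : imem m5 i_node 0 = x by rewrite (fr5.1 i_node).
  have u5 : imem m5 i_u 0 = (x + x + 1)%N by rewrite e5 /= /update /= mx4.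
  apply: runs_seq.
    by apply: (leaf_ok m5 p a x (a + 2 ^ p)%N z0) => //; rewrite u5 //; lia.
  move=> m6 fr6 [h' [u6 Hh' eh']].
  have ld6 := loaded_frame fr6 isT isT ld5.
  have tr6 := tree_frame fr6 isT isT tr5.
  have mx6 : imem m6 i_node 0 = x by rewrite (fr6.1 i_node).
  have lo6 : imem m6 i_lo 0 = (2 ^ l + h)%N by rewrite (fr6.1 i_lo) // e5 /= /update /= u4.
  apply: runs_straight_seq => // m7 fr7 e7.
  have ld7 := loaded_frame fr7 isT isT ld6.
  have thr7 : rmem m7 r_thr = update (rmem m6) r_thr x z0 r_thr.
    rewrite e7 /= mx6 u6 lo6 (loaded_N ld6) !addKn !addn1.
    rewrite !(loaded_S ld6) ?(loaded_E ld6); try lia.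
    by rewrite -(crossing_meet S_lt cr _ eh eh') //; lia.
  have tr7 : tree_ok S E r l x.+1 m7.
    apply: tree_agree tr6 => y xy'; rewrite (fr7.1 i_theta) // (fr7.2 r_rho) // (fr7.2 r_K) //.
    by rewrite thr7 /update /= xy.
  have mx7 : imem m7 i_node 0 = x by rewrite (fr7.1 i_node).
  have K7 : rmem m7 r_K x = env S E p a (rho r p (a + 2 ^ p)).
    rewrite (fr7.2 r_K) // (fr6.2 r_K) // (fr5.2 r_K) // (fr4.2 r_K) // K3.
    by rewrite /update /= eqxx.
  apply: runs_seq.
    exact: (theta_ok m7 p a x).
  move=> m8 fr8 lo8.
  have ld8 := loaded_frame fr8 isT isT ld7.
  have tr8 := tree_frame fr8 isT isT tr7.
  have mx8 : imem m8 i_node 0 = x by rewrite (fr8.1 i_node).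
  apply: runs_straight => //; split.
    exact: loaded_frame (exec_frame (exec_iset m8 i_theta (iv i_node) (iv i_lo))) isT isT ld8.
  move=> p' a' y xy' H1 H2; move: xy'; rewrite leq_eqVlt => /orP[/eqP ey|xy'].
    subst y; have [[ep] ea] := node_uniq xa aN H1 H2; subst p' a'.
    split; rewrite /=.
    - rewrite (fr8.2 r_rho) // (fr7.2 r_rho) // (fr6.2 r_rho) // (fr5.2 r_rho) //.
      rewrite (fr4.2 r_rho) // (fr3.2 r_rho) // (fr2.2 r_rho) // rho1.
      by rewrite /update /= eqxx.
    - by rewrite (fr8.2 r_thr) // thr7 /update /= eqxx.
    - by rewrite (fr8.2 r_K).
    - by move=> i ia; rewrite /update /= mx8 eqxx lo8.
  have [] := tr8 p' a' y xy' H1 H2; move=> *; split=> //= i ia.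
  by rewrite /update /= mx8 xy //; auto.
have X1 : (0 < l.+1 ^ 2)%N by rewrite expn_gt0.
have X2 : (l.+1 <= l.+1 ^ 2)%N by rewrite -mulnn; lia.
by cost; exact: leq_mul (leqnn _) X2.
Qed.

Lemma build_tree_ok : exists C, forall (S E r : nat -> R) (n k l : nat) (tau : R),
  admissible S E r -> forall m, loaded S E r n k l tau m ->
  runs build_tree m (C * (2 ^ l * l.+1 ^ 2)) (fun m' => loaded S E r n k l tau m' /\ tree_ok S E r l 1 m').
Proof.
have [C bn_] := build_node_ok.
eexists=> S E r n k l tau [S_lt E_le r_ge0] m ld.
have bn := bn_ S E r n k l tau (And3 S_lt E_le r_ge0).
have N0 : (0 < 2 ^ l)%N by rewrite expn_gt0.
apply: runs_le; last first.
  apply: runs_straight_seq => // m1 fr1 e1.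
  have ld1 := loaded_frame fr1 isT isT ld.
  apply: (runs_post (Q := fun m' => (exists v, [/\ imem m' i_node 0 = v, (0 < v <= 2 ^ l)%N,
     loaded S E r n k l tau m' & tree_ok S E r l v m']) /\ ~~ beval m' (BILe (ILit 2) (iv i_node)))).
    move=> m' _ [[v [mv vN ld' tr']]]; rewrite /= mv -ltnNge => v1; split=> //.
    by have -> : 1%N = v by lia.
  apply: (runs_while (v0 := (2 ^ l)%N)); last first.
    have n1 : imem m1 i_node 0 = (2 ^ l)%N by rewrite e1 /= /update /= (loaded_N ld).
    split=> //; first by rewrite N0 leqnn.
    move=> p a x Nx H1 H2; have := node_lt H1 H2; lia.
  move=> v m2 fr2 [mv vN ld2 tr2] bm.
  move: bm; rewrite /= mv => v2.
  have [p [a [H1 H2]]] := node_ex (l := l) (x := v.-1) ltac:(lia) ltac:(lia).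
  apply: runs_straight_seq => // m3 fr3 e3.
  have ld3 := loaded_frame fr3 isT isT ld2.
  have tr3 := tree_frame fr3 isT isT tr2.
  have mv3 : imem m3 i_node 0 = v.-1 by rewrite e3 /= /update /= mv subn1.
  apply: (runs_post _ (bn m3 p a v.-1 ld3 _ mv3 _ H1 H2)); [|by rewrite prednK //; lia|lia].
  move=> m4 fr4 [ld4 tr4]; exists v.-1; first lia.
  split=> //; [by rewrite (fr4.1 i_node)|lia].
have X1 : (0 < l.+1 ^ 2)%N by rewrite expn_gt0.
have X3 : (0 < 2 ^ l * l.+1 ^ 2)%N by rewrite muln_gt0 N0.
by cost; apply: (costM (X := l.+1 ^ 2) (Y := (2 ^ l)%N)); rewrite ?[(_ * 2 ^ l)%N]mulnC //; cost.
Qed.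

End BuildCost.

(** * The path and its mirror image *)

(** The fuel keeps the scan on the path: started at c with fuel n.-1 - c, for c < n, it stops at the
    last vertex at the latest. *)
Fixpoint scan (ok : nat -> bool) (c fuel : nat) : nat :=
  if fuel is f.+1 then if ok c.+1 then scan ok c.+1 f else c else c.

Lemma scan_bounds ok c f : (c <= scan ok c f <= c + f)%N.
Proof.
elim: f c => [|f IH] c /=; first by rewrite addn0 leqnn.
by case: ifP => _; [have := IH c.+1; lia|lia].
Qed.

Lemma scan_true ok c f y : (c < y <= scan ok c f)%N -> ok y.
Proof.
elim: f c => [|f IH] c /=; first by lia.
case: ifP => [okc|_]; last by lia.
move=> /andP[cy ys]; case: (eqVneq y c.+1) => [->//|yc].
by apply: (IH c.+1); lia.
Qed.

Lemma scan_false ok c f : (scan ok c f < c + f)%N -> ~~ ok (scan ok c f).+1.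
Proof.
elim: f c => [|f IH] c /=; first by lia.
by case: ifP => [okc H|->] //; apply: IH; lia.
Qed.

Section Network.
Variables (R : realType) (n : nat) (P : path_network R n).
Hypothesis n_gt0 : (0 < n)%N.
Implicit Types (t : R) (i s j : nat).

Notation l_ := (nth 0 (edge_length P)).
Notation c_ := (nth 0 (edge_capacity P)).
Notation tau := (transit_time P).

(* The path followed by its mirror image: evacuation to the left on the path is
   evacuation to the right on the mirror image. *)
Definition dweight (h : nat) : nat :=
  if (h < n)%N then nth 0%N (weight P) h
  else if (h < n + n)%N then nth 0%N (weight P) (n + n - 1 - h) else 1.

(** The edge n-1 that joins the path to its image is read out of range of the tuples: it has length
    0 and capacity 0, hence inverse capacity 0. *)
Definition dlength (h : nat) : R :=
  if (h < n)%N then l_ h else if (h < n + n)%N then l_ (n + n - 2 - h)%N else 0.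

Definition dcapacity (h : nat) : R :=
  if (h < n)%N then c_ h else if (h < n + n)%N then c_ (n + n - 2 - h)%N else 0.

Definition dS (h : nat) : R := \sum_(0 <= j < h) (dweight j)%:R.
Definition dE (h : nat) : R := \sum_(0 <= j < h) dlength j * tau.
Definition dr (h : nat) : R := (dcapacity h)^-1.

Lemma dS_S h : dS h.+1 = dS h + (dweight h)%:R.
Proof. by rewrite /dS big_nat_recr. Qed.

Lemma dE_S h : dE h.+1 = dE h + dlength h * tau.
Proof. by rewrite /dE big_nat_recr. Qed.

Lemma tau_gt0 : 0 < tau.
Proof. exact: transit_time_gt0. Qed.

Lemma length_ge0 h : 0 <= l_ h.
Proof.
case: (ltnP h (size (edge_length P))) => H; last by rewrite nth_default.
by apply: (allP (edge_length_ge0 P)); rewrite mem_nth.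
Qed.

Lemma capacity_ge0 h : 0 <= c_ h.
Proof.
case: (ltnP h (size (edge_capacity P))) => H; last by rewrite nth_default.
by apply/ltW/(allP (edge_capacity_gt0 P)); rewrite mem_nth.
Qed.

Lemma capacity_gt0 h : (h < n.-1)%N -> 0 < c_ h.
Proof.
by move=> H; apply: (allP (edge_capacity_gt0 P)); rewrite mem_nth // size_tuple.
Qed.

Lemma dweight_gt0 h : (0 < dweight h)%N.
Proof.
have w0 j : (j < n)%N -> (0 < nth 0%N (weight P) j)%N.
  by move=> H; apply: (allP (weight_gt0 P)); rewrite mem_nth // size_tuple.
rewrite /dweight; case: (ltnP h n) => H1; first exact: w0.
by case: (ltnP h (n + n)) => // H2; apply: w0; lia.
Qed.

Lemma dS_lt h : dS h < dS h.+1.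
Proof. by rewrite dS_S ltrDl ltr0n dweight_gt0. Qed.

Lemma dE_le h : dE h <= dE h.+1.
Proof.
rewrite dE_S lerDl mulr_ge0 ?(ltW tau_gt0) // /dlength.
by case: ifP => _; [|case: ifP => _ //]; apply: length_ge0.
Qed.

Lemma dr_ge0 h : 0 <= dr h.
Proof.
rewrite /dr invr_ge0 /dcapacity.
by case: ifP => _; [|case: ifP => _ //]; apply: capacity_ge0.
Qed.

Lemma network_admissible : admissible dS dE dr.
Proof. by split; [exact: dS_lt|exact: dE_le|exact: dr_ge0]. Qed.

Definition lc i s := lcost dS dE dr i s.
Definition rc s j := lc (n + n - 1 - j) (n + n - 1 - s).

Lemma mirror_E u v : (u <= v)%N -> (v < n)%N ->
  dE (n + n - 1 - u) - dE (n + n - 1 - v) = dE v - dE u.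
Proof.
move=> uv; rewrite -(subnKC uv); move: (v - u)%N => d; elim: d {uv} => [|d IH] H.
  by rewrite addn0 !subrr.
have -> : dE (n + n - 1 - (u + d.+1)) =
    dE (n + n - 1 - (u + d)) - dlength (n + n - 1 - (u + d.+1)) * tau.
  have -> : (n + n - 1 - (u + d) = (n + n - 1 - (u + d.+1)).+1)%N by lia.
  by rewrite dE_S addrK.
have -> : dlength (n + n - 1 - (u + d.+1)) = dlength (u + d).
  rewrite /dlength [LHS]ifF ?[LHS]ifT ?[RHS]ifT; try lia.
  by congr (l_ _); lia.
by rewrite addnS dE_S; have := IH ltac:(lia); lra.
Qed.

Lemma mirror_S u v : (u <= v)%N -> (v <= n)%N ->
  dS (n + n - u) - dS (n + n - v) = dS v - dS u.
Proof.
move=> uv; rewrite -(subnKC uv); move: (v - u)%N => d; elim: d {uv} => [|d IH] H.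
  by rewrite addn0 !subrr.
have -> : dS (n + n - (u + d.+1)) =
    dS (n + n - (u + d)) - (dweight (n + n - (u + d.+1)))%:R.
  have -> : (n + n - (u + d) = (n + n - (u + d.+1)).+1)%N by lia.
  by rewrite dS_S addrK.
have -> : dweight (n + n - (u + d.+1)) = dweight (u + d).
  rewrite /dweight [LHS]ifF ?[LHS]ifT ?[RHS]ifT; try lia.
  by congr (nth 0%N _ _); lia.
by rewrite addnS dS_S; have := IH ltac:(lia); lra.
Qed.

Lemma mirror_r g : (g < n.-1)%N -> dr (n + n - 2 - g) = dr g.
Proof.
move=> H; rewrite /dr /dcapacity; congr (_^-1).
rewrite [LHS]ifF ?[LHS]ifT ?[RHS]ifT; try lia.
by congr (c_ _); lia.
Qed.

(** The pairs of the mirror image read back on the path: vertex h corresponds to 2n-1-h and edge g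
    to 2n-2-g, which turns a vertex before an edge into a vertex after it. *)
Lemma rc_leP s j t : (s <= j)%N -> (j < n)%N -> rc s j <= t <->
  (0 <= t /\ forall g h, (s <= g)%N -> (g < h)%N -> (h <= j)%N ->
     dE h - dE s + (dS j.+1 - dS h) * dr g <= t).
Proof.
move=> sj jn; rewrite /rc /lc lcost_leP; split=> -[t0 H]; split=> //;
  [move=> g h H1 H2 H3|move=> h' g' H1 H2 H3].
  have := H (n + n - 1 - h)%N (n + n - 2 - g)%N ltac:(lia) ltac:(lia) ltac:(lia).
  rewrite /pairv; have := @mirror_E s h ltac:(lia) ltac:(lia).
  have -> : ((n + n - 1 - h).+1 = n + n - h)%N by lia.
  have -> : (n + n - 1 - j = n + n - j.+1)%N by lia.
  rewrite mirror_r; last lia.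
  have := @mirror_S h j.+1 ltac:(lia) ltac:(lia); nra.
have := H (n + n - 2 - g')%N (n + n - 1 - h')%N ltac:(lia) ltac:(lia) ltac:(lia).
rewrite /pairv; have := @mirror_E s (n + n - 1 - h')%N ltac:(lia) ltac:(lia).
have -> : (n + n - 1 - (n + n - 1 - h') = h')%N by lia.
have -> : (n + n - 1 - j = n + n - j.+1)%N by lia.
rewrite -(@mirror_r (n + n - 2 - g')) ?subKn; try lia.
have := @mirror_S (n + n - 1 - h') j.+1 ltac:(lia) ltac:(lia).
have -> : (n + n - (n + n - 1 - h') = h'.+1)%N by lia.
nra.
Qed.

Lemma rc_ge0 s j : 0 <= rc s j.
Proof. exact: lcost_ge0. Qed.

Lemma rc_nil s j : (j <= s)%N -> rc s j = 0.
Proof. by move=> js; apply: lcost_nil; lia. Qed.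

Lemma rc_homo s j j' : (j <= j')%N -> rc s j <= rc s j'.
Proof. by move=> jj; apply: (lcost_anti _ dS_lt dr_ge0); lia. Qed.

Lemma rc_anti s s' j : (s <= s')%N -> rc s' j <= rc s j.
Proof. by move=> ss; apply: (lcost_homo dS_lt dE_le dr_ge0); lia. Qed.

Lemma rc_step s j : (s < j)%N -> (j < n)%N -> rc s.+1 j + (dE s.+1 - dE s) <= rc s j.
Proof.
move=> sj jn; rewrite /rc /lc.
have -> : (n + n - 1 - s = (n + n - 1 - s.+1).+1)%N by lia.
have := @lcost_step _ dS dE dr dS_lt dr_ge0 (n + n - 1 - j) (n + n - 1 - s.+1) ltac:(lia).
have := @mirror_E s s.+1 ltac:(lia) ltac:(lia).
have -> : (n + n - 1 - s = (n + n - 1 - s.+1).+1)%N by lia.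
lra.
Qed.

(** * Evacuation times in terms of left and right costs *)

Lemma min_capacity u v : (u < v)%N -> (v <= n.-1)%N -> exists2 c : R,
  (\big[mine/+oo]_(u <= h < v) (c_ h)%:E)%E = c%:E &
  [/\ 0 < c, forall g, (u <= g)%N -> (g < v)%N -> c <= c_ g &
      exists g, [/\ (u <= g)%N, (g < v)%N & c = c_ g]].
Proof.
move=> uv vn; have [d ev] : exists d, v = (u + d).+1 by exists (v - u).-1; lia.
subst v; elim: d {uv} vn => [|d IH] H.
  exists (c_ u); first by rewrite addn0 big_nat1.
  split; first by apply: capacity_gt0; lia.
    by move=> g g1 g2; have -> : g = u by lia.
  by exists u; split=> //; lia.
have [|c e [c0 Hc [g [g1 g2 eg]]]] := IH; first by lia.
exists (Num.min c (c_ (u + d.+1)%N)).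
  by rewrite big_nat_recr /=; [rewrite addnS e EFin_min|lia].
split.
- by rewrite lt_min c0 capacity_gt0.
- move=> g' g1' g2'; rewrite ge_min; case: (eqVneq g' (u + d.+1)%N) => [->|ne].
    by rewrite lexx orbT.
  by rewrite Hc //; lia.
- case: leP => _; last by exists (u + d.+1)%N; split=> //; lia.
  by exists g; split=> //; lia.
Qed.

(** The step that removes the minimum capacity: bounding the quotient by the minimum means bounding
    the quotient by every edge. *)
Lemma div_min_le (c w y t : R) u v : 0 <= w -> 0 < c ->
  (forall g, (u <= g)%N -> (g < v)%N -> c <= c_ g) ->
  (exists g, [/\ (u <= g)%N, (g < v)%N & c = c_ g]) ->
  (y + w / c <= t) <->
  (forall g, (u <= g)%N -> (g < v)%N -> y + w * (c_ g)^-1 <= t).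
Proof.
move=> w0 c0 Hc [g [g1 g2 e]]; split=> [H g' g1' g2'|H]; last by rewrite e; apply: H.
apply: le_trans H; rewrite lerD2l ler_wpM2l // lef_pV2 ?posrE ?Hc //.
exact: lt_le_trans c0 (Hc _ g1' g2').
Qed.

Lemma position_vertex h : (h <= n)%N -> position P (vertex R h) * tau = dE h.
Proof.
move=> hn; rewrite /position /vertex /= addr0 /dE mulr_suml.
by apply: eq_big_nat => j Hj; rewrite /dlength ifT //; lia.
Qed.

Lemma total_weightE i h : (i <= h)%N -> (h < n)%N ->
  (total_weight P i h)%:R = dS h.+1 - dS i.
Proof.
move=> ih hn; rewrite /total_weight /dS natr_sum [X in _ = X - _](big_cat_nat (n := i)) //=; last lia.
rewrite addrAC subrr add0r; apply: eq_big_nat => j Hj.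
by rewrite /dweight ifT //; lia.
Qed.

Lemma dr_capacity g : (g < n)%N -> dr g = (c_ g)^-1.
Proof. by rewrite /dr /dcapacity => ->. Qed.

Lemma term_leP (a b : Defs.point R) (y w t : R) : 0 <= w ->
  (a.1 <= next_vertex b)%N -> (next_vertex b <= n.-1)%N ->
  (a == b) = (a.1 == next_vertex b) ->
  (y%:E + w%:E / capacity P a b <= t%:E)%E <->
  (if a == b then is_true (y <= t) else
   forall g, (a.1 <= g)%N -> (g < next_vertex b)%N -> y + w * dr g <= t).
Proof.
move=> w0 ab bn e; rewrite /capacity; case: ifP => ab'.
  by rewrite invey mule0 adde0 lee_fin.
have lt : (a.1 < next_vertex b)%N by rewrite ltn_neqAle ab -e ab'.
have [c -> [c0 Hc Hex]] := min_capacity lt bn.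
rewrite inver gt_eqF // -EFinM -EFinD lee_fin (div_min_le _ _ w0 c0 Hc Hex).
by split=> H g g1 g2; have := H g g1 g2; rewrite dr_capacity //; lia.
Qed.

Lemma distE a b : dist P a b * tau = `|position P b * tau - position P a * tau|.
Proof. by rewrite /dist -mulrBl normrM (gtr0_norm tau_gt0). Qed.

Lemma position_point s x : (s <= n)%N -> position P (s, x) * tau = dE s + x * tau.
Proof.
by move=> sn; rewrite -position_vertex // /position /vertex /= addr0 mulrDl.
Qed.

Lemma weight_ge0 i h : (i <= h)%N -> 0 <= dS h.+1 - dS i.
Proof. by move=> ih; rewrite subr_ge0 (S_homo dS_lt) //; lia. Qed.

Lemma vertex_evacuation i s j t : (i <= s)%N -> (s <= j)%N -> (j < n)%N ->
  (evacuation_time P (vertex R s) i j <= t%:E)%E <-> lc i s <= t /\ rc s j <= t.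
Proof.
move=> is_ sj jn; rewrite /evacuation_time /next_vertex /= eqxx addn0 ge_max.
have left_ h : (i <= h)%N -> (h <= s)%N ->
    ((dist P (vertex R h) (vertex R s) * tau)%:E +
     (total_weight P i h)%:R%:E / capacity P (vertex R h) (vertex R s) <= t%:E)%E <->
    (if h == s then is_true (0 <= t) else forall g, (h <= g)%N -> (g < s)%N ->
       dE s + pairv dS dE dr i h g <= t).
  move=> ih hs; have vE : (vertex R h == vertex R s) = (h == s).
    by rewrite /vertex xpair_eqE eqxx andbT.
  rewrite total_weightE //; last lia.
  rewrite term_leP ?weight_ge0 /next_vertex /= ?eqxx ?addn0 ?vE //; last lia.
  rewrite distE !position_vertex; try lia.
  have := E_homo dE_le hs; rewrite -subr_ge0 => /ger0_norm ->.
  case: eqP => [->|_]; first by rewrite subrr.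
  by split=> H g g1 g2; have := H g g1 g2; rewrite /pairv; lra.
have right_ h : (s <= h)%N -> (h <= j)%N ->
    ((dist P (vertex R s) (vertex R h) * tau)%:E +
     (total_weight P h j)%:R%:E / capacity P (vertex R s) (vertex R h) <= t%:E)%E <->
    (if h == s then is_true (0 <= t) else forall g, (s <= g)%N -> (g < h)%N ->
       dE h - dE s + (dS j.+1 - dS h) * dr g <= t).
  move=> sh hj; have vE : (vertex R s == vertex R h) = (s == h).
    by rewrite /vertex xpair_eqE eqxx andbT.
  rewrite total_weightE //.
  rewrite term_leP ?weight_ge0 /next_vertex /= ?eqxx ?addn0 ?vE //; last lia.
  rewrite distE !position_vertex; try lia.
  have := E_homo dE_le sh; rewrite -subr_ge0 => /ger0_norm ->.
  by rewrite [s == h]eq_sym; case: eqP => [->|_]; first by rewrite subrr.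
split=> [/andP[/bigmax_natP[_ H1] /bigmax_natP[_ H2]]|[H1 H2]].
  (* The sink vertex itself has infinite capacity and contributes 0, which matches the floor of
     [lcost]. *)
  have t0 : 0 <= t by have := H1 s is_ (leqnn _) => /left_; rewrite eqxx; apply.
  rewrite rc_leP // /lc lcost_leP; split; split=> //.
    move=> h g ih hg gs; have := H1 h ih ltac:(lia) => /(left_ h ih ltac:(lia)).
    by rewrite ifF; [apply|apply/eqP; lia].
  move=> g h sg gh hj; have := H2 h ltac:(lia) ltac:(lia) => /(right_ h ltac:(lia) hj).
  by rewrite ifF; [apply|apply/eqP; lia].
move/lcost_leP: H1 => [t0 H1]; move/rc_leP: H2 => /(_ sj jn)[_ H2].
apply/andP; split; apply/bigmax_natP; split=> //; rewrite ?leNye // => h h1 h2.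
  apply/left_ => //; case: eqP => // _ g g1 g2; exact: H1.
by apply/right_ => //; case: eqP => // _ g g1 g2; apply: H2.
Qed.

(** Limit of the left cost as the sink tends to v_s from inside its edge: as for a sink at v_(s+1),
    that edge already counts as crossed, but its transit time is deducted. *)
Definition left_base i s : R := lc i s.+1 - (dE s.+1 - dE s).

Lemma interior_evacuation i s x j t : (i <= s)%N -> (s < j)%N -> (j < n)%N ->
  0 < x < l_ s ->
  (evacuation_time P (s, x) i j <= t%:E)%E <->
  [/\ 0 <= t, left_base i s + x * tau <= t & rc s j - x * tau <= t].
Proof.
move=> is_ sj jn /andP[x0 xl].
have tau0 := tau_gt0.
have nv : next_vertex (s, x) = s.+1 by rewrite /next_vertex /= gt_eqF // addn1.
have dEs : dE s.+1 = dE s + l_ s * tau.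
  by rewrite dE_S /dlength ifT //; lia.
have xt : x * tau < l_ s * tau by rewrite ltr_pM2r.
have xt0 : 0 < x * tau by rewrite mulr_gt0.
have neq1 h : (vertex R h == (s, x)) = false.
  by rewrite /vertex xpair_eqE [0 == x]lt_eqF // andbF.
have neq2 h : ((s, x) == vertex R h) = false by rewrite eq_sym neq1.
have left_ h : (i <= h)%N -> (h <= s)%N ->
    ((dist P (vertex R h) (s, x) * tau)%:E +
     (total_weight P i h)%:R%:E / capacity P (vertex R h) (s, x) <= t%:E)%E <->
    (forall g, (h <= g)%N -> (g < s.+1)%N ->
       dE s + x * tau + pairv dS dE dr i h g <= t).
  move=> ih hs; rewrite total_weightE //; last lia.
  rewrite term_leP ?weight_ge0 ?neq1 ?nv //=; try lia.
  rewrite distE position_vertex ?position_point; try lia.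
  have le0 : 0 <= dE s + x * tau - dE h by have := E_homo dE_le hs; lra.
  rewrite (ger0_norm le0).
  by split=> H g g1 g2; have := H g g1 g2; rewrite /pairv; lra.
have right_ h : (s < h)%N -> (h <= j)%N ->
    ((dist P (s, x) (vertex R h) * tau)%:E +
     (total_weight P h j)%:R%:E / capacity P (s, x) (vertex R h) <= t%:E)%E <->
    (forall g, (s <= g)%N -> (g < h)%N ->
       dE h - dE s + (dS j.+1 - dS h) * dr g <= t + x * tau).
  move=> sh hj; rewrite total_weightE //.
  rewrite term_leP ?weight_ge0 ?neq2 /next_vertex /= ?eqxx ?addn0 //; try lia.
  rewrite distE position_vertex ?position_point; try lia.
  have le0 : 0 <= dE h - (dE s + x * tau) by have := E_homo dE_le sh; lra.
  rewrite (ger0_norm le0).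
  by split=> H g g1 g2; have := H g g1 g2; lra.
rewrite /evacuation_time nv /= ge_max /left_base /lc.
split=> [/andP[/bigmax_natP[_ H1] /bigmax_natP[_ H2]]|[t0 H1 H2]].
  have t0 : 0 <= t.
    have := H1 s is_ (leqnn _) => /(left_ _ is_ (leqnn _)) /(_ s (leqnn _) (leqnn _)).
    by rewrite /pairv; have := weight_ge0 is_; have := dr_ge0 s; nra.
  split=> //.
    suff : lcost dS dE dr i s.+1 <= t + (dE s.+1 - dE s) - x * tau by lra.
    apply/lcost_leP; split; first lra.
    move=> h g ih hg gs; have := H1 h ih ltac:(lia) => /(left_ h ih ltac:(lia)).
    by move=> /(_ g hg gs); lra.
  suff : rc s j <= t + x * tau by lra.
  apply/rc_leP => //; [lia|split; first lra].
  move=> g h sg gh hj; have := H2 h ltac:(lia) ltac:(lia) => /(right_ h ltac:(lia) hj).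
  by apply.
have {}H1 : lcost dS dE dr i s.+1 <= t + (dE s.+1 - dE s) - x * tau by lra.
have {}H2 : rc s j <= t + x * tau by lra.
move/lcost_leP: H1 => [_ H1]; move/rc_leP: H2 => /(_ (ltnW sj) jn)[_ H2].
apply/andP; split; apply/bigmax_natP; split=> //; rewrite ?leNye // => h h1 h2.
  by apply/left_ => // g g1 g2; have := H1 h g h1 g1 g2; lra.
by apply/right_ => // g g1 g2; apply: H2.
Qed.

(* Least cost of v_i, ..., v_j with the sink at v_s or inside the edge after it:
   a sink at distance x from v_s costs [left_base i s + x tau] on its left and
   [rc s j - x tau] on its right, which balance at the mean. *)
Definition reach i s j : R := Num.min (rc s j) ((rc s j + left_base i s) / 2).

Lemma reach_homo i s j j' : (j <= j')%N -> reach i s j <= reach i s j'.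
Proof.
move=> jj; rewrite /reach le_min !ge_min.
have H := rc_homo s jj; rewrite H /=; apply/orP; right.
by rewrite ler_pM2r ?invr_gt0 // lerD2r.
Qed.

Lemma reach_leP i s j t : reach i s j <= t <->
  (rc s j <= t \/ rc s j + left_base i s <= t + t).
Proof.
rewrite /reach ge_min; split=> [/orP[]|[]]; [by left|right; lra|by move=> ->|].
by move=> H; apply/orP; right; lra.
Qed.

(** * The greedy choice of a subpath and its sink *)

Definition snext t i := scan (fun s => lc i s <= t) i (n.-1 - i).
Definition jnext t i :=
  scan (fun j => reach i (snext t i) j <= t) (snext t i) (n.-1 - snext t i).
Definition next_start t i := (jnext t i).+1.
(** The sink goes as far right as the left cost t allows, rather than to the balance point. The
    right cost is then at most t exactly when the mean of the two costs is. *)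
Definition xnext t i :=
  if (snext t i < jnext t i)%N && (left_base i (snext t i) < t)
  then (t - left_base i (snext t i)) / tau else 0.

Lemma snext_ge t i : (i <= snext t i)%N.
Proof. by have /andP[] := scan_bounds (fun s => lc i s <= t) i (n.-1 - i). Qed.

Lemma snext_lt t i : (i < n)%N -> (snext t i < n)%N.
Proof. by have := scan_bounds (fun s => lc i s <= t) i (n.-1 - i); rewrite /snext; lia. Qed.

Lemma jnext_ge t i : (snext t i <= jnext t i)%N.
Proof. by case/andP: (scan_bounds (fun j => reach i (snext t i) j <= t) (snext t i) (n.-1 - snext t i)). Qed.

Lemma jnext_lt t i : (i < n)%N -> (jnext t i < n)%N.
Proof.
move=> /(snext_lt t) H.
have := scan_bounds (fun j => reach i (snext t i) j <= t) (snext t i) (n.-1 - snext t i).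
rewrite /jnext; lia.
Qed.

Lemma next_gt t i : (i < next_start t i)%N.
Proof. by rewrite ltnS; apply: leq_trans (snext_ge t i) (jnext_ge t i). Qed.

Lemma snext_le t i : 0 <= t -> lc i (snext t i) <= t.
Proof.
move=> t0; have := snext_ge t i; rewrite leq_eqVlt => /orP[/eqP <-|H].
  by rewrite /lc lcost_nil.
by apply: (@scan_true (fun s => lc i s <= t) i (n.-1 - i)); rewrite H leqnn.
Qed.

Lemma snext_max t i s : (i <= s)%N -> (s < n)%N -> lc i s <= t -> (s <= snext t i)%N.
Proof.
move=> is_ sn Ht; rewrite leqNgt; apply/negP => H.
have := @scan_false (fun s => lc i s <= t) i (n.-1 - i) ltac:(rewrite -/(snext t i); lia).
rewrite -/(snext t i) => /negP; apply; apply: le_trans Ht.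
exact: (lcost_homo dS_lt dE_le dr_ge0).
Qed.

Lemma snext_maxS t i : (i < n)%N -> (snext t i < n.-1)%N -> t < lc i (snext t i).+1.
Proof.
move=> i_n H; rewrite ltNge; apply/negP => Ht.
have := @snext_max t i (snext t i).+1 ltac:(have := snext_ge t i; lia) ltac:(lia) Ht; lia.
Qed.

Lemma jnext_le t i : (snext t i < jnext t i)%N -> reach i (snext t i) (jnext t i) <= t.
Proof.
move=> H; apply: (@scan_true (fun j => reach i (snext t i) j <= t) (snext t i) (n.-1 - snext t i)).
by rewrite H leqnn.
Qed.

Lemma jnext_max t i j : (snext t i <= j)%N -> (j < n)%N ->
  reach i (snext t i) j <= t -> (j <= jnext t i)%N.
Proof.
move=> sj jn Ht; rewrite leqNgt; apply/negP => H.
have := @scan_false (fun j => reach i (snext t i) j <= t) (snext t i) (n.-1 - snext t i)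
  ltac:(rewrite -/(jnext t i); lia).
by rewrite -/(jnext t i) => /negP; apply; apply: le_trans (reach_homo _ _ H) Ht.
Qed.

Lemma next_evacuation t i : 0 <= t -> (i < n)%N ->
  in_subpath P i (jnext t i) (snext t i, xnext t i) /\
  (evacuation_time P (snext t i, xnext t i) i (jnext t i) <= t%:E)%E.
Proof.
move=> t0 i_n; have tau0 := tau_gt0.
have is_ := snext_ge t i; have sj := jnext_ge t i; have jn := jnext_lt t i_n.
have lcs := snext_le i t0.
rewrite /xnext; case: ifP => [/andP[sj' lb]|H].
  have dEs : dE (snext t i).+1 = dE (snext t i) + l_ (snext t i) * tau.
    by rewrite dE_S /dlength ifT //; lia.
  have tl := @snext_maxS t i i_n ltac:(lia).
  (* The next vertex already has left cost above t, so the point where the left cost reaches t is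
     strictly inside the edge. *)
  have x_lt : 0 < (t - left_base i (snext t i)) / tau < l_ (snext t i).
    rewrite divr_gt0 ?subr_gt0 //= ltr_pdivrMr //.
    by rewrite /left_base dEs; lra.
  have e : (t - left_base i (snext t i)) / tau * tau = t - left_base i (snext t i).
    by rewrite divfK // gt_eqF.
  split.
    rewrite /in_subpath /next_vertex /= is_ x_lt orbT andbT.
    by case/andP: x_lt => /gt_eqF -> _; rewrite addn1.
  apply/interior_evacuation => //; rewrite e; split=> //; first lra.
  by case/reach_leP: (jnext_le sj'); lra.
split; first by rewrite /in_subpath /next_vertex /= eqxx is_ addn0 sj.
apply/vertex_evacuation => //; split=> //.
move: sj; rewrite leq_eqVlt => /orP[/eqP <-|sj']; first by rewrite rc_nil.
move: H; rewrite sj' /= => /negbT; rewrite -leNgt => lb.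
by case/reach_leP: (jnext_le sj'); lra.
Qed.

(** Exchange argument: starting later lowers left costs, so the base vertex of the given sink is at
    or before the greedy one, and moving the sink to the right lowers right costs. *)
Lemma next_dominates t i i' j (s : Defs.point R) : (i' <= i)%N -> (i <= j)%N -> (j < n)%N ->
  in_subpath P i' j s -> (evacuation_time P s i' j <= t%:E)%E ->
  0 <= t /\ (j <= jnext t i)%N.
Proof.
case: s => s x; move=> i'i ij jn; rewrite /in_subpath /= => /andP[/andP[i's sj] Hx].
have s0 := snext_ge t i.
have bound s1 : (s1 <= snext t i)%N -> (s1 <= j)%N ->
    ((s1 <= snext t i)%N -> (snext t i <= j)%N -> reach i (snext t i) j <= t) ->
    (j <= jnext t i)%N.
  move=> s1s s1j H; case: (leqP (snext t i) j) => sj'; first by apply: jnext_max; auto.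
  by apply: leq_trans (ltnW sj') (jnext_ge t i).
have anti_lc s1 : lc i s1 <= lc i' s1 by apply: (lcost_anti _ dS_lt dr_ge0).
move: Hx => /orP[/eqP x0|xl].
  subst x; rewrite -/(vertex R s); move: sj; rewrite /next_vertex /= eqxx addn0 => sj.
  move=> /(vertex_evacuation _ i's sj jn)[H1 H2].
  split; first exact: le_trans (rc_ge0 _ _) H2.
  have ss : (s <= snext t i)%N.
    case: (leqP i s) => is_; last lia.
    by apply: snext_max => //; [lia|apply: le_trans (anti_lc s) H1].
  apply: (bound s) => // _ _; apply/reach_leP; left.
  exact: le_trans (rc_anti _ ss) H2.
have /andP[x0 xls] := xl.
have sj' : (s < j)%N by move: sj; rewrite /next_vertex /= gt_eqF // addn1.
move=> /(interior_evacuation _ i's sj' jn xl)[t0 H1 H2]; split=> //.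
have tau0 := tau_gt0; have xt0 : 0 < x * tau by rewrite mulr_gt0.
have dEs : dE s.+1 = dE s + l_ s * tau by rewrite dE_S /dlength ifT //; lia.
have xt : x * tau < l_ s * tau by rewrite ltr_pM2r.
have ss : (s <= snext t i)%N.
  case: (leqP i s) => is_; last lia.
  apply: snext_max => //; first lia.
  apply: le_trans (anti_lc s) _.
  have := @lcost_step _ dS dE dr dS_lt dr_ge0 i' s ltac:(lia).
  by move: H1; rewrite /left_base /lc; lra.
apply: (bound s) => // [|_ sj2]; first lia.
apply/reach_leP; move: ss; rewrite leq_eqVlt => /orP[/eqP es|ss].
  (* Both sinks are in the same edge: adding the left and right bounds eliminates x. *)
  right; rewrite -es; have := anti_lc s.+1; move: H1; rewrite /left_base; lra.
(* The vertex v_(s+1) is still at or before the greedy base. Its right cost is below that of v_s by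
   at least the whole edge, which exceeds x tau. *)
left; have := rc_anti j ss; have := rc_step sj' jn; lra.
Qed.
End Network.

(** * The greedy feasibility test *)

Section Solutions.
Variables (R : realType) (n : nat) (P : path_network R n).
Hypothesis n_gt0 : (0 < n)%N.
Implicit Types (t : R) (S : solution R).

Definition start t q := iter q (next_start P t) 0%N.

Lemma start_lt t q : (start t q < start t q.+1)%N.
Proof. exact: next_gt. Qed.

Lemma start_homo t q q' : (q <= q')%N -> (start t q <= start t q')%N.
Proof.
by apply: (homo_leq (fun x => leqnn x) (fun y x z => @leq_trans y x z)) => h;
   apply/ltnW/start_lt.
Qed.

(** Greedy starts keep growing past n, so solutions with fewer than k parts are accepted as well. *)
Definition achievable k t := (0 <= t) && (n <= start t k)%N.

(** By induction through [next_dominates], the greedy starts stay at or ahead of the cuts of any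
    solution of cost at most t. *)
Lemma solution_achievable k (S : solution R) t :
  feasible P k S -> (objective P S <= t%:E)%E -> achievable k t.
Proof.
case=> pk c0 cn clt cin /bigmax_natP[_ obj].
have cut_le q q' : (q <= q')%N -> (q' <= parts S)%N -> (Defs.cut S q <= Defs.cut S q')%N.
  move=> qq; rewrite -(subnKC qq); move: (q' - q)%N => d; elim: d {qq} => [|d IH] H.
    by rewrite addn0.
  by rewrite addnS; apply: leq_trans (IH _) (ltnW (clt _ _)); lia.
have p0 : (0 < parts S)%N.
  by rewrite lt0n; apply/eqP => p0; move: cn; rewrite p0 c0; lia.
have last_lt q : (q < parts S)%N -> ((Defs.cut S q.+1).-1 < n)%N.
  by move=> qp; have := cut_le q.+1 (parts S) qp (leqnn _); rewrite cn; lia.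
have t0 : 0 <= t.
  have := cin 0%N p0; have := obj 0%N isT p0; rewrite c0 => H1 H2.
  by have [] := next_dominates n_gt0 (leqnn 0) (leq0n _) (last_lt _ p0) H2 H1.
rewrite /achievable t0 /=; apply: leq_trans (start_homo t pk).
suff H q : (q <= parts S)%N -> (Defs.cut S q <= start t q)%N by rewrite -cn H.
elim: q => [|q IH] qp; first by rewrite c0.
have {}IH := IH (ltnW qp); have qlt := clt q qp.
case: (ltnP (start t q) (Defs.cut S q.+1)) => H; last first.
  exact: leq_trans H (ltnW (start_lt t q)).
have [_] := next_dominates n_gt0 (t := t) IH (j := (Defs.cut S q.+1).-1) ltac:(lia) (last_lt _ qp)
  (cin q qp) (obj q isT qp).
by rewrite /start iterS /next_start -/(start t q); lia.
Qed.

Record greedy_output t (S : solution R) : Prop := GreedyOutput {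
  greedy_end : start t (parts S) = n;
  greedy_cut : forall q, (q <= parts S)%N -> Defs.cut S q = start t q;
  greedy_sink : forall q, (q < parts S)%N ->
    sink S q = (snext P t (start t q), xnext P t (start t q)) }.

Lemma greedy_start_lt t S q : greedy_output t S -> (q < parts S)%N -> (start t q < n)%N.
Proof.
by case=> e _ _ qp; rewrite -e; apply: leq_trans (start_lt t q) (start_homo t qp).
Qed.

Lemma greedy_achievable t S k : greedy_output t S ->
  achievable k t = (0 <= t) && (parts S <= k)%N.
Proof.
move=> g; rewrite /achievable; congr andb; apply/idP/idP => H.
  rewrite leqNgt; apply/negP => /(greedy_start_lt g); lia.
by rewrite -{1}(greedy_end g); apply: start_homo.
Qed.

Lemma greedy_feasible t S k : greedy_output t S -> achievable k t ->
  feasible P k S /\ (objective P S <= t%:E)%E.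
Proof.
move=> g; rewrite (greedy_achievable _ g) => /andP[t0 pk].
have gs := greedy_start_lt g; case: (g) => ge gc gk.
have ev q : (q < parts S)%N -> in_subpath P (Defs.cut S q) (Defs.cut S q.+1).-1 (sink S q) /\
    (evacuation_time P (sink S q) (Defs.cut S q) (Defs.cut S q.+1).-1 <= t%:E)%E.
  move=> qp; rewrite gk // !gc //; last exact: ltnW.
  rewrite /start iterS -/(start t q) /next_start /=.
  exact: next_evacuation t0 (gs q qp).
split; first split=> //.
- by rewrite gc.
- by rewrite gc.
- by move=> q qp; rewrite !gc // ?start_lt // ltnW.
- by move=> q /ev[].
by apply/bigmax_natP; split=> [|q _ /ev[]//]; rewrite leNye.
Qed.

Lemma achievable_optimal t S k : greedy_output t S -> achievable k t ->
  (forall t', achievable k t' -> t <= t') -> optimal_k_sink P k S.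
Proof.
move=> g a mint; have [fS oS] := greedy_feasible g a; split=> // S' fS'.
apply: le_trans oS _; case e: (objective P S') => [u| |]; last 2 first.
- by rewrite leey.
(* An objective of -oo would make the cost -1 achievable. *)
- have := solution_achievable (t := -1) fS'; rewrite e leNye => /(_ isT).
  by rewrite /achievable oppr_ge0 ler10.
by rewrite lee_fin; apply/mint/(solution_achievable fS'); rewrite e.
Qed.

End Solutions.

(** * The feasibility test as a program *)

Notation i_i := 19%N.
Notation i_f := 20%N.
Notation i_j := 21%N.
Notation i_go := 22%N.
Notation r_t := 17%N.
Notation r_lb := 18%N.
Notation r_gv := 19%N.
Notation r_x := 20%N.

Definition query_at ei es : cmd := (iset i_qi ei ;; iset i_qs es) ;; query.

Definition set_base : cmd :=
  query_at (iv i_i) (iv i_f ⊞ ILit 1) ;;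
  rset r_lb (rv r_qr ⊖ (RGet r_E (iv i_f ⊞ ILit 1) ⊖ RGet r_E (iv i_f))).

Definition set_reach ej : cmd :=
  query_at (iv 0 ⊞ iv 0 ⊟ ILit 1 ⊟ ej) (iv 0 ⊞ iv 0 ⊟ ILit 1 ⊟ iv i_f) ;;
  (rset r_gv ((rv r_qr ⊕ rv r_lb) ⊘ ROfI (ILit 2)) ;;
   If (BRLe (rv r_qr) (rv r_gv)) (rset r_gv (rv r_qr)) Skip).

(** A step of the scan takes a query, which a loop condition cannot run; hence the flag [i_go]. *)
Definition scan_loop cv test cond : cmd :=
  iset i_go (ILit 1) ;;
  While (BILe (ILit 1) (iv i_go))
    (If (ilt (iv cv ⊞ ILit 1) (iv 0))
       (test ;; If cond (iset cv (iv cv ⊞ ILit 1)) (iset i_go (ILit 0)))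
       (iset i_go (ILit 0))).

Definition greedy : cmd :=
  (iset i_i (ILit 0) ;; iset 1 (ILit 0) ;; iset 2 (ILit 0)) ;;
  While (ilt (iv i_i) (iv 0))
    (iset i_f (iv i_i) ;;
     scan_loop i_f (query_at (iv i_i) (iv i_f ⊞ ILit 1)) (BRLe (rv r_qr) (rv r_t)) ;;
     set_base ;;
     iset i_j (iv i_f) ;;
     scan_loop i_j (set_reach (iv i_j ⊞ ILit 1)) (BRLe (rv r_gv) (rv r_t)) ;;
     (rset r_x (ROfI (ILit 0)) ;;
      If (BAnd (ilt (iv i_f) (iv i_j)) (BNot (BRLe (rv r_t) (rv r_lb))))
        (rset r_x ((rv r_t ⊖ rv r_lb) ⊘ rv r_tau)) Skip) ;;
     (ISet 3 (iv 1) (iv i_f) ;; RSet 4 (iv 1) (rv r_x) ;;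
      iset 1 (iv 1 ⊞ ILit 1) ;; iset i_i (iv i_j ⊞ ILit 1) ;;
      ISet 2 (iv 1) (iv i_i))).

Section Greedy.
Variable R : realType.
Implicit Types (m : memory R).

(** All iterations but the last advance the scan, and the last one fails or meets the end of the
    path. The 100 is slack for the bookkeeping around a test. *)
Lemma scan_loop_ok cv test cond K (ok : nat -> bool) n m c :
  cv != i_go -> 0%N \notin iwrites (scan_loop cv test cond) ->
  cv \notin iwrites test -> i_go \notin iwrites test ->
  imem m 0 0 = n -> imem m cv 0 = c ->
  (forall m1 y, frame (scan_loop cv test cond) m m1 -> imem m1 cv 0 = y ->
     (c <= y)%N -> (y.+1 < n)%N ->
     runs test m1 K (fun m2 => beval m2 cond = ok y.+1)) ->
  runs (scan_loop cv test cond) m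
    ((K + bcost cond + 100) *
       (scan ok c (n.-1 - c) - c).+2)
    (fun m' => imem m' cv 0 = scan ok c (n.-1 - c)).
Proof.
move=> cvgo w0 cvt got m0 mc Htest.
have gocv := negbTE cvgo; have cvgo' : (i_go == cv) = false by rewrite eq_sym.
set r := scan _ _ _; have /andP[cr rn] := scan_bounds ok c (n.-1 - c).
have rok := @scan_true ok c (n.-1 - c); have rno := @scan_false ok c (n.-1 - c).
rewrite -/r in cr rn rok rno.
apply: runs_le; last first.
  apply: runs_straight_seq => // m1 fr1 e1.
  apply: (runs_post (Q := fun m' => (exists v y, [/\ imem m' cv 0 = y, (c <= y <= r)%N &
      (imem m' i_go 0 = 1%N /\ v = (r - y).+1) \/ [/\ imem m' i_go 0 = 0%N, y = r & v = 0%N]])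
      /\ ~~ beval m' (BILe (ILit 1) (iv i_go)))).
    move=> m' _ [[v [y [my _ H]]] nb].
    by case: H => [[go1 _]|[_ yr _]]; [rewrite /= go1 in nb|rewrite my].
  apply: (runs_while (v0 := (r - c).+1)); last first.
    exists c; rewrite e1 /= /update /= gocv; split=> //; [lia|by left].
  move=> v m2 fr2 [y [my Hy H]] bm.
  case: H => [[go2 vy]|[go2 _ _]]; last by move: bm; rewrite /= go2.
  have n2 : imem m2 0 0 = n.
    have w0' : 0%N \notin iwrites (While (BILe (ILit 1) (iv i_go))
      (If (ilt (iv cv ⊞ ILit 1) (iv 0))
       (test ;; If cond (iset cv (iv cv ⊞ ILit 1)) (iset i_go (ILit 0)))
       (iset i_go (ILit 0)))).
      by move: w0; rewrite /scan_loop /= inE => /norP[].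
    by rewrite (fr2.1 0%N) // (fr1.1 0%N).
  apply: runs_if; rewrite /= my n2 => c1.
    apply: runs_seq.
      apply: (Htest m2 y) => //; [|lia|lia].
      have fr1' := frame_weaken (c' := scan_loop cv test cond) _ _ fr1.
      have fr2' := frame_weaken (c' := scan_loop cv test cond) _ _ fr2.
      apply: frame_trans (fr1' _ _) (fr2' _ _) => a //=; rewrite ?inE.
      + by move=> ->.
      + by move=> ->; rewrite orbT.
    move=> m3 fr3 b3; apply: runs_straight => //.
    have my3 : imem m3 cv 0 = y by rewrite (fr3.1 cv).
    rewrite /= b3; case: ifP => oky.
      exists v.-1; first lia.
      have yr : (y < r)%N.
        rewrite ltnNge; apply/negP => ry; have yr : y = r by lia.
        by move: (rno ltac:(lia)); rewrite -yr oky.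
      exists y.+1; rewrite /= /update /= eqxx my3 addn1 cvgo' /= (fr3.1 i_go) //.
      by split=> //; [lia|left; split=> //; lia].
    exists 0%N; first lia.
    exists y; rewrite /= /update /= gocv; split=> //; right; split=> //.
    case: (ltnP y r) => yr; last by lia.
    by move: oky; rewrite rok //; lia.
  apply: runs_straight => //; exists 0%N; first lia.
  by exists y; rewrite /= /update /= gocv; split=> //; right; split=> //; lia.
rewrite /=; lia.
Qed.

Definition network_in_memory n (P : path_network R n) k l m :=
  loaded (dS P) (dE P) (dr P) n k l (transit_time P) m /\
  tree_ok (dS P) (dE P) (dr P) l 1 m.

Lemma network_frame n (P : path_network R n) k l c m m' : frame c m m' ->
  all (fun a => a \notin iwrites c) [:: 0; i_N; i_theta]%N ->
  all (fun a => a \notin rwrites c) [:: r_tau; r_S; r_E; r_rho; r_thr; r_K]%N ->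
  network_in_memory P k l m -> network_in_memory P k l m'.
Proof.
move=> fr /and4P[i0 i1 i2 _] /and5P[r1 r2 r3 r4 /and3P[r5 r6 _]] [ld tr]; split.
  by apply: loaded_frame fr _ _ ld; rewrite /= ?i0 ?i1 ?r1 ?r2 ?r3 ?r4.
by apply: tree_frame fr i2 _ tr; rewrite /= ?r4 ?r5 ?r6.
Qed.

Lemma query_at_ok ei es : exists C, forall n (P : path_network R n) k l m i s,
  (0 < n)%N -> network_in_memory P k l m -> ieval m ei = i ->
  ieval (sem (iset i_qi ei) m) es = s -> (s <= 2 ^ l)%N ->
  runs (query_at ei es) m (C * l.+1 ^ 2) (fun m' => rmem m' r_qr 0 = lc P i s).
Proof.
have [C qok] := query_ok R.
eexists=> n P k l m i s n0 nm mi ms sl.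
apply: runs_le; last first.
  apply: runs_straight_seq => // m1 fr1 e1.
  have [ld1 tr1] := network_frame fr1 isT isT nm.
  apply: qok ld1 tr1 _ _ sl => //; first exact: network_admissible.
    by rewrite e1 /= /update /= mi.
  by rewrite e1 -ms.
have X1 : (0 < l.+1 ^ 2)%N by rewrite expn_gt0.
cost.
Qed.

Lemma set_base_ok : exists C, forall n (P : path_network R n) k l m i f,
  (n + n <= 2 ^ l)%N -> network_in_memory P k l m ->
  imem m i_i 0 = i -> imem m i_f 0 = f -> (f < n)%N ->
  runs set_base m (C * l.+1 ^ 2) (fun m' => rmem m' r_lb 0 = left_base P i f).
Proof.
have [C qok] := query_at_ok (iv i_i) (iv i_f ⊞ ILit 1).
eexists=> n P k l m i f n2 nm mi mf fn.
apply: runs_le; last first.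
  apply: runs_seq.
    apply: (qok n P k l m i f.+1) => //; [lia| |lia].
    by rewrite /= /update /= mf addn1.
  move=> m1 fr1 q1; have [ld1 tr1] := network_frame fr1 isT isT nm.
  apply: runs_straight => //.
  rewrite /= /update /= q1 (fr1.1 i_f) // mf addn1 !(loaded_E ld1) //; lia.
have X1 : (0 < l.+1 ^ 2)%N by rewrite expn_gt0.
cost.
Qed.

Lemma set_reach_ok ej : exists C, forall n (P : path_network R n) k l m i f j,
  (n + n <= 2 ^ l)%N -> (0 < n)%N -> network_in_memory P k l m ->
  imem m i_f 0 = f -> ieval m ej = j -> rmem m r_lb 0 = left_base P i f ->
  runs (set_reach ej) m (C * l.+1 ^ 2) (fun m' => rmem m' r_gv 0 = reach P i f j).
Proof.
have [C qok] := query_at_ok (iv 0 ⊞ iv 0 ⊟ ILit 1 ⊟ ej) (iv 0 ⊞ iv 0 ⊟ ILit 1 ⊟ iv i_f).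
eexists=> n P k l m i f j n2 n0 nm mf mj mlb.
apply: runs_le; last first.
  apply: runs_seq.
    apply: (qok n P k l m (n + n - 1 - j)%N (n + n - 1 - f)%N) => //; last lia.
      by case: nm => ld _; rewrite /= (loaded_n ld) mj.
    by case: nm => ld _; rewrite /= /update /= (loaded_n ld) mf.
  move=> m1 fr1 q1.
  apply: runs_straight => //.
  rewrite /= /update /= q1 (fr1.2 r_lb) // mlb /reach -/(rc P f j).
  by case: leP => _ /=; rewrite /update /= ?q1 ?(fr1.2 r_lb) ?mlb.
have X1 : (0 < l.+1 ^ 2)%N by rewrite expn_gt0.
cost.
Qed.

(** The factor 4 absorbs the additive constant in the number of scan steps, since a greedy subpath
    has at least one vertex. *)
Lemma costM4 a b A X Y : (a <= A * X -> b <= 4 * Y -> a * b <= (4 * A) * (X * Y))%N.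
Proof.
by move=> aX bY; apply: leq_trans (leq_mul aX bY) _; rewrite leq_eqVlt; apply/orP; left; apply/eqP; lia.
Qed.

Lemma greedy_ok : exists C, forall n (P : path_network R n) k l m t,
  (0 < n)%N -> (n + n <= 2 ^ l)%N -> network_in_memory P k l m -> rmem m r_t 0 = t ->
  runs greedy m (C * (n * l.+1 ^ 2)) (fun m' => greedy_output P t (output m')).
Proof.
have [C1 qok] := query_at_ok (iv i_i) (iv i_f ⊞ ILit 1).
have [C2 bok] := set_base_ok.
have [C3 rok] := set_reach_ok (iv i_j ⊞ ILit 1).
eexists=> n P k l m t n0 n2 nm mt.
have X1 : (0 < l.+1 ^ 2)%N by rewrite expn_gt0.
set X := (l.+1 ^ 2)%N in X1 *.
apply: runs_le; last first.
  apply: runs_straight_seq => // m1 fr1 e1.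
  have nm1 := network_frame fr1 isT isT nm.
  apply: (runs_post (Q := fun m' => (exists v q, [/\ imem m' i_i 0 = start P t q,
     imem m' 1 0 = q, (start P t q <= n)%N /\ v = (n - start P t q)%N,
     (forall p, (p <= q)%N -> imem m' 2 p = start P t p) &
     (forall p, (p < q)%N -> imem m' 3 p = snext P t (start P t p) /\
        rmem m' 4 p = xnext P t (start P t p))]) /\ ~~ beval m' (ilt (iv i_i) (iv 0)))).
    move=> m' fr [[v [q [mi mq [sn _] Hcut Hsink]]] nb].
    have [ld' _] := network_frame fr isT isT nm1.
    split=> /=.
    - by rewrite mq; move: nb; rewrite /= mi (loaded_n ld'); lia.
    - by rewrite mq; exact: Hcut.
    - by rewrite mq => p pq; case: (Hsink p pq) => -> ->.
  (* The potential is the number of vertices not yet served: the two scans of an iteration are paid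
     for by the vertices it takes. *)
  apply: (runs_while_potential (v0 := n) (K := (_ * X)%N)); last first.
    exists 0%N; rewrite e1 /= /update /= subn0; split=> // p.
    by rewrite leqn0 => /eqP ->.
  move=> v m2 fr2 [q [mi mq [sn ev] Hcut Hsink]] bm.
  have nm2 := network_frame fr2 isT isT nm1.
  have [ld2 tr2] := nm2.
  move: bm; rewrite /= mi (loaded_n ld2) addn1 => i_n.
  set i := start P t q in mi sn ev i_n *.
  have is_ := snext_ge P t i; have sn' := snext_lt P n0 t i_n.
  have sj := jnext_ge P t i; have jn := jnext_lt P n0 t i_n.
  have mt2 : rmem m2 r_t 0 = t by rewrite (fr2.2 r_t) // (fr1.2 r_t).
  exists (next_start P t i - i)%N; first by rewrite /next_start ev; lia.
  apply: runs_le; last first.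
    apply: runs_straight_seq => // m3 fr3 e3.
    have nm3 := network_frame fr3 isT isT nm2.
    have mi3 : imem m3 i_i 0 = i by rewrite (fr3.1 i_i).
    have mt3 : rmem m3 r_t 0 = t by rewrite (fr3.2 r_t).
    apply: runs_seq.
      apply: (scan_loop_ok (K := (C1 * l.+1 ^ 2)%N) (ok := fun s => lc P i s <= t) (n := n) (c := i)) => //.
      - by have [ld3 _] := nm3; rewrite (loaded_n ld3).
      - by rewrite e3 /= /update /= mi.
      move=> m4 y fr4 my iy yn; have nm4 := network_frame fr4 isT isT nm3.
      apply: runs_post (qok n P k l m4 i y.+1 n0 nm4 _ _ _).
      + by move=> m5 fr5 /= ->; rewrite (fr5.2 r_t) // (fr4.2 r_t) // mt3.
      + by rewrite /= (fr4.1 i_i).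
      + by rewrite /= /update /= my addn1.
      + by lia.
    rewrite -/(snext P t i) => m4 fr4 mf4.
    have nm4 := network_frame fr4 isT isT nm3.
    have mi4 : imem m4 i_i 0 = i by rewrite (fr4.1 i_i).
    apply: runs_seq.
      exact: (bok n P k l m4 i (snext P t i) n2 nm4 mi4 mf4 sn').
    move=> m5 fr5 lb5; have nm5 := network_frame fr5 isT isT nm4.
    have mf5 : imem m5 i_f 0 = snext P t i by rewrite (fr5.1 i_f).
    apply: runs_straight_seq => // m6 fr6 e6.
    have nm6 := network_frame fr6 isT isT nm5.
    have mf6 : imem m6 i_f 0 = snext P t i by rewrite (fr6.1 i_f).
    have mt6 : rmem m6 r_t 0 = t by rewrite (fr6.2 r_t) // (fr5.2 r_t) // (fr4.2 r_t).
    have lb6 : rmem m6 r_lb 0 = left_base P i (snext P t i) by rewrite (fr6.2 r_lb).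
    apply: runs_seq.
      apply: (scan_loop_ok (K := (C3 * l.+1 ^ 2)%N)
        (ok := fun j => reach P i (snext P t i) j <= t) (n := n) (c := snext P t i)) => //.
      - by have [ld6 _] := nm6; rewrite (loaded_n ld6).
      - by rewrite e6 /= /update /= mf5.
      move=> m7 y fr7 my iy yn; have nm7 := network_frame fr7 isT isT nm6.
      apply: runs_post (rok n P k l m7 i (snext P t i) y.+1 n2 n0 nm7 _ _ _).
      + by move=> m8 fr8 /= ->; rewrite (fr8.2 r_t) // (fr7.2 r_t) // mt6.
      + by rewrite (fr7.1 i_f).
      + by rewrite /= my addn1.
      + by rewrite (fr7.2 r_lb).
    rewrite -/(jnext P t i) => m7 fr7 mj7.
    have nm7 := network_frame fr7 isT isT nm6; have [ld7 _] := nm7.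
    have mf7 : imem m7 i_f 0 = snext P t i by rewrite (fr7.1 i_f).
    have mt7 : rmem m7 r_t 0 = t by rewrite (fr7.2 r_t).
    have lb7 : rmem m7 r_lb 0 = left_base P i (snext P t i) by rewrite (fr7.2 r_lb).
    apply: runs_straight_seq => // m8 fr8 e8.
    have x8 : rmem m8 r_x 0 = xnext P t i.
      rewrite e8 /= /update /= mf7 mj7 mt7 lb7 (loaded_tau ld7) addn1 -ltNge /xnext.
      by case: ifP.
    have keep p : [/\ imem m8 1 p = imem m2 1 p, imem m8 2 p = imem m2 2 p,
        imem m8 3 p = imem m2 3 p & rmem m8 4 p = rmem m2 4 p].
      split; first by rewrite (fr8.1 1%N) // (fr7.1 1%N) // (fr6.1 1%N) //
        (fr5.1 1%N) // (fr4.1 1%N) // (fr3.1 1%N).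
      - by rewrite (fr8.1 2%N) // (fr7.1 2%N) // (fr6.1 2%N) // (fr5.1 2%N) //
          (fr4.1 2%N) // (fr3.1 2%N).
      - by rewrite (fr8.1 3%N) // (fr7.1 3%N) // (fr6.1 3%N) // (fr5.1 3%N) //
          (fr4.1 3%N) // (fr3.1 3%N).
      - by rewrite (fr8.2 4%N) // (fr7.2 4%N) // (fr6.2 4%N) // (fr5.2 4%N) //
          (fr4.2 4%N) // (fr3.2 4%N).
    have mq8 : imem m8 1 0 = q by have [->] := keep 0%N.
    have mf8 : imem m8 i_f 0 = snext P t i by rewrite (fr8.1 i_f).
    have mj8 : imem m8 i_j 0 = jnext P t i by rewrite (fr8.1 i_j).
    apply: runs_straight => //; exists q.+1.
    have st : start P t q.+1 = (jnext P t i).+1 by [].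
    rewrite st /= /update /= mq8 mf8 mj8 x8 !addn1.
    split=> //; first by rewrite /next_start ev; split; lia.
    - move=> p pq; case: eqP => [->|pq1]; first by rewrite st.
      by have [_ -> _ _] := keep p; apply: Hcut; lia.
    - move=> p pq; case: eqP => [->|pq1]; first by [].
      by have [_ _ -> ->] := keep p; apply: Hsink; lia.
  set d := (next_start P t i - i)%N.
  have d0 : (0 < d)%N by rewrite /d /next_start; lia.
  have Xd : (0 < X * d)%N by rewrite muln_gt0 X1.
  have sd : ((snext P t i - i).+2 <= 4 * d)%N by rewrite /d /next_start; lia.
  have jd : ((jnext P t i - snext P t i).+2 <= 4 * d)%N by rewrite /d /next_start; lia.
  have XXd : (X <= X * d)%N by rewrite leq_pmulr.
  rewrite -[X in (_ <= X)%N]mulnA.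
  cost.
  - by apply: costM4 sd; rewrite -/X; cost.
  - exact: leq_mul (leqnn _) XXd.
  - by apply: costM4 jd; rewrite -/X; cost.
have X3 : (0 < n * X)%N by rewrite muln_gt0 n0.
by cost; apply: (costM (X := X) (Y := n)); rewrite ?[(_ * n)%N]mulnC //; cost.
Qed.

End Greedy.

(** * Search among the candidate costs *)

Notation i_A := 23%N.
Notation i_B := 24%N.
Notation i_T := 25%N.
Notation i_row := 26%N.
Notation i_c := 27%N.
Notation i_tot := 28%N.
Notation i_sum := 29%N.
Notation i_best := 30%N.
Notation i_z := 31%N.
Notation i_cont := 32%N.
Notation i_A1 := 33%N.
Notation i_ok := 34%N.
Notation i_mode := 35%N.
Notation r_V := 21%N.
Notation r_hi := 22%N.
Notation r_val := 23%N.

(** [i_mode] selects the matrix. In the second one, row i has base vertex A1 i - 1, where [i_A1]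
    keeps the row boundaries found by the first search. *)
Definition eval_entry : cmd :=
  If (BILe (iv i_mode) (ILit 0))
    (query_at (iv i_row) (iv i_c) ;; rset r_val (rv r_qr))
    ((iset i_i (iv i_row) ;; iset i_f (IGet i_A1 (iv i_row) ⊟ ILit 1)) ;;
     set_base ;; set_reach (iv i_c) ;; rset r_val (rv r_gv)).

Definition middle : iexpr := IHalf (IGet i_A (iv i_row) ⊞ IGet i_B (iv i_row)).
Definition row_open : bexpr := ilt (IGet i_A (iv i_row)) (IGet i_B (iv i_row)).

Definition eval_rows : cmd :=
  (iset i_tot (ILit 0) ;; iset i_row (ILit 0)) ;;
  While (ilt (iv i_row) (iv i_N))
    (If (BAnd (ilt (iv i_row) (iv 0)) row_open)
       (iset i_c middle ;;
        eval_entry ;;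
        (RSet r_V (iv i_row) (rv r_val) ;;
         iset i_tot (iv i_tot ⊞ (IGet i_B (iv i_row) ⊟ IGet i_A (iv i_row))) ;;
         ISet i_T (iv i_N ⊞ iv i_row) (iv i_row ⊞ ILit 1)))
       (ISet i_T (iv i_N ⊞ iv i_row) (ILit 0)) ;;
     iset i_row (iv i_row ⊞ ILit 1)).

(* A tournament cell holds one plus the row of least value below it, and 0 when
   no row below it is left. *)
Definition pull : cmd :=
  If (BILe (IGet i_T (iv i_z ⊞ iv i_z)) (ILit 0))
    (ISet i_T (iv i_z) (IGet i_T (iv i_z ⊞ iv i_z ⊞ ILit 1)))
    (If (BILe (IGet i_T (iv i_z ⊞ iv i_z ⊞ ILit 1)) (ILit 0))
       (ISet i_T (iv i_z) (IGet i_T (iv i_z ⊞ iv i_z)))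
       (If (BRLe (RGet r_V (IGet i_T (iv i_z ⊞ iv i_z) ⊟ ILit 1))
                 (RGet r_V (IGet i_T (iv i_z ⊞ iv i_z ⊞ ILit 1) ⊟ ILit 1)))
          (ISet i_T (iv i_z) (IGet i_T (iv i_z ⊞ iv i_z)))
          (ISet i_T (iv i_z) (IGet i_T (iv i_z ⊞ iv i_z ⊞ ILit 1))))).

Definition build_tournament : cmd :=
  iset i_z (iv i_N) ;;
  While (BILe (ILit 2) (iv i_z)) (iset i_z (iv i_z ⊟ ILit 1) ;; pull).

Definition climb : cmd :=
  While (BILe (ILit 2) (iv i_z)) (iset i_z (IHalf (iv i_z)) ;; pull).

(** Rows leave the tournament in increasing order of value until half of the total width is out.
    These O(N log N) steps are dominated by one feasibility test. *)
Definition extract_median : cmd :=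
  iset i_sum (ILit 0) ;;
  While (ilt (iv i_sum ⊞ iv i_sum) (iv i_tot))
    ((iset i_best (IGet i_T (ILit 1) ⊟ ILit 1) ;;
      iset i_sum (iv i_sum ⊞ (IGet i_B (iv i_best) ⊟ IGet i_A (iv i_best))) ;;
      ISet i_T (iv i_N ⊞ iv i_best) (ILit 0) ;;
      iset i_z (iv i_N ⊞ iv i_best)) ;;
     climb).

Definition narrow_rows : cmd :=
  rset r_t (RGet r_V (iv i_best)) ;;
  greedy ;;
  (If (BAnd (BILe (iv 1) (IGet 0 (ILit 1))) (BRLe (ROfI (ILit 0)) (rv r_t)))
     (iset i_ok (ILit 1) ;; If (BRLe (rv r_t) (rv r_hi)) (rset r_hi (rv r_t)) Skip)
     (iset i_ok (ILit 0)) ;;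
   iset i_row (ILit 0)) ;;
  While (ilt (iv i_row) (iv 0))
    (If row_open
       (iset i_c middle ;;
        If (BILe (ILit 1) (iv i_ok))
          (If (BRLe (rv r_t) (RGet r_V (iv i_row))) (ISet i_B (iv i_row) (iv i_c)) Skip)
          (If (BRLe (RGet r_V (iv i_row)) (rv r_t))
             (ISet i_A (iv i_row) (iv i_c ⊞ ILit 1)) Skip))
       Skip ;;
     iset i_row (iv i_row ⊞ ILit 1)).

Definition search : cmd :=
  iset i_cont (ILit 1) ;;
  While (BILe (ILit 1) (iv i_cont))
    (eval_rows ;;
     If (BILe (iv i_tot) (ILit 0))
       (iset i_cont (ILit 0))
       (build_tournament ;; extract_median ;; narrow_rows)).

(** * Weighted medians by a tournament *)

Section Tournament.
Variable R : realType.
Implicit Types (m : memory R) (V : nat -> R) (T : nat -> nat).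

Definition winner V a b : nat :=
  if a == 0%N then b else if b == 0%N then a
  else if V a.-1 <= V b.-1 then a else b.

Definition pulled V T x := T x = winner V (T (x + x)%N) (T (x + x + 1)%N).

Lemma sem_pull m : let z := imem m i_z 0 in
  sem pull m = Memory (update (imem m) i_T z (winner (rmem m r_V)
    (imem m i_T (z + z)%N) (imem m i_T (z + z + 1)%N))) (rmem m).
Proof.
rewrite /= /winner !subn1 !leqn0; case: eqP => // _; case: eqP => // _.
by case: ifP.
Qed.

Lemma tournament_min V T p x : (forall e y, (e < p)%N -> (x * 2 ^ e <= y)%N ->
    (y < x.+1 * 2 ^ e)%N -> pulled V T y) ->
  if T x is w.+1 then
    (exists2 y, (x * 2 ^ p <= y < x.+1 * 2 ^ p)%N & T y = w.+1) /\
    (forall y w', (x * 2 ^ p <= y < x.+1 * 2 ^ p)%N -> T y = w'.+1 -> V w <= V w')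
  else forall y, (x * 2 ^ p <= y < x.+1 * 2 ^ p)%N -> T y = 0%N.
Proof.
elim: p x => [|p IH] x H.
  case E: (T x) => [|w]; first by move=> y; rewrite !expn0 !muln1 => Hy; have -> : y = x by lia.
  split; first by exists x; rewrite // !expn0 !muln1; lia.
  by move=> y w'; rewrite !expn0 !muln1 => Hy; have -> : y = x by [lia]; rewrite E => -[->].
have px : pulled V T x by apply: (H 0%N); rewrite ?expn0; lia.
have Hl e y : (e < p)%N -> ((x + x) * 2 ^ e <= y)%N -> (y < (x + x).+1 * 2 ^ e)%N -> pulled V T y.
  by move=> ep y1 y2; apply: (H e.+1); rewrite ?expnS; lia.
have Hr e y : (e < p)%N -> ((x + x + 1) * 2 ^ e <= y)%N -> (y < (x + x + 1).+1 * 2 ^ e)%N -> pulled V T y.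
  by move=> ep y1 y2; apply: (H e.+1); rewrite ?expnS; lia.
have := IH _ Hl; have := IH _ Hr; rewrite px /winner.
have split_ y : (x * 2 ^ p.+1 <= y < x.+1 * 2 ^ p.+1)%N ->
    ((x + x) * 2 ^ p <= y < (x + x).+1 * 2 ^ p)%N \/
    ((x + x + 1) * 2 ^ p <= y < (x + x + 1).+1 * 2 ^ p)%N.
  by rewrite expnS => Hy; case: (ltnP y ((x + x).+1 * 2 ^ p)) => ?; [left|right]; lia.
have inl y : ((x + x) * 2 ^ p <= y < (x + x).+1 * 2 ^ p)%N ->
    (x * 2 ^ p.+1 <= y < x.+1 * 2 ^ p.+1)%N by rewrite expnS; lia.
have inr y : ((x + x + 1) * 2 ^ p <= y < (x + x + 1).+1 * 2 ^ p)%N ->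
    (x * 2 ^ p.+1 <= y < x.+1 * 2 ^ p.+1)%N by rewrite expnS; lia.
case: (T (x + x)%N) => [|u] /=; case: (T (x + x + 1)%N) => [|v] /=.
- by move=> H1 H2 y /split_[/H2|/H1].
- move=> [[y Hy ey] H1] H2; split; first by exists y; auto.
  by move=> y' w' /split_[/H2 -> //|]; apply: H1.
- move=> H1 [[y Hy ey] H2]; split; first by exists y; auto.
  by move=> y' w' /split_[|/H1 -> //]; apply: H2.
move=> [[y1 Hy1 ey1] H1] [[y2 Hy2 ey2] H2].
case: leP => uv; split.
- by exists y2; auto.
- move=> y w' /split_[Hy|Hy] e; first exact: H2 Hy e.
  exact: le_trans uv (H1 _ _ Hy e).
- by exists y1; auto.
- move=> y w' /split_[Hy|Hy] e; last exact: H1 Hy e.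
  exact: le_trans (ltW uv) (H2 _ _ Hy e).
Qed.

Lemma build_tournament_ok : exists C, forall l m, imem m i_N 0 = (2 ^ l)%N ->
  runs build_tournament m (C * 2 ^ l)
    (fun m' => (forall x, (0 < x < 2 ^ l)%N -> pulled (rmem m' r_V) (imem m' i_T) x) /\
       forall x, (2 ^ l <= x)%N -> imem m' i_T x = imem m i_T x).
Proof.
eexists=> l m mN.
have N0 : (0 < 2 ^ l)%N by rewrite expn_gt0.
apply: runs_le; last first.
  apply: runs_straight_seq => // m1 fr1 e1.
  apply: (runs_post (Q := fun m' => (exists v, [/\ imem m' i_z 0 = v, (0 < v <= 2 ^ l)%N,
      (forall x, (v <= x < 2 ^ l)%N -> pulled (rmem m' r_V) (imem m' i_T) x) &
      forall x, (2 ^ l <= x)%N -> imem m' i_T x = imem m i_T x]) /\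
      ~~ beval m' (BILe (ILit 2) (iv i_z)))).
    move=> m' _ [[v [mv vN Hp Hl]]]; rewrite /= mv -ltnNge => v2; split=> // x Hx.
    by apply: Hp; lia.
  apply: (runs_while (v0 := (2 ^ l)%N)); last first.
    split; [by rewrite e1 /= /update /= mN|lia|by lia|].
    by move=> x _; rewrite (fr1.1 i_T).
  move=> v m2 fr2 [mv vN Hp Hl] bm; move: bm; rewrite /= mv => v2.
  apply: runs_straight => //; exists v.-1; first lia.
  rewrite sem_seq sem_pull /= /update /= mv subn1.
  split=> //; [lia| |].
    move=> x Hx; rewrite /pulled; case: (eqVneq x v.-1) => [->|xv].
      by rewrite !ifF //; apply/eqP; lia.
    rewrite !ifF //; try by apply/eqP; lia.
    by apply: Hp; move/eqP: xv; lia.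
  by move=> x Hx; rewrite ifF ?Hl //; apply/eqP; lia.
have X1 : (0 < 2 ^ l)%N by [].
by cost; apply: (costM (X := 1%N) (Y := (2 ^ l)%N)); rewrite ?mul1n //; exact: costS.
Qed.

(** A changed leaf z can only spoil its proper ancestors z / 2^e, which the loop repairs from the
    bottom up. *)
Lemma climb_ok : exists C, forall l m z, imem m i_z 0 = z -> (2 ^ l <= z < 2 ^ l.+1)%N ->
  (forall y, (0 < y < 2 ^ l)%N -> (forall e, (0 < e)%N -> y != (z %/ 2 ^ e)%N) ->
     pulled (rmem m r_V) (imem m i_T) y) ->
  runs climb m (C * l.+1)
    (fun m' => (forall x, (0 < x < 2 ^ l)%N -> pulled (rmem m' r_V) (imem m' i_T) x) /\
       forall x, (2 ^ l <= x)%N -> imem m' i_T x = imem m i_T x).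
Proof.
eexists=> l m z mz zN Hz.
have N0 : (0 < 2 ^ l)%N by rewrite expn_gt0.
apply: runs_le; last first.
  apply: (runs_post (Q := fun m' => (exists v z', [/\ imem m' i_z 0 = z',
      (0 < z')%N /\ (z' < 2 ^ v.+1)%N, (v <= l)%N,
      (forall y, (0 < y < 2 ^ l)%N -> (forall e, (0 < e)%N -> y != (z' %/ 2 ^ e)%N) ->
         pulled (rmem m' r_V) (imem m' i_T) y) &
      forall x, (2 ^ l <= x)%N -> imem m' i_T x = imem m i_T x]) /\
      ~~ beval m' (BILe (ILit 2) (iv i_z)))).
    move=> m' _ [[v [z' [mz' z0 vl Hp Hl]]]]; rewrite /= mz' -ltnNge => z2; split=> // x Hx.
    apply: Hp => // e e0; apply/eqP => ex; have : (z' %/ 2 ^ e = 0)%N.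
      by rewrite divn_small //; case: e e0 {ex} => // e _; rewrite expnS;
         have : (0 < 2 ^ e)%N; [rewrite expn_gt0|lia].
    lia.
  apply: (runs_while (v0 := l)); last first.
    by exists z; split=> //; split; lia.
  move=> v m2 fr2 [z' [mz' [z0 zv] vl Hp Hl]] bm; move: bm; rewrite /= mz' => z2.
  apply: runs_straight => //.
  have v0 : (0 < v)%N by case: v zv {vl} => // zv; move: zv; rewrite expn1; lia.
  have zh : (z'./2 < 2 ^ v)%N.
    by move: zv; rewrite expnS; have := odd_double_half z'; case: odd; lia.
  have zh0 : (0 < z'./2)%N by have := odd_double_half z'; case: odd; lia.
  have vN : (2 ^ v <= 2 ^ l)%N by rewrite leq_exp2l.
  exists v.-1; first lia.
  exists z'./2; rewrite sem_seq sem_pull /= /update /= mz'.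
  split=> //; [by rewrite prednK|lia| |].
    move=> y Hy Hanc; rewrite /pulled; case: (eqVneq y z'./2) => [->|yz].
      by rewrite !ifF //; apply/eqP; lia.
    have y1 : (z'./2 %/ 2 ^ 1 == y)%N = false.
      by apply/eqP => /esym/eqP; apply/negP; apply: Hanc.
    have c0 : ((y + y)%N == z'./2) = false.
      apply/eqP => e; move/eqP: y1; apply; rewrite -e expn1; lia.
    have c1 : ((y + y + 1)%N == z'./2) = false.
      apply/eqP => e; move/eqP: y1; apply; rewrite -e expn1; lia.
    rewrite c0 c1; apply: Hp => // e e0; case: e e0 => // -[_|e _].
      by rewrite expn1 divn2.
    by rewrite expnS divnMA divn2; apply: Hanc.
  by move=> x Hx; rewrite ifF ?Hl //; apply/eqP; lia.
by cost; apply: (costM (X := 1%N) (Y := l.+1)); rewrite ?mul1n //; exact: costS.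
Qed.

Lemma sum_set (n : nat) (f : nat -> nat) (c c' : pred nat) p : (p < n)%N ->
  ~~ c p -> (forall i, c' i = (i == p) || c i) ->
  (\sum_(0 <= i < n | c' i) f i = \sum_(0 <= i < n | c i) f i + f p)%N.
Proof.
move=> pn cp cc; rewrite big_mkcond [X in (X + _)%N]big_mkcond /=.
have -> : f p = (\sum_(0 <= i < n) if i == p then f i else 0)%N.
  by rewrite -big_mkcond big_nat1_eq /= pn.
rewrite -big_split; apply: eq_bigr => i _; rewrite cc /=.
by case: eqP => [->|_] /=; [rewrite (negbTE cp)|rewrite addn0].
Qed.

(** The extracted rows have value at most V p and weigh at least half. Those extracted before p
    weigh less than half, so the remaining ones together with p, of value at least V p, weigh more
    than half. *)
Lemma extract_median_ok : exists C, forall n l m,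
  let w i := (imem m i_B i - imem m i_A i)%N in let V := rmem m r_V in
  (n <= 2 ^ l)%N -> imem m i_N 0 = (2 ^ l)%N ->
  (forall x, (0 < x < 2 ^ l)%N -> pulled V (imem m i_T) x) ->
  (forall i, (i < 2 ^ l)%N ->
     imem m i_T (2 ^ l + i)%N = if (i < n)%N && (0 < w i)%N then i.+1 else 0%N) ->
  imem m i_tot 0 = (\sum_(0 <= i < n) w i)%N -> (0 < \sum_(0 <= i < n) w i)%N ->
  runs extract_median m (C * (2 ^ l * l.+1)) (fun m' => exists p,
    [/\ imem m' i_best 0 = p, (p < n)%N, (0 < w p)%N,
     (\sum_(0 <= i < n) w i <= 2 * \sum_(0 <= i < n | (V i <= V p)%R) w i)%N &
     (\sum_(0 <= i < n) w i <= 2 * \sum_(0 <= i < n | (V p <= V i)%R) w i)%N]).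
Proof.
have [C cl] := climb_ok.
eexists=> n l m w V nN mN Hp Hleaf mtot W0.
have N0 : (0 < 2 ^ l)%N by rewrite expn_gt0.
set W := (\sum_(0 <= i < n) w i)%N in mtot W0 *.
pose leaf (m' : memory R) i := imem m' i_T (2 ^ l + i)%N.
pose chosen m' p := [/\ imem m' i_best 0 = p, (p < n)%N, (0 < w p)%N, leaf m' p = 0%N &
  [/\ forall i, (i < n)%N -> (0 < w i)%N -> leaf m' i = 0%N -> V i <= V p,
      forall i, (i < n)%N -> leaf m' i <> 0%N -> V p <= V i &
      (2 * (imem m' i_sum 0 - w p) < W)%N]].
apply: runs_le; last first.
  apply: runs_straight_seq => // m1 fr1 e1.
  have sum1 : imem m1 i_sum 0 = 0%N by rewrite e1 /= /update.
  apply: (runs_post (Q := fun m' => (exists v, [/\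
      (forall x, (0 < x < 2 ^ l)%N -> pulled V (imem m' i_T) x),
      (forall i, (i < 2 ^ l)%N -> leaf m' i = 0%N \/
         [/\ leaf m' i = i.+1, (i < n)%N & (0 < w i)%N]),
      imem m' i_sum 0 = (\sum_(0 <= i < n | leaf m' i == 0%N) w i)%N,
      (\sum_(0 <= i < 2 ^ l | leaf m' i != 0%N) 1 <= v)%N &
      (forall i, (i < n)%N -> (0 < w i)%N -> leaf m' i <> 0%N) \/ exists p, chosen m' p]) /\
      ~~ beval m' (ilt (iv i_sum ⊞ iv i_sum) (iv i_tot)))).
    move=> m' fr' [[v [_ Hl Hs _ Hc]]].
    rewrite /= (fr'.1 i_tot) // (fr1.1 i_tot) // mtot addn1 -leqNgt => Ws.
    case: Hc => [Hc|[p [bp pn wp lp [H1 H2 H3]]]].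
      move: Ws; rewrite Hs big1_seq; first by lia.
      move=> i /andP[/eqP l0]; rewrite mem_index_iota => /andP[_ i_n].
      by case E: (w i) => [//|u]; case: (Hc i i_n _ l0); rewrite E.
    exists p; split=> //.
      apply: leq_trans Ws _; rewrite addnn -mul2n leq_mul2l /= Hs.
      rewrite big_mkcond [leqRHS]big_mkcond /= big_seq [leqRHS]big_seq.
      apply: leq_sum => i; rewrite mem_index_iota => /andP[_ i_n].
      case: eqP => // l0; case E: (w i) => [//|u]; rewrite -E ifT //.
      by apply: H1; rewrite ?E.
    have e : imem m' i_sum 0 = (\sum_(0 <= i < n | (leaf m' i == 0%N) && (i != p)) w i + w p)%N.
      rewrite Hs; apply: sum_set => //; first by rewrite eqxx andbF.
      by move=> i; case: (eqVneq i p) => [->|_]; rewrite ?lp ?eqxx ?andbT ?orbT.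
    move: H3; rewrite e addnK => H3.
    suff : (W <= \sum_(0 <= i < n | (V p <= V i)%R) w i +
      \sum_(0 <= i < n | (leaf m' i == 0%N) && (i != p)) w i)%N by lia.
    rewrite /W [X in (_ <= X + _)%N]big_mkcond [X in (_ <= _ + X)%N]big_mkcond /= -big_split /=.
    rewrite big_seq [leqRHS]big_seq.
    apply: leq_sum => i; rewrite mem_index_iota => /andP[_ i_n].
    case: ifP => Vpi; first by lia.
    case: (eqVneq (leaf m' i) 0%N) => [l0|/eqP l0]; last by rewrite H2 in Vpi.
    case: (eqVneq i p) => [ip|_]; last by rewrite /=; lia.
    by rewrite ip lexx in Vpi.
  apply: (runs_while (v0 := (2 ^ l)%N)); last first.
    have T1 i : leaf m1 i = leaf m i by rewrite /leaf (fr1.1 i_T).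
    have Hl1 i : (i < 2 ^ l)%N -> leaf m1 i = 0%N \/ [/\ leaf m1 i = i.+1, (i < n)%N & (0 < w i)%N].
      move=> iN; rewrite T1 /leaf Hleaf //.
      by case: ifP => [/andP[i_n wi]|_]; [right|left].
      split=> //.
      - by move=> x Hx; rewrite /pulled !(fr1.1 i_T) //; apply: Hp.
      - rewrite sum1 big1_seq // => i /andP[/eqP l0]; rewrite mem_index_iota => /andP[_ i_n].
        move: l0; rewrite T1 /leaf Hleaf ?i_n /=; last lia.
        by case: (w i).
      - rewrite big_mkcond -[leqRHS]subn0 -[leqRHS]muln1 -[leqRHS]sum_nat_const_nat.
        by apply: leq_sum => i _; case: ifP.
      - left=> i i_n wi; rewrite T1 /leaf Hleaf ?i_n ?wi //; lia.
  move=> v m2 fr2 [Hp2 Hl2 Hs2 Hv2 Hc2] bm.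
  have tot2 : imem m2 i_tot 0 = W by rewrite (fr2.1 i_tot) // (fr1.1 i_tot).
  have mN2 : imem m2 i_N 0 = (2 ^ l)%N by rewrite (fr2.1 i_N) // (fr1.1 i_N).
  have wE i : (imem m2 i_B i - imem m2 i_A i)%N = w i.
    by rewrite (fr2.1 i_B) // (fr2.1 i_A) // (fr1.1 i_B) // (fr1.1 i_A).
  have VE : rmem m2 r_V = V by apply/funext => i; rewrite (fr2.2 r_V) // (fr1.2 r_V).
  move: bm; rewrite /= tot2 addn1 => lt2.
  have := @tournament_min V (imem m2 i_T) l 1; rewrite mul1n mul2n -addnn.
  case E: (imem m2 i_T 1) => [|u] root.
    (* An empty root would mean that all the weight has been extracted, against the loop test. *)
    have : imem m2 i_sum 0 = W; last by lia.
    rewrite Hs2 big_mkcond; apply: eq_big_nat => i Hi.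
    by rewrite /leaf root ?eqxx //; [move=> e y He H1 H2; apply: Hp2;
      have : (2 ^ e.+1 <= 2 ^ l)%N; [rewrite leq_exp2l|rewrite expnS; have : (0 < 2 ^ e)%N;
      [rewrite expn_gt0|lia]]|lia].
  have [|[y Hy ey] Hmin] := root.
    move=> e y He H1 H2; apply: Hp2; have : (0 < 2 ^ e)%N by rewrite expn_gt0.
    by have : (2 ^ e.+1 <= 2 ^ l)%N; [rewrite leq_exp2l|rewrite expnS; lia].
  have [leafu un wu] : [/\ leaf m2 u = u.+1, (u < n)%N & (0 < w u)%N].
    have := Hl2 (y - 2 ^ l)%N ltac:(lia); rewrite /leaf subnKC ?ey; last lia.
    case=> // -[[eu] H1 H2]; rewrite -eu in H1 H2; split=> //.
    by rewrite /leaf eu subnKC //; lia.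
  have uN : (u < 2 ^ l)%N by lia.
  have {Hmin} Vmin i : (i < n)%N -> leaf m2 i <> 0%N -> V u <= V i.
    move=> i_n l0; have [//|[li _ _]] := Hl2 i ltac:(lia).
    by apply: (Hmin (2 ^ l + i)%N i) => //; lia.
  apply: runs_straight_seq => // m3 fr3 e3.
  have best3 : imem m3 i_best 0 = u by rewrite e3 /= /update /= E subn1.
  have sum3 : imem m3 i_sum 0 = (imem m2 i_sum 0 + w u)%N.
    by rewrite e3 /= /update /= E subn1 /= wE.
  have z3 : imem m3 i_z 0 = (2 ^ l + u)%N by rewrite e3 /= /update /= E subn1 /= mN2.
  have T3 x : imem m3 i_T x = if x == (2 ^ l + u)%N then 0%N else imem m2 i_T x.
    by rewrite e3 /= /update /= E subn1 /= mN2.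
  have V3 : rmem m3 r_V = V by rewrite e3 /=.
  apply: runs_post (cl l m3 _ z3 _ _); last 2 first.
  - by rewrite expnS; lia.
  - move=> x Hx Hanc; have z1 := Hanc 1%N isT; rewrite expn1 in z1.
    have n1 : (x == (2 ^ l + u)%N) = false by apply/negbTE; rewrite neq_ltn; lia.
    have n2 : ((x + x)%N == (2 ^ l + u)%N) = false.
      by apply/negbTE; apply: contra z1 => /eqP <-; apply/eqP; lia.
    have n3 : ((x + x + 1)%N == (2 ^ l + u)%N) = false.
      by apply/negbTE; apply: contra z1 => /eqP <-; apply/eqP; lia.
    by rewrite V3 /pulled !T3 n1 n2 n3; apply: Hp2.
  move=> m4 fr4 [Hp4 Hl4].
  have leaf4 i : leaf m4 i = if i == u then 0%N else leaf m2 i.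
    by rewrite /leaf Hl4 ?leq_addr // T3 eqn_add2l.
  have sum4 : imem m4 i_sum 0 = (imem m2 i_sum 0 + w u)%N by rewrite (fr4.1 i_sum).
  have V4 : rmem m4 r_V = V by apply/funext => i; rewrite (fr4.2 r_V) // V3.
  exists (\sum_(0 <= i < 2 ^ l | leaf m4 i != 0%N) 1)%N.
    apply: leq_trans Hv2; rewrite (@sum_set (2 ^ l) (fun=> 1%N) (fun i => leaf m4 i != 0%N)
      (fun i => leaf m2 i != 0%N) u) //.
    - by rewrite addn1.
    - by rewrite leaf4 eqxx.
    - by move=> i; rewrite leaf4; case: (eqVneq i u) => [->|_]; rewrite ?leafu ?orbF.
  split.
  - by move=> x Hx; rewrite -V4; apply: Hp4.
  - by move=> i iN; rewrite leaf4; case: eqP => _; [left|apply: Hl2].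
  - rewrite sum4 Hs2; apply/esym/sum_set => //; first by rewrite leafu.
    by move=> i; rewrite leaf4; case: (eqVneq i u).
  - by [].
  right; exists u; split=> //; first by rewrite (fr4.1 i_best).
    by rewrite leaf4 eqxx.
  split; last by rewrite sum4 addnK mul2n -addnn.
    move=> i i_n wi; rewrite leaf4; case: eqP => [-> //|_ l0].
    case: Hc2 => [H|[q [_ qn wq lq [H1 H2 _]]]]; first by case: (H i i_n wi).
    by apply: le_trans (H1 i i_n wi l0) _; apply: H2; rewrite ?leafu.
  by move=> i i_n; rewrite leaf4; case: eqP => // _; apply: Vmin.
have X3 : (0 < 2 ^ l * l.+1)%N by rewrite muln_gt0 N0.
by cost; apply: (costM (X := l.+1) (Y := (2 ^ l)%N)); rewrite ?[(_ * 2 ^ l)%N]mulnC //; cost.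
Qed.

End Tournament.

(** * Evaluating, narrowing and searching the rows *)

Section Search.
Variable R : realType.
Implicit Types (m : memory R).

Definition entry n (P : path_network R n) m i c : R :=
  if imem m i_mode 0 == 0%N then lc P i c else reach P i (imem m i_A1 i).-1 c.

Lemma entry_homo n (P : path_network R n) m i c c' : (0 < n)%N -> (c <= c')%N ->
  entry P m i c <= entry P m i c'.
Proof.
move=> n0 cc; rewrite /entry; case: ifP => _; last exact: reach_homo.
by have [s1 s2 s3] := network_admissible P n0; apply: lcost_homo.
Qed.

Lemma eval_entry_ok : exists C, forall n (P : path_network R n) k l m i c,
  (0 < n)%N -> (n + n <= 2 ^ l)%N -> network_in_memory P k l m ->
  imem m i_row 0 = i -> imem m i_c 0 = c -> (imem m i_A1 i <= n)%N -> (c < n)%N ->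
  runs eval_entry m (C * l.+1 ^ 2) (fun m' => rmem m' r_val 0 = entry P m i c).
Proof.
have [C1 qok] := query_at_ok R (iv i_row) (iv i_c).
have [C2 bok] := set_base_ok R.
have [C3 rok] := set_reach_ok R (iv i_c).
eexists=> n P k l m i c n0 n2 nm mi mc mA1 cn.
apply: runs_le; last first.
  apply: runs_if; rewrite /= leqn0 /entry => md; [rewrite md|rewrite (negbTE md)].
    apply: runs_seq.
      by apply: (qok n P k l m i c n0 nm) => //; lia.
    by move=> m1 fr1 q1; apply: runs_straight => //; rewrite /= /update.
  apply: runs_straight_seq => // m1 fr1 e1.
  have nm1 := network_frame fr1 isT isT nm.
  have mi1 : imem m1 i_i 0 = i by rewrite e1 /= /update /= mi.
  have mf1 : imem m1 i_f 0 = (imem m i_A1 i).-1 by rewrite e1 /= /update /= mi subn1.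
  have mc1 : imem m1 i_c 0 = c by rewrite (fr1.1 i_c).
  apply: runs_seq.
    by apply: (bok n P k l m1 i _ n2 nm1 mi1 mf1); lia.
  move=> m2 fr2 lb2; have nm2 := network_frame fr2 isT isT nm1.
  apply: runs_seq.
    apply: (rok n P k l m2 i _ c n2 n0 nm2 _ _ lb2); first by rewrite (fr2.1 i_f).
    by rewrite /= (fr2.1 i_c).
  by move=> m3 fr3 gv3; apply: runs_straight => //; rewrite /= /update /= gv3.
have X1 : (0 < l.+1 ^ 2)%N by rewrite expn_gt0.
cost.
Qed.

Lemma eval_rows_ok : exists C, forall n (P : path_network R n) k l m,
  let a := imem m i_A in let b := imem m i_B in
  (0 < n)%N -> (n + n <= 2 ^ l)%N -> network_in_memory P k l m ->
  (forall i, (i < n)%N -> (imem m i_A1 i <= n)%N /\ (b i <= n)%N) ->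
  runs eval_rows m (C * (2 ^ l * l.+1 ^ 2)) (fun m' =>
    [/\ imem m' i_tot 0 = (\sum_(0 <= i < n) (b i - a i))%N,
     (forall i, (i < 2 ^ l)%N -> imem m' i_T (2 ^ l + i)%N =
        if (i < n)%N && (0 < b i - a i)%N then i.+1 else 0%N) &
     (forall i, (i < n)%N -> (a i < b i)%N ->
        rmem m' r_V i = entry P m i (a i + b i)./2)]).
Proof.
have [C eok] := eval_entry_ok.
eexists=> n P k l m a b n0 n2 nm Hb.
have N0 : (0 < 2 ^ l)%N by rewrite expn_gt0.
apply: runs_le; last first.
  apply: runs_straight_seq => // m1 fr1 e1.
  have nm1 := network_frame fr1 isT isT nm.
  apply: (runs_post (Q := fun m' => (exists v c, [/\
      imem m' i_row 0 = c /\ (c + v = 2 ^ l)%N,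
      imem m' i_tot 0 = (\sum_(0 <= i < minn c n) (b i - a i))%N,
      (forall i, (i < c)%N -> imem m' i_T (2 ^ l + i)%N =
        if (i < n)%N && (0 < b i - a i)%N then i.+1 else 0%N) &
      (forall i, (i < c)%N -> (i < n)%N -> (a i < b i)%N ->
        rmem m' r_V i = entry P m i (a i + b i)./2)]) /\
      ~~ beval m' (ilt (iv i_row) (iv i_N)))).
    move=> m' fr' [[v [c [[mc cv] Ht Hl HV]]]].
    have [ld' _] := network_frame fr' isT isT nm1.
    rewrite /= mc (loaded_N ld') addn1 -leqNgt => cN.
    have ec : c = (2 ^ l)%N by lia.
    split.
    - by rewrite Ht ec; congr bigop; congr index_iota; lia.
    - by move=> i Hi; apply: Hl; lia.
    - by move=> i Hi; apply: HV; lia.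
  apply: (runs_while (v0 := (2 ^ l)%N)); last first.
    exists 0%N; rewrite e1 /= /update /= min0n big_nil; split=> //.
  move=> v m2 fr2 [c [[mc cv] Ht Hl HV]] bm.
  have nm2 := network_frame fr2 isT isT nm1; have [ld2 _] := nm2.
  move: bm; rewrite /= mc (loaded_N ld2) addn1 => cN.
  have mA j : imem m2 i_A j = a j by rewrite (fr2.1 i_A) // (fr1.1 i_A).
  have mB j : imem m2 i_B j = b j by rewrite (fr2.1 i_B) // (fr1.1 i_B).
  apply: (runs_seq (Q1 := fun m' => [/\ imem m' i_row 0 = c,
      imem m' i_tot 0 = (\sum_(0 <= i < minn c.+1 n) (b i - a i))%N,
      (forall i, (i < c.+1)%N -> imem m' i_T (2 ^ l + i)%N =
        if (i < n)%N && (0 < b i - a i)%N then i.+1 else 0%N) &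
      (forall i, (i < c.+1)%N -> (i < n)%N -> (a i < b i)%N ->
        rmem m' r_V i = entry P m i (a i + b i)./2)])).
    apply: runs_if; rewrite /= mc (loaded_n ld2) mA mB !addn1.
      move=> /andP[cn ab].
      apply: runs_straight_seq => // m3 fr3 e3.
      have nm3 := network_frame fr3 isT isT nm2.
      have mc3 : imem m3 i_c 0 = ((a c + b c)./2)%N by rewrite e3 /= /update /= mc mA mB.
      have row3 : imem m3 i_row 0 = c by rewrite (fr3.1 i_row).
      have A13 j : imem m3 i_A1 j = imem m i_A1 j.
        by rewrite (fr3.1 i_A1) // (fr2.1 i_A1) // (fr1.1 i_A1).
      have [HA1 Hbc] := Hb c cn.
      have midn : ((a c + b c)./2 < n)%N.
        by have := odd_double_half (a c + b c); case: odd; lia.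
      apply: runs_seq.
        by apply: (eok n P k l m3 c _ n0 n2 nm3 row3 mc3) => //; rewrite A13.
      move=> m4 fr4 v4; have nm4 := network_frame fr4 isT isT nm3; have [ld4 _] := nm4.
      apply: runs_straight => //.
      have row4 : imem m4 i_row 0 = c by rewrite (fr4.1 i_row).
      have tot4 : imem m4 i_tot 0 = imem m2 i_tot 0 by rewrite (fr4.1 i_tot) // (fr3.1 i_tot).
      have mA4 j : imem m4 i_A j = a j by rewrite (fr4.1 i_A) // (fr3.1 i_A).
      have mB4 j : imem m4 i_B j = b j by rewrite (fr4.1 i_B) // (fr3.1 i_B).
      have T4 j : imem m4 i_T j = imem m2 i_T j by rewrite (fr4.1 i_T) // (fr3.1 i_T).
      have V4 j : rmem m4 r_V j = rmem m2 r_V j by rewrite (fr4.2 r_V) // (fr3.2 r_V).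
      have en : entry P m3 c (a c + b c)./2 = entry P m c (a c + b c)./2.
        by rewrite /entry A13 (fr3.1 i_mode) // (fr2.1 i_mode) // (fr1.1 i_mode).
      rewrite /= /update /= row4 tot4 mA4 mB4 (loaded_N ld4) v4 en; split=> //.
      - have -> : minn c.+1 n = c.+1 by lia.
        by rewrite big_nat_recr //= Ht; have -> : minn c n = c by lia.
      - move=> i ic; rewrite eqn_add2l; case: eqP => [->|ne].
          by rewrite cn subn_gt0 ab addn1.
        by rewrite T4; apply: Hl; lia.
      - move=> i ic i_n abi; case: eqP => [->|ne] //.
        by rewrite V4; apply: HV => //; lia.
    move=> closed; apply: runs_straight => //.
    have wc : (c < n)%N -> (b c - a c = 0)%N by move=> cn; move: closed; rewrite cn /=; lia.
    rewrite /= /update /= mc (loaded_N ld2) ; split=> //.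
    - rewrite Ht; case: (ltnP c n) => cn.
        have -> : minn c.+1 n = c.+1 by lia.
        by rewrite big_nat_recr //= wc // addn0.
      by have -> : minn c.+1 n = n by lia.
    - move=> i ic; rewrite eqn_add2l; case: eqP => [->|ne].
        by case: (ltnP c n) => //= cn; rewrite wc.
      by apply: Hl; lia.
    - move=> i ic i_n abi; case: (eqVneq i c) => [ei|ne]; last by apply: HV => //; lia.
      by move: (wc); rewrite -ei => /(_ i_n); lia.
  move=> m3 fr3 [mc3 Ht3 Hl3 HV3]; apply: runs_straight => //; exists v.-1; first lia.
  by exists c.+1; rewrite /= /update /= mc3 addn1; split=> //; split=> //; lia.
have X1 : (0 < l.+1 ^ 2)%N by rewrite expn_gt0.
have X3 : (0 < 2 ^ l * l.+1 ^ 2)%N by rewrite muln_gt0 N0.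
by cost; apply: (costM (X := (l.+1 ^ 2)%N) (Y := (2 ^ l)%N)); rewrite ?[(_ * 2 ^ l)%N]mulnC //; cost.
Qed.

Section Narrow.
Variables (n : nat) (val : nat -> nat -> R) (a b : nat -> nat) (V : nat -> R).
Hypothesis val_homo : forall i c c', (c <= c')%N -> val i c <= val i c'.
Hypothesis V_mid : forall i, (i < n)%N -> (a i < b i)%N -> V i = val i (a i + b i)./2.

Definition narrow (ok : bool) (t : R) (i : nat) : nat * nat :=
  if (a i < b i)%N then
    if ok then if t <= V i then (a i, (a i + b i)./2) else (a i, b i)
    else if V i <= t then ((a i + b i)./2.+1, b i) else (a i, b i)
  else (a i, b i).

(** A row whose middle entry is on the decided side of t loses at least half of its width;
    multiplying by 4 keeps the count integral. *)
Lemma narrow_width ok t i :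
  let hit := if ok then t <= V i else V i <= t in
  (4 * ((narrow ok t i).2 - (narrow ok t i).1) +
     2 * (if hit then b i - a i else 0) <= 4 * (b i - a i))%N.
Proof.
rewrite /narrow; have := odd_double_half (a i + b i).
case: ltnP => ab /=; last by case: ifP; case: ifP; lia.
by case: ok; case: ifP => _ /=; case: odd; lia.
Qed.

(** Whatever the outcome of the test, the rows on the decided side carry at least half of the total
    width and lose at least half of theirs, that is, a quarter of the total. *)
Lemma narrow_total ok t p : (p < n)%N -> V p = t ->
  (\sum_(0 <= i < n) (b i - a i) <= 2 * \sum_(0 <= i < n | (V i <= V p)%R) (b i - a i))%N ->
  (\sum_(0 <= i < n) (b i - a i) <= 2 * \sum_(0 <= i < n | (V p <= V i)%R) (b i - a i))%N ->
  (4 * \sum_(0 <= i < n) ((narrow ok t i).2 - (narrow ok t i).1) <=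
   3 * \sum_(0 <= i < n) (b i - a i))%N.
Proof.
move=> pn Vp; rewrite Vp => H1 H2.
have H : (4 * \sum_(0 <= i < n) ((narrow ok t i).2 - (narrow ok t i).1) +
    2 * \sum_(0 <= i < n) (if (if ok then (t <= V i)%R else (V i <= t)%R) then b i - a i else 0) <=
    4 * \sum_(0 <= i < n) (b i - a i))%N.
  rewrite !big_distrr -big_split /=; apply: leq_sum => i _; exact: narrow_width.
move: H1 H2; rewrite [X in (_ <= 2 * X)%N]big_mkcond [X in _ -> (_ <= 2 * X)%N -> _]big_mkcond /=.
by move=> H1 H2; move: H; case: ok => /=; lia.
Qed.

Lemma narrow_bounds ok t i : (a i <= n)%N -> (b i <= n)%N ->
  (a i <= (narrow ok t i).1 <= n)%N && ((narrow ok t i).2 <= b i)%N.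
Proof.
rewrite /narrow; have := odd_double_half (a i + b i).
case: ltnP => ab /= e an bn; last by rewrite leqnn an leqnn.
by case: ok; case: ifP => _ /=; move: e; case: odd; lia.
Qed.

Lemma narrow_low t i c : (i < n)%N -> (a i <= c)%N ->
  (c < (narrow false t i).1)%N -> val i c <= t.
Proof.
rewrite /narrow => i_n ac; case: (ltnP (a i) (b i)) => ab /=; last by lia.
case: ifP => Vt /=; last by lia.
move=> cm; apply: le_trans Vt; rewrite V_mid //; apply: val_homo; lia.
Qed.

Lemma narrow_high t i c : (i < n)%N -> (c < b i)%N ->
  ((narrow true t i).2 <= c)%N -> t <= val i c.
Proof.
rewrite /narrow => i_n cb; case: (ltnP (a i) (b i)) => ab /=; last by lia.
case: ifP => Vt /=; last by lia.
move=> cm; apply: le_trans Vt _; rewrite V_mid //; exact: val_homo.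
Qed.

End Narrow.

(* [lo] is not computed: it is the largest value found infeasible.  The entries
   of row i strictly between [lo] and [hi] lie in the columns from A i to B i. *)
Definition bracketed n (P : path_network R n) k (val : nat -> nat -> R)
    (a0 : nat -> nat) lo m : Prop :=
  [/\ ~~ achievable P k lo, achievable P k (rmem m r_hi 0) &
   forall i, (i < n)%N ->
     [/\ (a0 i <= imem m i_A i)%N, (imem m i_A i <= n)%N, (imem m i_B i <= n)%N,
      forall c, (a0 i <= c)%N -> (c < imem m i_A i)%N -> val i c <= lo &
      forall c, (imem m i_B i <= c)%N -> (c < n)%N -> rmem m r_hi 0 <= val i c]].

Lemma narrow_rows_ok : exists C, forall n (P : path_network R n) k l m a0 lo p,
  let a := imem m i_A in let b := imem m i_B in let V := rmem m r_V in
  (0 < n)%N -> (n + n <= 2 ^ l)%N -> network_in_memory P k l m ->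
  bracketed P k (entry P m) a0 lo m ->
  (forall i, (i < n)%N -> (a i < b i)%N -> V i = entry P m i (a i + b i)./2) ->
  imem m i_best 0 = p -> (p < n)%N ->
  (\sum_(0 <= i < n) (b i - a i) <= 2 * \sum_(0 <= i < n | (V i <= V p)%R) (b i - a i))%N ->
  (\sum_(0 <= i < n) (b i - a i) <= 2 * \sum_(0 <= i < n | (V p <= V i)%R) (b i - a i))%N ->
  runs narrow_rows m (C * (2 ^ l * l.+1 ^ 2)) (fun m' =>
    [/\ exists2 lo', lo <= lo' & bracketed P k (entry P m) a0 lo' m',
      rmem m' r_hi 0 <= rmem m r_hi 0 &
      (4 * \sum_(0 <= i < n) (imem m' i_B i - imem m' i_A i) <=
       3 * \sum_(0 <= i < n) (b i - a i))%N]).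
Proof.
have [C gok] := greedy_ok R.
eexists=> n P k l m a0 lo p a b V n0 n2 nm brk Vmid mp pn W1 W2.
have N0 : (0 < 2 ^ l)%N by rewrite expn_gt0.
have nN : (n <= 2 ^ l)%N by lia.
apply: runs_le; last first.
  apply: runs_straight_seq => // m1 fr1 e1.
  have nm1 := network_frame fr1 isT isT nm.
  have t1 : rmem m1 r_t 0 = V p by rewrite e1 /= /update /= mp.
  apply: runs_seq.
    exact: (gok n P k l m1 (V p) n0 n2 nm1 t1).
  move=> m2 fr2 g2; have nm2 := network_frame fr2 isT isT nm1; have [ld2 _] := nm2.
  have t2 : rmem m2 r_t 0 = V p by rewrite (fr2.2 r_t).
  have hi2 : rmem m2 r_hi 0 = rmem m r_hi 0 by rewrite (fr2.2 r_hi) // (fr1.2 r_hi).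
  apply: runs_straight_seq => // m3 fr3 e3.
  have nm3 := network_frame fr3 isT isT nm2.
  have {}g2 : greedy_output P (V p) (output m2) := g2.
  set ok := achievable P k (V p).
  have okE : beval m2 (BAnd (BILe (iv 1) (IGet 0 (ILit 1))) (BRLe (ROfI (ILit 0)) (rv r_t))) = ok.
    by rewrite /ok (greedy_achievable n0 k g2) /= t2 (loaded_k ld2) andbC.
  rewrite /= in okE.
  have ok3 : imem m3 i_ok 0 = ok.
    rewrite e3 sem_seq /= okE.
    by case: (ok) => //=; rewrite ?t2 ?hi2; case: ifP => _; rewrite /update.
  have hi3 : rmem m3 r_hi 0 = if ok then Num.min (V p) (rmem m r_hi 0) else rmem m r_hi 0.
    rewrite e3 sem_seq /= okE.
    by case: (ok) => /=; rewrite ?t2 ?hi2 //; case: leP => _; rewrite /update /= ?t2 ?hi2.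
  have t3 : rmem m3 r_t 0 = V p by rewrite (fr3.2 r_t).
  have row3 : imem m3 i_row 0 = 0%N by rewrite e3 sem_seq /=; case: ifP.
  have a3 i : imem m3 i_A i = a i by rewrite (fr3.1 i_A) // (fr2.1 i_A) // (fr1.1 i_A).
  have b3 i : imem m3 i_B i = b i by rewrite (fr3.1 i_B) // (fr2.1 i_B) // (fr1.1 i_B).
  have V3 i : rmem m3 r_V i = V i by rewrite (fr3.2 r_V) // (fr2.2 r_V) // (fr1.2 r_V).
  apply: (runs_post (Q := fun m' => (exists v c, [/\ imem m' i_row 0 = c, (c <= n)%N,
      v = (n - c)%N & forall i, (imem m' i_A i, imem m' i_B i) =
        if (i < c)%N then narrow a b V ok (V p) i else (a i, b i)]) /\
      ~~ beval m' (ilt (iv i_row) (iv 0)))).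
    move=> m' fr' [[v [c [mc cn _ Hab]]] nb].
    have [ld' _] := network_frame fr' isT isT nm3.
    have {}mc : c = n by move: nb; rewrite /= mc (loaded_n ld'); lia.
    subst c; have Ha i : (i < n)%N -> imem m' i_A i = (narrow a b V ok (V p) i).1.
      by move=> i_n; have := Hab i; rewrite i_n => <-.
    have Hb i : (i < n)%N -> imem m' i_B i = (narrow a b V ok (V p) i).2.
      by move=> i_n; have := Hab i; rewrite i_n => <-.
    have hi' : rmem m' r_hi 0 = rmem m3 r_hi 0 by rewrite (fr'.2 r_hi).
    have ehomo i c c' : (c <= c')%N -> entry P m i c <= entry P m i c'.
      by apply: entry_homo.
    case: brk => alo ahi Hrow.
    split.
    (* The median may lie outside the current bracket, hence the maximum here and the minimum taken
       for [r_hi]. *)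
    - exists (if ok then lo else Num.max lo (V p)).
        by case: (ok); rewrite // le_max lexx.
      split.
      + by case E: ok => //; case: leP => _ //; rewrite -/ok E.
      + by rewrite hi' hi3; case E: ok => //; case: leP.
      move=> i i_n; have [r1 r2 r3 r4 r5] := Hrow i i_n.
      have /andP[/andP[b1 b2] b3'] := narrow_bounds (n := n) V ok (V p) r2 r3.
      rewrite Ha // Hb //; split=> //.
      + exact: leq_trans r1 b1.
      + exact: leq_trans b3' r3.
      + move=> c c1 c2; case: (ltnP c (a i)) => ca.
          apply: le_trans (r4 c c1 ca) _; case: (ok) => //.
          by rewrite le_max lexx.
        case E: ok c2 => c2.
          move: c2; rewrite /narrow; clear -ca; clearbody a b.
          by case: ifP => _ /=; [case: ifP => _ /=|]; lia.
        rewrite le_max; apply/orP; right.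
        exact: (narrow_low ehomo Vmid i_n ca c2).
      + move=> c c1 c2; rewrite hi' hi3; case: (ltnP c (b i)) => cb; last first.
          apply: le_trans (r5 c cb c2); case: (ok) => //.
          by rewrite ge_min lexx orbT.
        case E: ok c1 => c1; last first.
          move: c1; rewrite /narrow; clear -cb; clearbody a b.
          by case: ifP => _ /=; [case: ifP => _ /=|]; lia.
        rewrite ge_min; apply/orP; left.
        exact: (narrow_high ehomo Vmid i_n cb c1).
    - by rewrite hi' hi3; case: (ok) => //; rewrite ge_min lexx orbT.
    - have := narrow_total ok pn (erefl (V p)) W1 W2.
      apply: leq_trans; rewrite leq_mul2l /=; apply: eq_leq.
      by apply: eq_big_nat => i /andP[_ i_n]; rewrite Ha // Hb.
  apply: (runs_while (v0 := n)); last first.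
    by exists 0%N; split=> // [|i]; [rewrite subn0|rewrite a3 b3].
  move=> v m4 fr4 [c [mc cn ev Hab]] bm.
  have nm4 := network_frame fr4 isT isT nm3; have [ld4 _] := nm4.
  move: bm; rewrite /= mc (loaded_n ld4) addn1 => {}cn.
  have [a4 b4] : imem m4 i_A c = a c /\ imem m4 i_B c = b c.
    by have := Hab c; rewrite ltnn => -[-> ->].
  have t4 : rmem m4 r_t 0 = V p by rewrite (fr4.2 r_t).
  have V4 i : rmem m4 r_V i = V i by rewrite (fr4.2 r_V).
  have ok4 : imem m4 i_ok 0 = ok by rewrite (fr4.1 i_ok).
  apply: runs_straight => //; exists (n - c.+1)%N; first lia.
  exists c.+1; rewrite sem_seq; set m5 := sem (If _ _ _) m4.
  have row5 : imem m5 i_row 0 = c.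
    by rewrite /m5 /=; do ![case: ifP => _ //=].
  have H5 i : (imem m5 i_A i, imem m5 i_B i) =
      if i == c then narrow a b V ok (V p) i else (imem m4 i_A i, imem m4 i_B i).
    rewrite /m5 /narrow /= mc a4 b4 addn1.
    case: (eqVneq i c) => [->|ic]; case: (ltnP (a c) (b c)) => ab /=; rewrite ?a4 ?b4 //.
      rewrite /update /= ok4 t4 V4 mc; case: (ok) => /=; case: ifP => _ /=;
      by rewrite /update /= ?mc ?eqxx ?a4 ?b4 ?addn1.
    rewrite /update /= ok4 t4 V4 mc; case: (ok) => /=; case: ifP => _ /=;
    by rewrite /update /= ?mc ?(negbTE ic).
  split=> [||//|i]; [by rewrite /= /update /= row5 addn1|by []|].
  rewrite -[(_, _)]/(imem m5 i_A i, imem m5 i_B i) H5 Hab ltnS [(i <= c)%N]leq_eqVlt.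
  by case: (eqVneq i c).
have X3 : (0 < 2 ^ l * l.+1 ^ 2)%N by rewrite muln_gt0 N0 expn_gt0.
cost.
- by apply: leq_mul (leqnn C) _; rewrite leq_mul2r nN orbT.
- apply: (costM (X := 1%N) (Y := n)); rewrite ?mul1n //; first exact: costS.
  by apply: leq_trans nN _; rewrite leq_pmulr // expn_gt0.
Qed.

Lemma bracketed_frame n (P : path_network R n) k val a0 lo c m m' : frame c m m' ->
  all (fun a => a \notin iwrites c) [:: i_A; i_B]%N -> r_hi \notin rwrites c ->
  bracketed P k val a0 lo m -> bracketed P k val a0 lo m'.
Proof.
move=> [fi fr] /and3P[iA iB _] rh; rewrite /bracketed fr // => -[H1 H2 H3].
by split=> // i i_n; rewrite !fi //; apply: H3.
Qed.

Lemma entry_frame n (P : path_network R n) c m m' : frame c m m' ->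
  all (fun a => a \notin iwrites c) [:: i_A1; i_mode]%N -> entry P m' = entry P m.
Proof.
move=> [fi fr] /and3P[i1 i2 _]; apply/funext => i; apply/funext => s.
by rewrite /entry !fi.
Qed.

Lemma search_ok : exists C, forall n (P : path_network R n) k l m a0 lo0,
  (0 < n)%N -> (n + n <= 2 ^ l)%N -> network_in_memory P k l m ->
  (forall i, (i < n)%N -> (imem m i_A1 i <= n)%N) ->
  bracketed P k (entry P m) a0 lo0 m ->
  runs search m (C * (2 ^ l * l.+1 ^ 3)) (fun m' =>
    [/\ exists2 lo, lo0 <= lo & bracketed P k (entry P m) a0 lo m',
      rmem m' r_hi 0 <= rmem m r_hi 0 &
      forall i, (i < n)%N -> (imem m' i_B i <= imem m' i_A i)%N]).
Proof.
have [C1 erok] := eval_rows_ok.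
have [C2 btok] := build_tournament_ok R.
have [C3 emok] := extract_median_ok R.
have [C4 nrok] := narrow_rows_ok.
eexists=> n P k l m a0 lo0 n0 n2 nm HA1 brk.
pose W (m' : memory R) := (\sum_(0 <= i < n) (imem m' i_B i - imem m' i_A i))%N.
apply: runs_le; last first.
  apply: runs_straight_seq => // m1 fr1 e1.
  have nm1 := network_frame fr1 isT isT nm.
  have brk1 := bracketed_frame fr1 isT isT brk.
  (* A round keeps at most 3/4 of the W <= 4^l entries left, and
     3^5 4 < 4^5, so 5 (l + 1) rounds are enough. *)
  apply: (runs_post (Q := fun m' => (exists v, (exists2 lo, lo0 <= lo &
        bracketed P k (entry P m) a0 lo m') /\
      [/\ rmem m' r_hi 0 <= rmem m r_hi 0, forall i, imem m' i_A1 i = imem m i_A1 i &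
      (exists2 v', v = v'.+1 & imem m' i_cont 0 = 1%N /\ (W m' * 3 ^ v' < 4 ^ v')%N) \/
      (imem m' i_cont 0 = 0%N /\ W m' = 0%N)]) /\ ~~ beval m' (BILe (ILit 1) (iv i_cont)))).
    move=> m' _ [[v [Hlo [Hhi _ Hc]]] nb]; split=> // i i_n.
    case: Hc => [[v' _ [mc _]]|[_ W0]]; first by rewrite /= mc in nb.
    move: W0; rewrite /W big_mkord => /eqP; rewrite sum_nat_eq0 => /forallP /(_ (Ordinal i_n)).
    by rewrite /= subn_eq0.
  apply: (runs_while (v0 := (5 * l.+1).+1)); last first.
    split; first by exists lo0.
    split; [by rewrite (fr1.2 r_hi)|by move=> i; rewrite (fr1.1 i_A1)|left].
    exists (5 * l.+1)%N => //; split; first by rewrite e1.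
    have W1 : (W m1 <= 4 ^ l)%N.
      apply: (@leq_trans (\sum_(0 <= i < n) n)%N).
        rewrite /W [leqLHS]big_nat [leqRHS]big_nat; apply: leq_sum => i /andP[_ i_n].
        by have [_ _ /(_ i i_n) [_ _ Hb _ _]] := brk1; lia.
      rewrite sum_nat_const_nat subn0 (_ : 4 = 2 ^ 2)%N // -expnM mulnC expnM -mulnn.
      by apply: leq_mul; lia.
    rewrite !expnM; apply: (@leq_ltn_trans (4 ^ l * (3 ^ 5) ^ l.+1)%N).
      by rewrite leq_mul2r W1 orbT.
    have -> : (3 ^ 5 = 243)%N by [].
    have -> : (4 ^ 5 = 1024)%N by [].
    rewrite !expnS.
    have : (4 ^ l * 243 ^ l <= 1024 ^ l)%N by rewrite -expnMn; case: (l) => // l'; rewrite leq_exp2r.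
    have : (0 < 1024 ^ l)%N by rewrite expn_gt0.
    by clear; move: (4 ^ l)%N (243 ^ l)%N (1024 ^ l)%N => x y z; nia.
  move=> v m2 fr2 [[lo lo0lo brk2] [Hhi HA Hc]] bm.
  case: Hc => [[v' -> [mc HW]]|[mc _]]; last by rewrite /= mc in bm.
  have nm2 := network_frame fr2 isT isT nm1; have [ld2 _] := nm2.
  have E2 : entry P m2 = entry P m by rewrite (entry_frame P fr2) // (entry_frame P fr1).
  apply: runs_seq.
    apply: (erok n P k l m2 n0 n2 nm2) => i i_n; rewrite HA; split; first exact: HA1.
    by have [_ _ /(_ i i_n) [_ _ Hb _ _]] := brk2.
  move=> m3 fr3 [tot3 leaf3 V3].
  have nm3 := network_frame fr3 isT isT nm2; have [ld3 _] := nm3.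
  have brk3 := bracketed_frame fr3 isT isT brk2.
  have A3 : imem m3 i_A = imem m2 i_A by apply/funext => i; rewrite (fr3.1 i_A).
  have B3 : imem m3 i_B = imem m2 i_B by apply/funext => i; rewrite (fr3.1 i_B).
  apply: runs_if; rewrite /= tot3.
    rewrite leqn0 => /eqP W0; apply: runs_straight => //; exists 0%N => //.
    split; first by exists lo => //; apply: (bracketed_frame (c := iset i_cont (ILit 0))) brk3.
    rewrite /= (fr3.2 r_hi) //; split=> // [i|]; first by rewrite /update /= (fr3.1 i_A1).
    by right; rewrite /W /= /update /= A3 B3.
  rewrite -ltnNge => W0.
  have nN : (n <= 2 ^ l)%N by lia.
  apply: runs_seq; first exact: (btok l m3 (loaded_N ld3)).
  move=> m4 fr4 [pull4 leaf4].
  have nm4 := network_frame fr4 isT isT nm3; have [ld4 _] := nm4.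
  have brk4 := bracketed_frame fr4 isT isT brk3.
  have A4 : imem m4 i_A = imem m2 i_A by rewrite -A3; apply/funext => i; rewrite (fr4.1 i_A).
  have B4 : imem m4 i_B = imem m2 i_B by rewrite -B3; apply/funext => i; rewrite (fr4.1 i_B).
  have V4 : rmem m4 r_V = rmem m3 r_V by apply/funext => i; rewrite (fr4.2 r_V).
  apply: runs_seq.
    apply: (emok n l m4 nN (loaded_N ld4) pull4).
    - by move=> i Hi; rewrite leaf4 ?leq_addr // leaf3 // A4 B4.
    - by rewrite (fr4.1 i_tot) // tot3 A4 B4.
    - by rewrite A4 B4.
  move=> m5 fr5 [p [mp pn _ W1 W2]].
  have nm5 := network_frame fr5 isT isT nm4; have [ld5 _] := nm5.
  have brk5 := bracketed_frame fr5 isT isT brk4.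
  have A5 : imem m5 i_A = imem m2 i_A by rewrite -A4; apply/funext => i; rewrite (fr5.1 i_A).
  have B5 : imem m5 i_B = imem m2 i_B by rewrite -B4; apply/funext => i; rewrite (fr5.1 i_B).
  have V5 : rmem m5 r_V = rmem m3 r_V by rewrite -V4; apply/funext => i; rewrite (fr5.2 r_V).
  have E5 : entry P m5 = entry P m.
    by rewrite (entry_frame P fr5) // (entry_frame P fr4) // (entry_frame P fr3).
  apply: runs_post (nrok n P k l m5 a0 lo p n0 n2 nm5 _ _ mp pn _ _).
  - move=> m6 fr6 [[lo' lolo' brk6] hi6 W6].
    have v'0 : (0 < v')%N by case: v' HW => // HW; rewrite /W in HW; lia.
    exists v'; first by [].
    split; first by exists lo'; [exact: le_trans lo0lo lolo'|rewrite -E5].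
    split.
    + apply: le_trans hi6 _; rewrite (fr5.2 r_hi) // (fr4.2 r_hi) // (fr3.2 r_hi) //.
    + by move=> i; rewrite (fr6.1 i_A1) // (fr5.1 i_A1) // (fr4.1 i_A1) // (fr3.1 i_A1).
    left; exists v'.-1; first by rewrite prednK.
    split.
      by rewrite (fr6.1 i_cont) // (fr5.1 i_cont) // (fr4.1 i_cont) // (fr3.1 i_cont).
    case: v' v'0 HW => // v' _; rewrite /= !expnS; move: W6; rewrite A5 B5 -/(W m2) -/(W m6).
    by nia.
  - by rewrite E5.
  - by move=> i i_n; rewrite V5 A5 B5 E5 -E2; apply: V3.
  - by move: W1; rewrite A4 B4 A5 B5 V4 V5.
  - by move: W2; rewrite A4 B4 A5 B5 V4 V5.
have X1 : (0 < 2 ^ l)%N by rewrite expn_gt0.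
have X2 : (0 < l.+1 ^ 2)%N by rewrite expn_gt0.
have X3 : (0 < 2 ^ l * l.+1 ^ 2)%N by rewrite muln_gt0 X1.
have X4 : (0 < 2 ^ l * l.+1 ^ 3)%N by rewrite muln_gt0 X1 expn_gt0.
(* The bound of 5 (l + 1) + 1 iterations is at most 6 (l + 1). *)
cost; apply: (costMM (X := (2 ^ l * l.+1 ^ 2)%N) (Y := l.+1) (B := 6)); last 2 first.
- by lia.
- by rewrite -mulnA -expnSr.
cost; apply: leq_mul (leqnn _) _; first by rewrite leq_pmulr.
by rewrite leq_mul2l expnS leq_pmulr ?orbT.
Qed.

End Search.

(** * Minimality of the cost found *)

Section Optimality.
Variables (R : realType) (n : nat) (P : path_network R n) (k : nat).
Hypothesis n_gt0 : (0 < n)%N.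
Implicit Types t : R.

(** The greedy subpath from i has cost at most t' and ends at or after i', so [next_dominates]
    applies to it. *)
Lemma jnext_homo t t' i i' : 0 <= t -> t <= t' -> (i <= i')%N -> (i' <= jnext P t i)%N ->
  (i < n)%N -> (jnext P t i <= jnext P t' i')%N.
Proof.
move=> t0 tt ii ij i_n; have [H1 H2] := @next_evacuation _ _ P n_gt0 t i t0 i_n.
have [|_] := next_dominates n_gt0 (t := t') ii ij (jnext_lt P n_gt0 t i_n) H1; last by [].
by apply: le_trans H2 _; rewrite lee_fin.
Qed.

(** Comparing the greedy choices, rather than t and t', allows feasibility to be carried down from a
    cost inside the gap to [lo]. *)
Lemma achievable_next t t' : 0 <= t' ->
  (forall i, (i < n)%N -> (jnext P t i <= jnext P t' i)%N) ->
  achievable P k t -> achievable P k t'.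
Proof.
move=> t'0 H /andP[_ tk]; rewrite /achievable t'0 /=.
suff : (minn n (start P t k) <= start P t' k)%N by lia.
elim: (k) => [|q IH]; first by rewrite /start /= minn0.
have lt' := start_lt P t' q; case: (ltnP (start P t q) n) => tn; last by lia.
case: (ltnP (start P t' q) n) => t'n; last by lia.
rewrite /start !iterS -!/(start _ _ _) /next_start geq_min ltnS; apply/orP; right.
have Hq := H _ tn; case: (leqP (start P t' q) (jnext P t (start P t q))) => Hj.
  apply: leq_trans Hq _; apply: jnext_homo => //; first lia.
  exact: leq_trans Hj (H _ tn).
by apply: leq_trans (ltnW Hj) _; rewrite -ltnS; exact: next_gt.
Qed.

Lemma achievable_homo t t' : t <= t' -> achievable P k t -> achievable P k t'.
Proof.
move=> tt a; have /andP[t0 _] := a; apply: (achievable_next (le_trans t0 tt)) a => i i_n.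
apply: jnext_homo => //.
exact: leq_trans (snext_ge P t i) (jnext_ge P t i).
Qed.

(** The initial feasible cost of the search: a single sink at the last vertex. *)
Lemma achievable_single : (0 < k)%N -> achievable P k (lc P 0 n.-1).
Proof.
move=> k0; rewrite /achievable lcost_ge0 /=; apply: leq_trans (start_homo P _ k0).
have := @snext_max _ _ P n_gt0 (lc P 0 n.-1) 0%N n.-1 isT ltac:(lia) (lexx _).
have := jnext_ge P (lc P 0 n.-1) 0; rewrite /start /= /next_start; lia.
Qed.

Section Gap.
Variables (A1 A : nat -> nat) (lo hi : R).
Hypothesis lo_infeasible : ~~ achievable P k lo.
Hypothesis A1_bounds : forall i, (i < n)%N -> (i <= A1 i)%N && (A1 i <= A i <= n)%N.
Hypothesis lc_lo : forall i c, (i < n)%N -> (i <= c < A1 i)%N -> lc P i c <= lo.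
Hypothesis lc_hi : forall i c, (i < n)%N -> (A1 i <= c < n)%N -> hi <= lc P i c.
Hypothesis reach_lo : forall i c, (i < n)%N -> (A1 i <= c < A i)%N -> reach P i (A1 i).-1 c <= lo.
Hypothesis reach_hi : forall i c, (i < n)%N -> (A i <= c < n)%N -> hi <= reach P i (A1 i).-1 c.

(** Otherwise the entry lc i i = 0 would be at least [hi]. This makes A1 i - 1 a genuine base vertex
    for row i. *)
Lemma gap_base t i : 0 <= t -> t < hi -> (i < n)%N -> (i < A1 i)%N.
Proof.
move=> t0 thi i_n; rewrite ltnNge; apply/negP => Ai.
have := lc_hi (c := i) i_n ltac:(lia); rewrite /lc lcost_nil //.
by rewrite leNgt (le_lt_trans t0).
Qed.

Lemma snext_gap t i : 0 <= t -> lo <= t -> t < hi -> (i < n)%N -> snext P t i = (A1 i).-1.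
Proof.
move=> t0 lot thi i_n; have iA := gap_base t0 thi i_n.
have /andP[_ /andP[AA An]] := A1_bounds i_n.
apply/eqP; rewrite eqn_leq; apply/andP; split.
  suff : (snext P t i < A1 i)%N by lia.
  rewrite ltnNge; apply/negP => H; have sn := snext_lt P n_gt0 t i_n.
  have := lc_hi (c := snext P t i) i_n ltac:(lia); have := snext_le P i t0; lra.
apply: snext_max => //; [lia|lia|].
by apply: le_trans lot; apply: lc_lo => //; lia.
Qed.

Lemma jnext_gap t i : 0 <= t -> lo <= t -> t < hi -> (i < n)%N -> jnext P t i = (A i).-1.
Proof.
move=> t0 lot thi i_n; have iA := gap_base t0 thi i_n.
have /andP[_ /andP[AA An]] := A1_bounds i_n.
have sE := snext_gap t0 lot thi i_n; have sj := jnext_ge P t i.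
apply/eqP; rewrite eqn_leq; apply/andP; split.
  suff : (jnext P t i < A i)%N by lia.
  rewrite ltnNge; apply/negP => H; have jn := jnext_lt P n_gt0 t i_n.
  have := reach_hi (c := jnext P t i) i_n ltac:(lia).
  by have := @jnext_le _ _ P t i ltac:(lia); rewrite sE; lra.
case: (leqP (A i).-1 (A1 i).-1) => H; first by lia.
apply: jnext_max => //; rewrite ?sE //; [lia|lia|].
by apply: le_trans lot; apply: reach_lo => //; lia.
Qed.

(** The greedy choices are constant on the interval from [lo] included to [hi] excluded; a feasible
    cost inside it would therefore make [lo] feasible. *)
Lemma gap_minimal t : achievable P k t -> hi <= t.
Proof.
move=> a; rewrite leNgt; apply/negP => thi; have /andP[t0 _] := a.
case: (leP t lo) => tlo; first by move/negP: lo_infeasible; apply; apply: achievable_homo a.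
(* The search starts from the infeasible cost -1, but the entry lc 0 0 = 0 lies before A1 0 and so
   is at most [lo]. *)
have lo0 : 0 <= lo.
  have := lc_lo (c := 0%N) n_gt0; rewrite /lc lcost_nil //; apply.
  exact: gap_base t0 thi n_gt0.
move/negP: lo_infeasible; apply; apply: (achievable_next lo0) a => i i_n.
by rewrite !jnext_gap // ?(ltW tlo) // (lt_trans tlo).
Qed.

End Gap.
End Optimality.

(** * The complete program *)

Notation i_h := 36%N.
Notation r_w := 24%N.
Notation r_l := 25%N.
Notation r_c := 26%N.

Definition load_size : cmd :=
  iset i_N (ILit 1) ;;
  While (ilt (iv i_N) (iv 0 ⊞ iv 0)) (iset i_N (iv i_N ⊞ iv i_N)).

(** Input cells read out of range hold 0, like the defaults of [nth] in the doubled path; the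
    inverse of a zero capacity is 0 for the machine as it is in [dr]. *)
Definition fetch : cmd :=
  If (ilt (iv i_h) (iv 0))
    (rset r_w (RGet 0 (iv i_h)) ;; rset r_l (RGet 1 (iv i_h)) ;; rset r_c (RGet 2 (iv i_h)))
    (If (ilt (iv i_h) (iv 0 ⊞ iv 0))
       (rset r_w (RGet 0 (iv 0 ⊞ iv 0 ⊟ ILit 1 ⊟ iv i_h)) ;;
        rset r_l (RGet 1 (iv 0 ⊞ iv 0 ⊟ ILit 2 ⊟ iv i_h)) ;;
        rset r_c (RGet 2 (iv 0 ⊞ iv 0 ⊟ ILit 2 ⊟ iv i_h)))
       (rset r_w (ROfI (ILit 1)) ;; rset r_l (ROfI (ILit 0)) ;; rset r_c (ROfI (ILit 0)))).

Definition load_arrays : cmd :=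
  iset i_h (ILit 0) ;;
  While (ilt (iv i_h) (iv i_N))
    (fetch ;;
     (RSet r_S (iv i_h ⊞ ILit 1) (RGet r_S (iv i_h) ⊕ rv r_w) ;;
      RSet r_E (iv i_h ⊞ ILit 1) (RGet r_E (iv i_h) ⊕ rv r_l ⊗ rv r_tau) ;;
      RSet r_rho (iv i_N ⊞ iv i_h) (ROfI (ILit 1) ⊘ rv r_c) ;;
      iset i_h (iv i_h ⊞ ILit 1))).

Definition initial_rows : cmd :=
  query_at (ILit 0) (iv 0 ⊟ ILit 1) ;;
  (rset r_hi (rv r_qr) ;; iset i_row (ILit 0)) ;;
  While (ilt (iv i_row) (iv 0))
    (ISet i_A (iv i_row) (iv i_row) ;; ISet i_B (iv i_row) (iv 0) ;;
     iset i_row (iv i_row ⊞ ILit 1)).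

(** [i_A] keeps its values: a greedy subpath always reaches its base vertex A1 i - 1, so the
    undecided ends j of row i start at column A1 i. *)
Definition reach_rows : cmd :=
  (iset i_mode (ILit 1) ;; iset i_row (ILit 0)) ;;
  While (ilt (iv i_row) (iv 0))
    (ISet i_A1 (iv i_row) (IGet i_A (iv i_row)) ;; ISet i_B (iv i_row) (iv 0) ;;
     iset i_row (iv i_row ⊞ ILit 1)).

Definition k_sink : cmd :=
  load_size ;; load_arrays ;; build_tree ;; initial_rows ;; search ;; reach_rows ;; search ;;
  rset r_t (rv r_hi) ;; greedy.

Section Main.
Variable R : realType.
Implicit Types (m : memory R).

Lemma load_size_ok : exists C, forall n (P : path_network R n) k, (0 < n)%N ->
  runs load_size (input P k) (C * n) (fun m => exists l,
    [/\ imem m i_N 0 = (2 ^ l)%N, (n + n <= 2 ^ l)%N & (2 ^ l < 4 * n)%N]).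
Proof.
eexists=> n P k n0.
apply: runs_le; last first.
  apply: runs_straight_seq => // m1 fr1 e1.
  have n1 : imem m1 0 0 = n by rewrite (fr1.1 0%N).
  apply: (runs_post (Q := fun m' => (exists v l, [/\ imem m' i_N 0 = (2 ^ l)%N,
     (2 ^ l < 4 * n)%N & v = (n + n - 2 ^ l)%N]) /\
     ~~ beval m' (ilt (iv i_N) (iv 0 ⊞ iv 0)))).
    move=> m' fr [[v [l [mN lt _]]] nb]; exists l; split=> //.
    by move: nb; rewrite /= mN (fr.1 0%N) // n1; lia.
  apply: (runs_while (v0 := (n + n - 1)%N)); last first.
    by exists 0%N; rewrite e1 /= /update /=; split=> //; lia.
  move=> v m2 fr2 [l [mN lt ev]] bm; move: bm; rewrite /= mN (fr2.1 0%N) // n1 => lt2.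
  apply: runs_straight => //.
  have l0 : (0 < 2 ^ l)%N by rewrite expn_gt0.
  exists (n + n - 2 ^ l.+1)%N; first by rewrite expnS; lia.
  by exists l.+1; rewrite /= /update /= mN expnS; split=> //; lia.
cost.
by apply: (costMM (X := 1%N) (Y := n) (B := 2)); [exact: costS|lia|lia].
Qed.

Lemma load_arrays_ok : exists C, forall n (P : path_network R n) k l m, (0 < n)%N ->
  frame load_size (input P k) m -> imem m i_N 0 = (2 ^ l)%N ->
  runs load_arrays m (C * 2 ^ l)
    (fun m' => loaded (dS P) (dE P) (dr P) n k l (transit_time P) m').
Proof.
eexists=> n P k l m n0 fr mN.
have N0 : (0 < 2 ^ l)%N by rewrite expn_gt0.
apply: runs_le; last first.
  apply: runs_straight_seq => // m1 fr1 e1.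
  have i0 i : imem m1 0 i = nth 0%N [:: n; k] i by rewrite (fr1.1 0%N) // (fr.1 0%N).
  have N1 : imem m1 i_N 0 = (2 ^ l)%N by rewrite (fr1.1 i_N).
  have R1 a i : rmem m1 a i = rmem (input P k) a i by rewrite (fr1.2 a) // (fr.2 a).
  apply: (runs_post (Q := fun m' => (exists v h, [/\ imem m' i_h 0 = h, (h + v = 2 ^ l)%N,
     forall j, (j <= h)%N -> rmem m' r_S j = dS P j,
     forall j, (j <= h)%N -> rmem m' r_E j = dE P j &
     forall j, (j < h)%N -> rmem m' r_rho (2 ^ l + j) = dr P j]) /\
     ~~ beval m' (ilt (iv i_h) (iv i_N)))).
    move=> m' fr' [[v [h [mh hv HS HE Hr]]] nb].
    have mN' : imem m' i_N 0 = (2 ^ l)%N by rewrite (fr'.1 i_N).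
    have eh : h = (2 ^ l)%N by move: nb; rewrite /= mh mN'; lia.
    rewrite eh in HS HE Hr.
    by split=> //; rewrite ?(fr'.1 0%N) ?(fr'.2 r_tau) // ?i0 ?R1.
  apply: (runs_while (v0 := (2 ^ l)%N)); last first.
    exists 0%N; rewrite e1 /= /update /=; split=> // j; rewrite leqn0 => /eqP ->.
    - by rewrite (fr.2 r_S) //= /dS big_nil.
    - by rewrite (fr.2 r_E) //= /dE big_nil.
  move=> v m2 fr2 [h [mh hv HS HE Hr]] bm.
  have N2 : imem m2 i_N 0 = (2 ^ l)%N by rewrite (fr2.1 i_N).
  move: bm; rewrite /= mh N2 addn1 => hN.
  have m20 i : imem m2 0 i = nth 0%N [:: n; k] i by rewrite (fr2.1 0%N).
  have R2 a i : a \notin [:: r_S; r_E; r_rho; r_w; r_l; r_c]%N ->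
      rmem m2 a i = rmem (input P k) a i.
    move=> Ha; rewrite (fr2.2 a) ?R1 //=; move: Ha; rewrite !inE; lia.
  apply: runs_straight_seq => // m3 fr3 e3.
  have [w3 l3 c3] : [/\ rmem m3 r_w 0 = (dweight P h)%:R, rmem m3 r_l 0 = dlength P h &
      rmem m3 r_c 0 = dcapacity P h].
    rewrite e3 /= mh m20 /= !addn1 /dweight /dlength /dcapacity.
    case: ifP => _; [|case: ifP => _]; rewrite /= /update /= ?mh ?m20 /= ?R2 //.
  have h3 : imem m3 i_h 0 = h by rewrite (fr3.1 i_h).
  have N3 : imem m3 i_N 0 = (2 ^ l)%N by rewrite (fr3.1 i_N).
  have t3 : rmem m3 r_tau 0 = transit_time P by rewrite (fr3.2 r_tau) // R2.
  have S3 j : rmem m3 r_S j = rmem m2 r_S j by rewrite (fr3.2 r_S).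
  have E3 j : rmem m3 r_E j = rmem m2 r_E j by rewrite (fr3.2 r_E).
  have r3 j : rmem m3 r_rho j = rmem m2 r_rho j by rewrite (fr3.2 r_rho).
  apply: runs_straight => //; exists v.-1; first lia.
  exists h.+1; rewrite /= /update /= h3 N3 w3 l3 c3 t3 S3 E3 !addn1; split=> //; first lia.
  - move=> j jh; rewrite S3; case: eqP => [->|ne]; last by apply: HS; lia.
    by rewrite HS // dS_S.
  - move=> j jh; rewrite E3; case: eqP => [->|ne]; last by apply: HE; lia.
    by rewrite HE // dE_S.
  - move=> j jh; rewrite r3 eqn_add2l; case: eqP => [->|ne]; last by apply: Hr; lia.
    by rewrite /dr div1r.
by cost; apply: (costM (X := 1%N) (Y := (2 ^ l)%N)); rewrite ?mul1n //; exact: costS.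
Qed.

Lemma initial_rows_ok : exists C, forall n (P : path_network R n) k l m,
  (0 < n)%N -> (0 < k)%N -> (n + n <= 2 ^ l)%N -> network_in_memory P k l m ->
  runs initial_rows m (C * (2 ^ l * l.+1 ^ 2))
    (fun m' => bracketed P k (lc P) id (-1) m').
Proof.
have [C qok] := query_at_ok R (ILit 0) (iv 0 ⊟ ILit 1).
eexists=> n P k l m n0 k0 n2 nm.
have N0 : (0 < 2 ^ l)%N by rewrite expn_gt0.
apply: runs_le; last first.
  have [ld _] := nm.
  apply: runs_seq.
    apply: (qok n P k l m 0%N n.-1 n0 nm) => //; last by lia.
    by rewrite /= /update /= (loaded_n ld) subn1.
  move=> m1 fr1 q1; have nm1 := network_frame fr1 isT isT nm.
  apply: runs_straight_seq => // m2 fr2 e2.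
  have nm2 := network_frame fr2 isT isT nm1.
  have hi2 : rmem m2 r_hi 0 = lc P 0 n.-1 by rewrite e2 /= /update /= q1.
  apply: (runs_post (Q := fun m' => (exists v c, [/\ imem m' i_row 0 = c, (c + v = n)%N &
      forall i, (i < c)%N -> imem m' i_A i = i /\ imem m' i_B i = n]) /\
      ~~ beval m' (ilt (iv i_row) (iv 0)))).
    move=> m' fr' [[v [c [mc cv HAB]]] nb].
    have [ld' _] := network_frame fr' isT isT nm2.
    have ec : c = n by move: nb; rewrite /= mc (loaded_n ld'); lia.
    rewrite {}ec in HAB; split.
    - by rewrite /achievable lerNr oppr0 ler10.
    - by rewrite (fr'.2 r_hi) // hi2; exact: achievable_single.
    by move=> i i_n; have [-> ->] := HAB i i_n; split; rewrite ?leqnn ?(ltnW i_n) // => c'; lia.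
  apply: (runs_while (v0 := n)); last first.
    by exists 0%N; rewrite e2 /= /update /=.
  move=> v m3 fr3 [c [mc cv HAB]] bm.
  have [ld3 _] := network_frame fr3 isT isT nm2.
  move: bm; rewrite /= mc (loaded_n ld3) addn1 => cn.
  apply: runs_straight => //; exists v.-1; first lia.
  exists c.+1; rewrite /= /update /= mc (loaded_n ld3) addn1; split=> //; first lia.
  by move=> i ic; case: (eqVneq i c) => [->//|ne]; apply: HAB; lia.
have X2 : (0 < l.+1 ^ 2)%N by rewrite expn_gt0.
have X3 : (0 < 2 ^ l * l.+1 ^ 2)%N by rewrite muln_gt0 N0.
cost.
  by apply: leq_mul (leqnn _) _; rewrite leq_pmull.
apply: (costM (X := 1%N) (Y := n)); rewrite ?mul1n; first exact: costS; first by [].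
by apply: (@leq_trans (2 ^ l)); [lia|rewrite leq_pmulr].
Qed.

Lemma reach_rows_ok : exists C, forall n (P : path_network R n) k l m lo,
  (0 < n)%N -> (n + n <= 2 ^ l)%N -> network_in_memory P k l m ->
  bracketed P k (lc P) id lo m ->
  runs reach_rows m (C * (2 ^ l * l.+1 ^ 2)) (fun m' =>
    [/\ bracketed P k (entry P m') (imem m i_A) lo m', imem m' i_mode 0 = 1%N &
     forall i, (i < n)%N -> imem m' i_A1 i = imem m i_A i]).
Proof.
eexists=> n P k l m lo n0 n2 nm brk.
have N0 : (0 < 2 ^ l)%N by rewrite expn_gt0.
apply: runs_le; last first.
  apply: runs_straight_seq => // m1 fr1 e1.
  have nm1 := network_frame fr1 isT isT nm.
  apply: (runs_post (Q := fun m' => (exists v c, [/\ imem m' i_row 0 = c, (c + v = n)%N &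
      forall i, (i < c)%N -> imem m' i_A1 i = imem m i_A i /\ imem m' i_B i = n]) /\
      ~~ beval m' (ilt (iv i_row) (iv 0)))).
    move=> m' fr' [[v [c [mc cv HAB]]] nb].
    have [ld' _] := network_frame fr' isT isT nm1.
    have ec : c = n by move: nb; rewrite /= mc (loaded_n ld'); lia.
    have mode' : imem m' i_mode 0 = 1%N by rewrite (fr'.1 i_mode) // e1.
    rewrite {}ec in HAB; split=> //; last by move=> i /HAB[].
    case: brk => H1 H2 H3; split=> //.
    - by rewrite (fr'.2 r_hi) // (fr1.2 r_hi).
    move=> i i_n; have [_ ->] := HAB i i_n; have [_ An _ _ _] := H3 i i_n.
    by rewrite (fr'.1 i_A) // (fr1.1 i_A) //; split; rewrite ?leqnn // => c'; lia.
  apply: (runs_while (v0 := n)); last first.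
    by exists 0%N; rewrite e1 /= /update /=.
  move=> v m3 fr3 [c [mc cv HAB]] bm.
  have [ld3 _] := network_frame fr3 isT isT nm1.
  move: bm; rewrite /= mc (loaded_n ld3) addn1 => cn.
  have A3 : imem m3 i_A c = imem m i_A c by rewrite (fr3.1 i_A) // (fr1.1 i_A).
  apply: runs_straight => //; exists v.-1; first lia.
  exists c.+1; rewrite /= /update /= mc A3 (loaded_n ld3) addn1; split=> //; first lia.
  by move=> i ic; case: (eqVneq i c) => [->//|ne]; apply: HAB; lia.
have X2 : (0 < l.+1 ^ 2)%N by rewrite expn_gt0.
have X3 : (0 < 2 ^ l * l.+1 ^ 2)%N by rewrite muln_gt0 N0.
cost.
apply: (costM (X := 1%N) (Y := n)); rewrite ?mul1n; first exact: costS; first by [].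
by apply: (@leq_trans (2 ^ l)); [lia|rewrite leq_pmulr].
Qed.

Lemma k_sink_ok : exists C, forall n (P : path_network R n) k, (0 < n)%N -> (0 < k)%N ->
  exists2 l, (2 ^ l < 4 * n)%N &
  runs k_sink (input P k) (C * (2 ^ l * l.+1 ^ 3)) (fun m' => optimal_k_sink P k (output m')).
Proof.
have [C1 lsok] := load_size_ok.
have [C2 laok] := load_arrays_ok.
have [C3 btok] := build_tree_ok R.
have [C4 irok] := initial_rows_ok.
have [C5 sok] := search_ok R.
have [C6 rrok] := reach_rows_ok.
have [C7 gok] := greedy_ok R.
eexists=> n P k n0 k0.
(* The exponent l only comes out of the run of [load_size], which is therefore opened before the
   bound in l can be stated. *)
have [t1 [m1 [ex1 le1 [l [mN n2 N4]]]]] := lsok n P k n0.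
exists l => //.
have N0 : (0 < 2 ^ l)%N by rewrite expn_gt0.
have nN : (n <= 2 ^ l)%N by lia.
apply: runs_le; last first.
  apply: (runs_seq (Q1 := fun m' => m' = m1)).
    by exists t1, m1; split; [exact: ex1|exact: le1|].
  move=> m1' /[swap] -> fr1.
  have A1_1 i : imem m1 i_A1 i = 0%N by rewrite (fr1.1 i_A1).
  have mode1 : imem m1 i_mode 0 = 0%N by rewrite (fr1.1 i_mode).
  apply: runs_seq; first exact: (laok n P k l m1 n0 fr1 mN).
  move=> m2 fr2 ld2; apply: runs_seq.
    exact: (btok _ _ _ n k l _ (network_admissible P n0) m2 ld2).
  move=> m3 fr3 nm3; apply: runs_seq.
    exact: (irok n P k l m3 n0 k0 n2 nm3).
  move=> m4 fr4 brk4; have nm4 := network_frame fr4 isT isT nm3.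
  have A1_4 i : imem m4 i_A1 i = 0%N by rewrite (fr4.1 i_A1) // (fr3.1 i_A1) // (fr2.1 i_A1).
  have mode4 : imem m4 i_mode 0 = 0%N.
    by rewrite (fr4.1 i_mode) // (fr3.1 i_mode) // (fr2.1 i_mode).
  have E4 : entry P m4 = lc P by apply/funext => i; apply/funext => c; rewrite /entry mode4.
  apply: runs_seq.
    by apply: (sok n P k l m4 id (-1) n0 n2 nm4) => [i _|]; rewrite ?A1_4 ?E4.
  move=> m5 fr5 [[lo5 _ brk5] _ BA5]; rewrite E4 in brk5.
  have nm5 := network_frame fr5 isT isT nm4.
  apply: runs_seq; first exact: (rrok n P k l m5 lo5 n0 n2 nm5 brk5).
  move=> m6 fr6 [brk6 mode6 A1_6]; have nm6 := network_frame fr6 isT isT nm5.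
  have hi6 : rmem m6 r_hi 0 = rmem m5 r_hi 0 by rewrite (fr6.2 r_hi).
  case: (brk5) => _ _ row5.
  apply: runs_seq.
    apply: (sok n P k l m6 (imem m5 i_A) lo5 n0 n2 nm6 _ brk6) => i i_n.
    by rewrite A1_6 //; have [] := row5 i i_n.
  move=> m7 fr7 [[lo7 lo57 brk7] hi7 BA7]; have nm7 := network_frame fr7 isT isT nm6.
  case: (brk7) => lo7i hi7a row7.
  apply: runs_straight_seq => // m8 fr8 e8; have nm8 := network_frame fr8 isT isT nm7.
  have t8 : rmem m8 r_t 0 = rmem m7 r_hi 0 by rewrite e8.
  apply: runs_post (gok n P k l m8 _ n0 n2 nm8 t8) => m9 _ g9.
  apply: (achievable_optimal n0 g9 hi7a) => t.
  have E6 i c : (i < n)%N -> entry P m6 i c = reach P i (imem m5 i_A i).-1 c.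
    by move=> i_n; rewrite /entry mode6 A1_6.
  apply: (gap_minimal n0 (A1 := imem m5 i_A) (A := imem m7 i_A) lo7i) => i.
  - by move=> i_n; have [-> _ _ _ _] := row5 i i_n; have [-> -> _ _ _] := row7 i i_n.
  - move=> c i_n /andP[c1 c2]; apply: le_trans lo57.
    by have [_ _ _ H _] := row5 i i_n; apply: H.
  - move=> c i_n /andP[c1 c2]; apply: le_trans hi7 _; rewrite hi6.
    have [_ _ _ _ H] := row5 i i_n; apply: H => //.
    exact: leq_trans (BA5 i i_n) c1.
  - move=> c i_n /andP[c1 c2]; rewrite -E6 //.
    by have [_ _ _ H _] := row7 i i_n; apply: H.
  - move=> c i_n /andP[c1 c2]; rewrite -E6 //.
    have [_ _ _ _ H] := row7 i i_n; apply: H => //.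
    exact: leq_trans (BA7 i i_n) c1.
have X2 : (0 < l.+1 ^ 2)%N by rewrite expn_gt0.
have X3 : (0 < 2 ^ l * l.+1 ^ 3)%N by rewrite muln_gt0 N0 expn_gt0.
have X4 : (2 ^ l * l.+1 ^ 2 <= 2 ^ l * l.+1 ^ 3)%N by rewrite leq_mul2l [leqRHS]expnS leq_pmull ?orbT.
cost; apply: leq_mul (leqnn _) _ => //.
- by apply: leq_trans nN _; rewrite leq_pmulr ?expn_gt0.
- by rewrite leq_pmulr ?expn_gt0.
- by apply: leq_trans X4; rewrite leq_mul2r nN orbT.
Qed.

End Main.

(** * Asymptotic form of the time bound *)

Lemma trunc_log_le_ln (R : realType) n : (0 < n)%N ->
  (trunc_log 2 n)%:R * ln 2 <= ln n%:R :> R.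
Proof.
move=> n0; rewrite mulrC mulr_natr -lnXn // ler_ln ?posrE ?exprn_gt0 ?ltr0n //.
by rewrite -natrX ler_nat trunc_logP.
Qed.

Lemma size_bound n l : (2 ^ l < 4 * n)%N -> (l < trunc_log 2 n + 3)%N.
Proof.
move=> H; rewrite -(ltn_exp2l l _ (isT : 1 < 2)%N); apply: ltn_trans H _.
by have := @trunc_log_ltn 2 n isT; rewrite -addnS expnD expnS; lia.
Qed.

Lemma time_eqO (R : realType) C :
  (fun n : nat => (C * (4 * n * (trunc_log 2 n + 3) ^ 3))%:R : R^o) =O_\oo
    (fun n : nat => n%:R * ln n%:R ^+ 3 : R^o).
Proof.
apply/eqO_exP; have l2 : 0 < ln 2 :> R by rewrite ln_gt0 // ltr1n.
(* For n >= 2 the binary logarithm is at least 1, so adding 3 at most quadruples it; this gives 4 /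
   ln 2. The final 1 keeps the constant positive. *)
exists (C%:R * (4 * (4 / ln 2) ^+ 3) + 1).
  by rewrite ltr_wpDl // mulr_ge0 // mulr_ge0 // exprn_ge0 // divr_ge0 // ltW.
near=> n.
have n2 : (2 <= n)%N by near: n; exact: nbhs_infty_ge.
have t1 : (0 < trunc_log 2 n)%N by rewrite trunc_log_gt0.
have lnn0 : 0 <= ln n%:R :> R by rewrite ln_ge0 // ler1n; lia.
have tl : (trunc_log 2 n + 3)%:R <= (4 / ln 2) * ln n%:R :> R.
  apply: (@le_trans _ _ (4 * (trunc_log 2 n)%:R)); first by rewrite -natrM ler_nat; lia.
  rewrite mulrAC ler_pdivlMr // -mulrA ler_wpM2l //.
  by apply: trunc_log_le_ln; lia.
rewrite !ger0_norm ?mulr_ge0 ?exprn_ge0 //.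
apply: (@le_trans _ _ (C%:R * (4 * (4 / ln 2) ^+ 3) * (n%:R * ln n%:R ^+ 3))); last first.
  by rewrite ler_wpM2r ?mulr_ge0 ?exprn_ge0 // lerDl.
have -> : C%:R * (4 * (4 / ln 2) ^+ 3) * (n%:R * ln n%:R ^+ 3) =
    C%:R * (4 * n%:R * (4 / ln 2 * ln n%:R) ^+ 3) :> R by ring.
rewrite natrM [(4 * n * _)%:R]natrM [(4 * n)%:R]natrM natrX.
by rewrite !ler_wpM2l ?mulr_ge0 // lerXn2r ?nnegrE ?mulr_ge0 ?invr_ge0 // ltW.
Unshelve. all: by end_near.
Qed.

Theorem theorem3 (R : realType) :
  exists (p : cmd) (T : nat -> nat),
    (forall (n k : nat) (P : path_network R n), (0 < n)%N -> (0 < k)%N ->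
       exists (t : nat) (m : memory R),
         [/\ exec p (input P k) t m,
             (t <= T n)%N &
             optimal_k_sink P k (output m)]) /\
    (fun n : nat => (T n)%:R : R^o) =O_\oo
      (fun n : nat => n%:R * ln n%:R ^+ 3 : R^o).
Proof.
have [C ok] := k_sink_ok R.
exists k_sink, (fun n => C * (4 * n * (trunc_log 2 n + 3) ^ 3))%N; split; last exact: time_eqO.
move=> n k P n0 k0; have [l ln4 [t [m [ex tC opt]]]] := ok n P k n0 k0.
exists t, m; split=> //; apply: leq_trans tC _; rewrite leq_mul2l; apply/orP; right.
by apply: leq_mul; [exact: ltnW|rewrite leq_exp2r // size_bound].
Qed.
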